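(* Let $q$ be a (complex-valued) function with $q,q_1\in L^\infty(\mathbb R)$, where $q_1(x)=\int_0^xq(t)dt$. Then: (i) For every $\lambda\in\mathbb C$ there exist unique solutions $\psi_\pm(x,\lambda)$ of $-y''+(x^2+q(x))y=\lambda y$ satisfying, as $x\to\pm\infty$ and locally uniformly in $\lambda$, $$\psi_\pm(x,\lambda)=(\pm\sqrt2x)^{\frac{\lambda-1}2}e^{-x^2/2}(1+o(1)),\qquad \psi_\pm'(x,\lambda)=-x(\pm\sqrt2x)^{\frac{\lambda-1}2}e^{-x^2/2}(1+o(1)).$$ Moreover, for each fixed $x\in\mathbb R$ the functions $\lambda\mapsto\psi_\pm(x,\lambda)$, $\lambda\mapsto\psi_\pm'(x,\lambda)$ and the Wronskian $w(\lambda)=\psi_-\psi_+'-\psi_-'\psi_+$ are entire. (ii) If $q$ is real-valued, then the operator $T=-\frac{d^2}{dx^2}+x^2+q(x)$ on $L^2(\mathbb R)$ has only simple eigenvalues.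
   Context: Powers $z^\alpha$ use the principal branch. The derivative $'$ is with respect to $x$. *)

(* Defs.v *)
From HB Require Import structures.
From mathcomp Require Import all_boot all_order all_algebra.
From mathcomp Require Import all_classical all_reals all_analysis.
From mathcomp Require Import complex.
Import Order.TTheory GRing.Theory Num.Theory numFieldNormedType.Exports.
Set Implicit Arguments. Unset Strict Implicit. Unset Printing Implicit Defensive.
Local Open Scope ring_scope.
Local Open Scope complex_scope.

(* The complex numbers over a real type R, seen as a numClosedFieldType
   (hence a normed module over itself: derivable = complex differentiable). *)
Definition Cplx (R : realType) : numClosedFieldType := R[i].

Section Defs.
Context {R : realType}.
Local Notation C := (Cplx R).
Local Notation mu := (@lebesgue_measure R).

Definition cRe (z : C) : R := complex.Re z.
Definition cIm (z : C) : R := complex.Im z.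
Definition cabs (z : C) : R := Num.sqrt (cRe z ^+ 2 + cIm z ^+ 2).

Definition cint (f : R -> C) (a b : R) : C :=
  Complex (Rintegral mu `[a, b] (cRe \o f)) (Rintegral mu `[a, b] (cIm \o f)).

Definition oint (f : R -> C) (a b : R) : C :=
  if a <= b then cint f a b else - cint f b a.

Definition loc_integrable (f : R -> C) : Prop :=
  forall a b : R, mu.-integrable `[a, b] (EFin \o (cRe \o f)) /\
                  mu.-integrable `[a, b] (EFin \o (cIm \o f)).

Definition Linfty (f : R -> C) : Prop :=
  [/\ measurable_fun setT (cRe \o f), measurable_fun setT (cIm \o f) &
      exists M : R, \forall x \ae mu, cabs (f x) <= M].

Definition L2 (f : R -> C) : Prop :=
  [/\ measurable_fun setT (cRe \o f), measurable_fun setT (cIm \o f) &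
      mu.-integrable setT (fun x => (cabs (f x) ^+ 2)%:E)].

Definition prim (q : R -> C) : R -> C := fun x => oint q 0 x.

Definition coef (q : R -> C) (l : C) : R -> C := fun t => (t ^+ 2)%:C + q t - l.

(* (y, dy) is a (Caratheodory) solution of -y'' + (x^2 + q(x)) y = l y, with
   dy = y' :  y is absolutely continuous with y' = dy, dy is absolutely
   continuous with dy' = (x^2 + q - l) y almost everywhere. *)
Definition ode_sol (q : R -> C) (l : C) (y dy : R -> C) : Prop :=
  [/\ loc_integrable dy, loc_integrable (fun t => coef q l t * y t),
      forall x, y x = y 0 + oint dy 0 x &
      forall x, dy x = dy 0 + oint (fun t => coef q l t * y t) 0 x].

Definition cexp (z : C) : C :=
  (expR (cRe z))%:C * Complex (cos (cIm z)) (sin (cIm z)).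

Definition cpowR (b : R) (a : C) : C := cexp (a * (ln b)%:C).

Definition pref_p (l : C) (x : R) : C :=
  cpowR (Num.sqrt 2 * x) ((l - 1) / 2) * (expR (- (x ^+ 2) / 2))%:C.
Definition pref_m (l : C) (x : R) : C :=
  cpowR (- (Num.sqrt 2 * x)) ((l - 1) / 2) * (expR (- (x ^+ 2) / 2))%:C.
Definition dpref_p (l : C) (x : R) : C := - x%:C * pref_p l x.
Definition dpref_m (l : C) (x : R) : C := - x%:C * pref_m l x.

Definition asym_p (f g : R -> C) : Prop :=
  forall eps : R, 0 < eps -> exists X : R, forall x, X <= x ->
    cabs (f x - g x) <= eps * cabs (g x).
Definition asym_m (f g : R -> C) : Prop :=
  forall eps : R, 0 < eps -> exists X : R, forall x, x <= X ->
    cabs (f x - g x) <= eps * cabs (g x).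

Definition uasym_p (F G : C -> R -> C) : Prop :=
  forall K : set C, compact K ->
  forall eps : R, 0 < eps -> exists X : R, forall x, X <= x -> forall l, K l ->
    cabs (F l x - G l x) <= eps * cabs (G l x).
Definition uasym_m (F G : C -> R -> C) : Prop :=
  forall K : set C, compact K ->
  forall eps : R, 0 < eps -> exists X : R, forall x, x <= X -> forall l, K l ->
    cabs (F l x - G l x) <= eps * cabs (G l x).

Definition entire (f : C -> C) : Prop := forall l : C, derivable f l 1.

(* y is an eigenfunction of T = -d^2/dx^2 + x^2 + q on L^2(R) with eigenvalue l
   (T with its maximal domain: y, y' locally absolutely continuous,
    y and Ty in L^2; here Ty = l y, and y is a nonzero element of L^2) *)
Definition eigenfunction (q : R -> C) (l : C) (y : R -> C) : Prop :=
  (exists dy, ode_sol q l y dy) /\ L2 y /\ ~ (\forall x \ae mu, y x = 0).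

End Defs.

(* Main.v *)
Require Import Defs.
From HB Require Import structures.
From mathcomp Require Import all_boot all_order all_algebra.
From mathcomp Require Import all_classical all_reals all_analysis.
From mathcomp Require Import complex.
From mathcomp Require Import ring lra measurable_realfun.
Import Order.TTheory GRing.Theory Num.Theory numFieldNormedType.Exports.
Local Open Scope ring_scope.
Local Open Scope complex_scope.

(* With [Q] the primitive of [q], which is bounded and Lipschitz, the equation is equivalent to the
   system [y' = dy], [(dy - Q y)' = (x^2 - l) y - Q dy] with continuous coefficients, so [q] itself
   disappears. Put [a = (l - 1) / 2] and [z = (sqrt 2 x)^a exp (- x^2 / 2 + h)], where
   [h'' - 2 x h' = q], [h' = O(1/x)] and [h = O(1/x)]; this is where the boundedness of [Q] enters.
   Then [z'' = (x^2 + q - l + rho) z] with [rho = O(x^-2)], and for [y = z u], [p = u'] one gets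
   [p' = - 2 (z'/z) p - rho u]. Comparing [(z^2 p)'] with the derivative of [|z|^2 x^-3] gives an a
   priori estimate for this system (with a source term) on [[X, +oo[], uniform for bounded [l].
   It makes the solutions with data [u = 1], [p = 0] at [N] converge as [N -> +oo], to the solution
   [psi_p]; applied to divided differences in [l] it shows that these are Cauchy, hence
   holomorphy. Finally, a solution vanishing at a large [X] has [|u|] nondecreasing on [[X, +oo[],
   which yields both uniqueness and the simplicity of eigenvalues. The solution [psi_m] is obtained
   by the reflection [x -> - x]. *)

Set Implicit Arguments. Unset Strict Implicit. Unset Printing Implicit Defensive.

(** The obstacle is that [q] does not decay. Without [h] the remainder would be
    [rho = - q + O(x^-2)], forcing [u'] to be of size [1/x], which is not absolutely integrable;
    only the cancellations in [q], expressed by the boundedness of [Q], save convergence. Hence [h],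
    built from [Q] alone. The rest of [z] is forced: for [b = a/x - x + h'] one finds [b' + b^2 =
    x^2 - (2 a + 1) + (h'' - 2 x h') + O(x^-2)], and [2 a + 1 = l].

    The new [rho] is harmless: [|z|^2] decreases at relative rate at least [x], which gains a factor
    [1/x], so a source [O(x^-2)] gives [p = O(x^-3)] and, after one more integration,
    [u - 1 = O(x^-2)]. These bounds come from explicit antiderivatives and a mean value inequality
    for complex-valued functions.

    The conditions at infinity, [u -> 1] and [p -> 0], do not depend on [l]. Divided differences in
    [l] therefore vanish at infinity and fall under the same estimate, which then has to be carried
    from a large [X] to an arbitrary [x] by a Gronwall bound uniform in [l]. *)

Section ComplexBasics.
Context {R : realType}.
Local Notation C := (Cplx R).
Implicit Types (z w : C) (x y : R).

(** * Complex numbers, the exponential, and derivatives in a real variable *)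

Lemma cReD z w : cRe (z + w) = cRe z + cRe w. Proof. by case: z; case: w. Qed.
Lemma cImD z w : cIm (z + w) = cIm z + cIm w. Proof. by case: z; case: w. Qed.
Lemma cReN z : cRe (- z) = - cRe z. Proof. by case: z. Qed.
Lemma cImN z : cIm (- z) = - cIm z. Proof. by case: z. Qed.
Lemma cReM z w : cRe (z * w) = cRe z * cRe w - cIm z * cIm w.
Proof. by case: z; case: w. Qed.
Lemma cImM z w : cIm (z * w) = cRe z * cIm w + cIm z * cRe w.
Proof. by case: z => a b; case: w => c d. Qed.
Lemma cReC x : cRe (x%:C : C) = x. Proof. by []. Qed.
Lemma cImC x : cIm (x%:C : C) = 0. Proof. by []. Qed.
Lemma cRe0 : cRe (0 : C) = 0. Proof. by []. Qed.
Lemma cIm0 : cIm (0 : C) = 0. Proof. by []. Qed.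
Lemma cRe1 : cRe (1 : C) = 1. Proof. by []. Qed.
Lemma cIm1 : cIm (1 : C) = 0. Proof. by []. Qed.
Lemma cRe_conj z : cRe (conjc z : C) = cRe z. Proof. by case: z. Qed.
Lemma cIm_conj z : cIm (conjc z : C) = - cIm z. Proof. by case: z. Qed.

Definition cReIm := (cReD, cImD, cReN, cImN, cReM, cImM, cReC, cImC, cRe0, cIm0,
  cRe1, cIm1, cRe_conj, cIm_conj).

Lemma cext z w : cRe z = cRe w -> cIm z = cIm w -> z = w.
Proof. by case: z => a b; case: w => c d; rewrite /cRe /cIm /= => -> ->. Qed.

Lemma cabsE z : cabs z = Normc.normc z.
Proof. by case: z. Qed.

Lemma cabs_norm z : `|z| = (cabs z)%:C :> C.
Proof. by case: z. Qed.

Lemma cabsM z w : cabs (z * w) = cabs z * cabs w.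
Proof. by rewrite !cabsE Normc.normcM. Qed.
Lemma cabsV z : cabs z^-1 = (cabs z)^-1.
Proof. by rewrite !cabsE Normc.normcV. Qed.
Lemma cabsD z w : cabs (z + w) <= cabs z + cabs w.
Proof. by rewrite !cabsE le_normcD. Qed.
Lemma cabsN z : cabs (- z) = cabs z.
Proof. by rewrite !cabsE normcN. Qed.
Lemma cabsBC z w : cabs (z - w) = cabs (w - z).
Proof. by rewrite -cabsN opprB. Qed.
Lemma cabsB z w : cabs (z - w) <= cabs z + cabs w.
Proof. by rewrite -(cabsN w) cabsD. Qed.
Lemma cabs0 : cabs (0 : C) = 0.
Proof. by rewrite cabsE Normc.normc0. Qed.
Lemma cabs1 : cabs (1 : C) = 1.
Proof. by rewrite cabsE Normc.normc1. Qed.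
Lemma cabs_ge0 z : 0 <= cabs z.
Proof. exact: sqrtr_ge0. Qed.
Lemma cabs_eq0 z : cabs z = 0 -> z = 0.
Proof. by rewrite cabsE => /Normc.eq0_normc. Qed.
Lemma cabs_gt0 z : (0 < cabs z) = (z != 0).
Proof.
rewrite lt_neqAle cabs_ge0 andbT eq_sym; congr (~~ _).
by apply/eqP/eqP => [/cabs_eq0 //|->]; rewrite cabs0.
Qed.
Lemma cabsC x : cabs (x%:C : C) = `|x|.
Proof. by rewrite /cabs cReC cImC expr0n addr0 sqrtr_sqr. Qed.
Lemma cabsX z n : cabs (z ^+ n) = cabs z ^+ n.
Proof. by elim: n => [|n IH]; rewrite ?expr0 ?cabs1// !exprS cabsM IH. Qed.
Lemma cabs_conj z : cabs (conjc z : C) = cabs z.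
Proof. by rewrite /cabs cRe_conj cIm_conj sqrrN. Qed.
Lemma cabs2 z : cabs z ^+ 2 = cRe z ^+ 2 + cIm z ^+ 2.
Proof. by rewrite sqr_sqrtr// addr_ge0 ?sqr_ge0. Qed.
Lemma ler_cRe z : `|cRe z| <= cabs z.
Proof. by rewrite -sqrtr_sqr ler_wsqrtr// lerDl sqr_ge0. Qed.
Lemma ler_cIm z : `|cIm z| <= cabs z.
Proof. by rewrite -sqrtr_sqr ler_wsqrtr// lerDr sqr_ge0. Qed.
Lemma cabs_le_sum z : cabs z <= `|cRe z| + `|cIm z|.
Proof.
rewrite -(ler_pXn2r (n := 2))// ?nnegrE ?cabs_ge0 ?addr_ge0//.
rewrite cabs2 sqrrD !real_normK ?num_real// addrAC lerDl.
by rewrite mulrn_wge0// mulr_ge0.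
Qed.
Lemma cabs_distD z w t : cabs (z - w) <= cabs (z - t) + cabs (t - w).
Proof. by apply: le_trans (cabsD _ _); rewrite addrA subrK. Qed.
Lemma cabs_triB z w : cabs z - cabs w <= cabs (z - w).
Proof. by rewrite lerBlDr; apply: le_trans (cabsD _ _); rewrite subrK. Qed.
Lemma cexpD z w : cexp (z + w) = cexp z * cexp w.
Proof.
apply: cext; rewrite /cexp !cReIm expRD /= ?cosD ?sinD.
  by rewrite /cRe /cIm /=; ring.
by rewrite /cRe /cIm /=; ring.
Qed.
Lemma cexp0 : cexp (0 : C) = 1.
Proof. by apply: cext; rewrite /cexp !cReIm /cRe /cIm/= expR0 ?cos0 ?sin0; ring. Qed.
Lemma cabs_cexp z : cabs (cexp z) = expR (cRe z).
Proof.
rewrite /cexp cabsM cabsC ger0_norm ?expR_ge0// /cabs /cRe /cIm/=.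
by rewrite cos2Dsin2 sqrtr1 mulr1.
Qed.
Lemma cexp_neq0 z : cexp z != 0.
Proof. by rewrite -cabs_gt0 cabs_cexp expR_gt0. Qed.
Lemma cexpN z : cexp (- z) = (cexp z)^-1.
Proof.
apply: (mulfI (cexp_neq0 z)); rewrite -cexpD subrr cexp0 divff// cexp_neq0//.
Qed.
Lemma cexpC x : cexp (x%:C : C) = (expR x)%:C.
Proof. by apply: cext; rewrite /cexp !cReIm /cRe /cIm/= ?cos0 ?sin0; ring. Qed.

Lemma rderD (f g : R -> R) x d e : is_derive x 1 f d -> is_derive x 1 g e ->
  is_derive x 1 (fun t => f t + g t) (d + e).
Proof. exact: is_deriveD. Qed.
Lemma rderB (f g : R -> R) x d e : is_derive x 1 f d -> is_derive x 1 g e ->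
  is_derive x 1 (fun t => f t - g t) (d - e).
Proof. exact: is_deriveB. Qed.
Lemma rderN (f : R -> R) x d : is_derive x 1 f d -> is_derive x 1 (fun t => - f t) (- d).
Proof. exact: is_deriveN. Qed.
Lemma rderM (f g : R -> R) x d e : is_derive x 1 f d -> is_derive x 1 g e ->
  is_derive x 1 (fun t => f t * g t) (d * g x + f x * e).
Proof.
move=> a b; apply: is_derive_eq (is_deriveM a b) _.
by rewrite /GRing.scale/=; ring.
Qed.
Lemma rderMl (c : R) (f : R -> R) x d : is_derive x 1 f d ->
  is_derive x 1 (fun t => c * f t) (c * d).
Proof. exact: is_deriveZ. Qed.
Lemma rder_cst (c : R) x : is_derive x 1 (fun=> c) 0.
Proof. exact: is_derive_cst. Qed.
Lemma rder_id x : is_derive x 1 (fun t : R => t) 1.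
Proof. exact: is_derive_id. Qed.
Lemma rder_exp (f : R -> R) x d : is_derive x 1 f d ->
  is_derive x 1 (fun t => expR (f t)) (expR (f x) * d).
Proof. exact: is_derive1_comp (is_derive_expR (f x)). Qed.
Lemma rder_inv x : x != 0 -> is_derive x 1 (fun t : R => t^-1) (- (x ^- 2)).
Proof.
move=> x0; apply: is_derive_eq (is_deriveV x0 (is_derive_id x 1)) _.
by rewrite /GRing.scale/= mulr1.
Qed.
Lemma rder_ln x : 0 < x -> is_derive x 1 (@ln R) x^-1.
Proof. exact: is_derive1_ln. Qed.
Lemma rder_eq (f : R -> R) x d e : is_derive x 1 f d -> d = e -> is_derive x 1 f e.
Proof. by move=> ? <-. Qed.
Lemma rderX (n : nat) x : is_derive x 1 (fun t : R => t ^+ n.+1) (n.+1%:R * x ^+ n).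
Proof.
elim: n => [|n IH]; first by apply: rder_eq (rder_id x) _; rewrite expr0 mulr1.
by apply: rder_eq (rderM (rder_id x) IH) _; rewrite exprS (natrD _ 1 n.+1); ring.
Qed.
Lemma rder_continuous (f : R -> R) x d : is_derive x 1 f d -> {for x, continuous f}.
Proof.
by move=> [a _]; apply: differentiable_continuous; apply/derivable1_diffP.
Qed.

(** Componentwise, because [C] is a normed space over itself here: its own [derivable] means complex
    differentiability, whereas the variable [x] is real. *)
Definition cder (f : R -> C) (x : R) (d : C) : Prop :=
  is_derive x 1 (cRe \o f) (cRe d) /\ is_derive x 1 (cIm \o f) (cIm d).

Lemma cder_eq f x (d e : C) : cder f x d -> d = e -> cder f x e.
Proof. by move=> ? <-. Qed.

Lemma cder_cst (c : C) x : cder (fun=> c) x 0.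
Proof. by split; rewrite !cReIm; apply: is_derive_cst. Qed.

Lemma cder_real (f : R -> R) x d : is_derive x 1 f d -> cder (fun t => (f t)%:C) x d%:C.
Proof. by move=> h; split; rewrite ?cReIm//; apply: is_derive_cst. Qed.

Lemma cderD f g x (d e : C) : cder f x d -> cder g x e ->
  cder (fun t => f t + g t) x (d + e).
Proof.
move=> [a b] [c' d']; split; rewrite !cReIm.
  rewrite (_ : _ \o _ = (cRe \o f) + (cRe \o g)); first exact: is_deriveD.
  by apply/funext => t /=; rewrite !cReIm.
rewrite (_ : _ \o _ = (cIm \o f) + (cIm \o g)); first exact: is_deriveD.
by apply/funext => t /=; rewrite !cReIm.
Qed.

Lemma cderN f x (d : C) : cder f x d -> cder (fun t => - f t) x (- d).
Proof.
move=> [a b]; split; rewrite !cReIm.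
  rewrite (_ : _ \o _ = - (cRe \o f)); first exact: is_deriveN.
  by apply/funext => t /=; rewrite !cReIm.
rewrite (_ : _ \o _ = - (cIm \o f)); first exact: is_deriveN.
by apply/funext => t /=; rewrite !cReIm.
Qed.

Lemma cderB f g x (d e : C) : cder f x d -> cder g x e ->
  cder (fun t => f t - g t) x (d - e).
Proof. by move=> ? ?; apply: cderD => //; apply: cderN. Qed.

Lemma cderM f g x (d e : C) : cder f x d -> cder g x e ->
  cder (fun t => f t * g t) x (d * g x + f x * e).
Proof.
move=> [a b] [c' d']; split; rewrite !cReIm.
  rewrite (_ : _ \o _ = (cRe \o f) * (cRe \o g) - (cIm \o f) * (cIm \o g)).
    apply: is_derive_eq (is_deriveB (is_deriveM a c') (is_deriveM b d')) _.
    by rewrite /= /GRing.scale/=; ring.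
  by apply/funext => t /=; rewrite !cReIm.
rewrite (_ : _ \o _ = (cRe \o f) * (cIm \o g) + (cIm \o f) * (cRe \o g)).
  apply: is_derive_eq (is_deriveD (is_deriveM a d') (is_deriveM b c')) _.
  by rewrite /= /GRing.scale/=; ring.
by apply/funext => t /=; rewrite !cReIm.
Qed.

Lemma cderMl (c : C) f x (d : C) : cder f x d -> cder (fun t => c * f t) x (c * d).
Proof.
by move=> df; apply: cder_eq (cderM (cder_cst c x) df) _; rewrite mul0r add0r.
Qed.

Lemma cder_cexp f x (d : C) : cder f x d -> cder (fun t => cexp (f t)) x (d * cexp (f x)).
Proof.
move=> [a b].
have e1 := is_derive1_comp (is_derive_expR (cRe (f x))) a.
have e2 := is_derive1_comp (is_derive_cos (cIm (f x))) b.
have e3 := is_derive1_comp (is_derive_sin (cIm (f x))) b.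
split; rewrite /cexp !cReIm.
  rewrite (_ : _ \o _ = (expR \o (cRe \o f)) * (cos \o (cIm \o f))).
    apply: is_derive_eq (is_deriveM e1 e2) _; rewrite /= /GRing.scale/= /cRe /cIm/=; ring.
  by apply/funext => t /=; rewrite /= ?mul0r ?subr0.
rewrite (_ : _ \o _ = (expR \o (cRe \o f)) * (sin \o (cIm \o f))).
  apply: is_derive_eq (is_deriveM e1 e3) _; rewrite /= /GRing.scale/= /cRe /cIm/=; ring.
by apply/funext => t /=; rewrite /= ?mul0r ?addr0.
Qed.

Lemma cder_continuous f x (d : C) : cder f x d ->
  {for x, continuous (cRe \o f)} /\ {for x, continuous (cIm \o f)}.
Proof.
by move=> [[a _] [b _]]; split; apply: differentiable_continuous; apply/derivable1_diffP.
Qed.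

Lemma is_derive_nondecr (f df : R -> R) a b : a <= b ->
  (forall x, a <= x <= b -> is_derive x 1 f (df x)) ->
  (forall x, a <= x <= b -> 0 <= df x) -> f a <= f b.
Proof.
move=> ab fdf df0.
have [||c] := @MVT_segment R f df a b ab.
- by move=> x; rewrite in_itv/= => /andP[ax xb]; apply: fdf; rewrite !ltW.
- apply: continuous_in_subspaceT => x; rewrite inE/= in_itv/= => /fdf[dx _].
  by apply: differentiable_continuous; apply/derivable1_diffP.
rewrite in_itv/= => cab fE; rewrite -subr_ge0 fE mulr_ge0 ?df0 ?subr_ge0//.
Qed.

(** The complex statement is reduced to a real one by projecting on the direction [v = f b - f a]:
    by Cauchy-Schwarz the function [|v| g - Re (conj v * f)] is nondecreasing, and comparing its end
    values gives [|v|^2 <= |v| (g b - g a)]. *)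
Lemma cder_mean_value (f df : R -> C) (g dg : R -> R) a b : a <= b ->
  (forall x, a <= x <= b -> cder f x (df x)) ->
  (forall x, a <= x <= b -> is_derive x 1 g (dg x)) ->
  (forall x, a <= x <= b -> cabs (df x) <= dg x) ->
  cabs (f b - f a) <= g b - g a.
Proof.
move=> ab fdf gdg fg.
have gab : g a <= g b.
  apply: (is_derive_nondecr ab gdg) => x xab.
  by apply: le_trans (fg _ xab); exact: cabs_ge0.
set v := f b - f a; have [->|v0] := eqVneq v 0; first by rewrite cabs0 subr_ge0.
pose phi x := cabs v * g x - (cRe v * cRe (f x) + cIm v * cIm (f x)).
have : phi a <= phi b.
  apply: (@is_derive_nondecr phi (fun x => cabs v * dg x -
     (cRe v * cRe (df x) + cIm v * cIm (df x))) a b ab).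
    move=> x xab; have [h1 h2] := fdf x xab; have h3 := gdg x xab.
    rewrite (_ : phi = cabs v *: g - (cRe v *: (cRe \o f) + cIm v *: (cIm \o f))); last by [].
    exact: is_deriveB (is_deriveZ _ h3) (is_deriveD (is_deriveZ _ h1) (is_deriveZ _ h2)).
  move=> x xab; rewrite subr_ge0.
  apply: le_trans (_ : cabs v * cabs (df x) <= _); last first.
    by rewrite ler_wpM2l ?cabs_ge0 ?fg.
  apply: le_trans (ler_norm _) _; rewrite -(cabs_conj v) -cabsM.
  apply: le_trans (ler_cRe _); rewrite !cReIm mulNr opprK//.
rewrite /phi => H.
have /ler_pM2l <- : 0 < cabs v by rewrite cabs_gt0.
have EA : cRe v = cRe (f b) - cRe (f a) by rewrite /v !cReIm.
have EB : cIm v = cIm (f b) - cIm (f a) by rewrite /v !cReIm.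
have -> : cabs v * cabs v = cRe v * (cRe (f b) - cRe (f a)) + cIm v * (cIm (f b) - cIm (f a)).
  by rewrite -EA -EB -expr2 cabs2 !expr2.
lra.
Qed.

End ComplexBasics.

(** * Oriented Lebesgue integrals of real functions *)

Section RealIntegral.
Context {R : realType}.
Local Notation mu := (@lebesgue_measure R).
Implicit Types (f g : R -> R) (a b c x : R).

Lemma rder_eps f x d :
  (forall eps, 0 < eps -> exists2 del, 0 < del & forall h, h != 0 -> `|h| < del ->
     `|f (x + h) - f x - h * d| <= eps * `|h|) -> is_derive x 1 f d.
Proof.
move=> H.
have cv : (h^-1 *: ((f \o shift x) (h *: 1) - f x) @[h --> 0^'] --> d)%classic.
  apply/cvgrPdist_le => e e0; have [del del0 Hd] := H e e0.
  near=> h.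
  have h0 : h != 0 by near: h; exact: nbhs_dnbhs_neq.
  have hd : `|h| < del by near: h; apply: dnbhs0_lt.
  rewrite /= /GRing.scale/= mulr1 (addrC h) distrC.
  rewrite (_ : h^-1 * _ - d = h^-1 * (f (x + h) - f x - h * d)); last first.
    by rewrite [RHS]mulrBr mulKf.
  rewrite normrM normfV ler_pdivrMl ?normr_gt0// [leRHS]mulrC; exact: Hd.
split; first by apply/cvg_ex; exists d.
by apply/cvg_lim.
Unshelve. all: by end_near. Qed.

Lemma aeS (P Q : R -> Prop) : (forall x, P x -> Q x) ->
  (\forall x \ae mu, P x) -> \forall x \ae mu, Q x.
Proof. by move=> PQ; apply: filterS => //; exact: (ae_filter_ringOfSetsType mu). Qed.

Definition locint f := forall a b, mu.-integrable `[a, b]%classic (EFin \o f).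

Definition roint f a b :=
  if a <= b then Rintegral mu `[a, b]%classic f else - Rintegral mu `[b, a]%classic f.

Lemma ae_bounded_integrable (f : measurableTypeR R -> R) (D : set (measurableTypeR R)) (K : R) :
  measurable D -> (mu D < +oo)%E ->
  measurable_fun D f -> 0 <= K -> (\forall x \ae mu, D x -> `|f x| <= K) ->
  mu.-integrable D (EFin \o f) /\ `|Rintegral mu D f| <= K * fine (mu D).
Proof.
move=> mD Doo mf K0 fK.
(* The bound on [f] holds only almost everywhere; its truncation [g] to [[-K, K]] is bounded
   everywhere, and [|g| = |f|] almost everywhere on [D]. *)
pose g (x : measurableTypeR R) : R := Num.max (- K) (Num.min K (f x)).
have mg : measurable_fun D g.
  by apply: measurable_maxr => //; apply: measurable_minr.
have gK x : `|g x| <= K.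
  rewrite ler_norml /g le_max lexx/= ge_max ge_min lexx/= andbT.
  by rewrite (le_trans _ K0)// oppr_le0.
have fg : ae_eq mu D (fun x => `|f x|%:E) (fun x => `|g x|%:E).
  apply: aeS fK => x /[apply] fxK; rewrite /g; congr (`| _ |%:E).
  move: fxK; rewrite ler_norml => /andP[h1 h2].
  by rewrite (min_idPr h2) (max_idPr h1).
have E : (\int[mu]_(x in D) `|f x|%:E = \int[mu]_(x in D) `|g x|%:E)%E.
  apply: ge0_ae_eq_integral => //; try by move=> x _; rewrite lee_fin.
  - by apply/measurable_EFinP; apply: measurableT_comp.
  - by apply/measurable_EFinP; apply: measurableT_comp.
have B : (\int[mu]_(x in D) `|g x|%:E <= K%:E * mu D)%E.
  rewrite -integral_cst//; apply: ge0_le_integral => //.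
  - by apply/measurable_EFinP; apply: measurableT_comp.
  - by move=> x _ /=; rewrite lee_fin.
have fi : mu.-integrable D (EFin \o f).
  apply/integrableP; split; first exact/measurable_EFinP.
  rewrite /= E; apply: le_lt_trans B _; rewrite lte_mul_pinfty//.
split=> //.
have := le_normr_Rintegral mD fi; move=> H; apply: (le_trans H) => {H}.
have Kmu : (K%:E * mu D < +oo)%E by rewrite lte_mul_pinfty.
have I0 : (0 <= \int[mu]_(x in D) `|g x|%:E)%E.
  by apply: integral_ge0 => x _; rewrite lee_fin.
rewrite /Rintegral E -lee_fin EFinM fineK; last first.
  by rewrite ge0_fin_numE//; exact: le_lt_trans B Kmu.
by rewrite fineK ?ge0_fin_numE.
Qed.

Lemma fine_mu_itv a b : a <= b -> fine (mu `[a, b]%classic) = b - a.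
Proof.
move=> ab; rewrite lebesgue_measure_itv/= lte_fin.
by case: ltgtP ab => // -> _; rewrite subrr.
Qed.

Lemma mu_itv_fin a b : (mu `[a, b]%classic < +oo)%E.
Proof. by rewrite lebesgue_measure_itv/=; case: ifP => _; rewrite -?EFinD ltry. Qed.

Lemma roint_same f a : roint f a a = 0.
Proof. by rewrite /roint lexx set_itv1 Rintegral_set1. Qed.

Lemma roint_sym f a b : roint f b a = - roint f a b.
Proof.
rewrite /roint; case: ltgtP => // [_|->]; first by rewrite opprK.
by rewrite set_itv1 Rintegral_set1 oppr0.
Qed.

Lemma roint_split_le f a b c : locint f -> a <= b -> b <= c ->
  roint f a b + roint f b c = roint f a c.
Proof.
move=> fi ab bc; rewrite /roint ab bc (le_trans ab bc).
have := @Rintegral_itvB R f (BLeft a) (BRight c) b (fi a c).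
rewrite !bnd_simp => /(_ ab bc).
rewrite Rintegral_itv_obnd_cbnd; last first.
  apply: integrableS (fi b c) => //; exact: subset_itv_oc_cc.
by move/eqP; rewrite subr_eq => /eqP ->; rewrite addrC.
Qed.

Lemma roint_chasles f b a c : locint f -> roint f a b + roint f b c = roint f a c.
Proof.
move=> fi; have S := roint_split_le fi.
have [ab|/ltW ba] := leP a b; have [bc|/ltW cb] := leP b c; have [ac|/ltW ca] := leP a c.
- exact: S.
- have -> : b = a by lra.
  have -> : c = a by lra.
  by rewrite !roint_same addr0.
- by rewrite (roint_sym _ c b) -(S a c b)// addrK.
- by rewrite (roint_sym f c b) (roint_sym f c a) -(S c a b)//; ring.
- by rewrite (roint_sym f b a) -(S b a c)// addKr.
- by rewrite (roint_sym f b a) (roint_sym f c a) -(S b c a)//; ring.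
- have -> : b = a by lra.
  have -> : c = a by lra.
  by rewrite !roint_same addr0.
- by rewrite (roint_sym f b a) (roint_sym f c b) (roint_sym f c a) -(S c b a)//; ring.
Qed.

Lemma roint_diff f a b c : locint f -> roint f a c - roint f a b = roint f b c.
Proof. by move=> fi; rewrite -(roint_chasles b a c fi) addrAC subrr add0r. Qed.

Lemma rointD f g a b : locint f -> locint g ->
  roint (fun x => f x + g x) a b = roint f a b + roint g a b.
Proof.
move=> fi gi; rewrite /roint; case: ifP => _; rewrite RintegralD ?opprD//.
Qed.

Lemma rointZ k f a b : locint f -> roint (fun x => k * f x) a b = k * roint f a b.
Proof. by move=> fi; rewrite /roint; case: ifP => _; rewrite RintegralZl// mulrN. Qed.

Lemma rointB f g a b : locint f -> locint g ->
  roint (fun x => f x - g x) a b = roint f a b - roint g a b.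
Proof.
by move=> fi gi; rewrite /roint; case: ifP => _; rewrite RintegralB// opprB addrC opprK.
Qed.

Lemma eq_roint f g a b : f =1 g -> roint f a b = roint g a b.
Proof. by move=> /funext ->. Qed.

Lemma locintD f g : locint f -> locint g -> locint (fun x => f x + g x).
Proof. by move=> fi gi a b; apply: integrableD (fi a b) (gi a b). Qed.
Lemma locintZ k f : locint f -> locint (fun x => k * f x).
Proof. by move=> fi a b; apply: integrableZl (fi a b). Qed.
Lemma locintB f g : locint f -> locint g -> locint (fun x => f x - g x).
Proof. by move=> fi gi a b; apply: integrableB (fi a b) (gi a b). Qed.

Lemma continuous_locint f : continuous f -> locint f.
Proof.
move=> cf a b; apply: continuous_compact_integrable; first exact: segment_compact.
exact: continuous_subspaceT.
Qed.

Lemma roint_cst k a b : roint (fun=> k) a b = k * (b - a).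
Proof.
rewrite /roint; case: leP => [ab|/ltW ba]; rewrite Rintegral_cst// fine_mu_itv//.
by rewrite -mulrN opprB.
Qed.

Lemma roint_bound f a b K : measurable_fun setT f -> 0 <= K ->
  (\forall x \ae mu, Num.min a b <= x <= Num.max a b -> `|f x| <= K) ->
  `|roint f a b| <= K * `|b - a|.
Proof.
move=> mf K0.
wlog ab : a b / a <= b => [W H|].
  have [/W|/ltW ba] := leP a b; first exact.
  by rewrite roint_sym normrN distrC; apply: W => //; rewrite minC maxC.
rewrite (min_idPl ab) (max_idPr ab) => H.
have -> : `|b - a| = b - a by rewrite ger0_norm ?subr_ge0.
rewrite /roint ab -(fine_mu_itv ab).
apply: (proj2 (@ae_bounded_integrable f `[a, b]%classic K _ (mu_itv_fin a b) _ _ _)) => //.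
  exact: measurable_funTS.
Qed.

Lemma continuous_bounded f a b : continuous f ->
  exists2 K, 0 <= K & forall x, a <= x <= b -> `|f x| <= K.
Proof.
move=> cf; have [ab|ba] := leP a b; last first.
  by exists 0 => // x /andP[ax xb]; move: (le_trans ax xb); rewrite leNgt ba.
have cg : continuous (fun x => `|f x|).
  by move=> x; apply: continuous_comp; [exact: cf|exact: norm_continuous].
have [c _ Hc] := @EVT_max R (fun x => `|f x|) a b ab (continuous_subspaceT cg).
by exists `|f c| => // x xab; apply: Hc; rewrite in_itv.
Qed.

Lemma bounded_mul_locint f g M : measurable_fun setT f ->
  (\forall x \ae mu, `|f x| <= M) -> continuous g -> locint (fun x => f x * g x).
Proof.
move=> mf fM cg a b; have [K K0 gK] := continuous_bounded a b cg.
apply: (proj1 (@ae_bounded_integrable _ _ (`|M| * K) _ _ _ _ _)) => //.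
- exact: mu_itv_fin.
- apply: measurable_funM; apply: measurable_funTS => //.
  exact: continuous_measurable_fun.
- by rewrite mulr_ge0.
- apply: aeS fM => x fM /=; rewrite in_itv/= => xab; rewrite normrM.
  by rewrite ler_pM ?gK// (le_trans fM)// ler_norm.
Qed.

Lemma roint_continuous f a : locint f -> continuous (roint f a).
Proof.
move=> fi x.
(* The base point is moved to [x - 1], so that [x] is interior to the segment [[x - 1, x + 1]] on
   which continuity in the upper end is used. *)
have E : roint f a = (fun t => roint f a (x - 1) + roint f (x - 1) t).
  by apply/funext => t; rewrite roint_chasles.
rewrite E; apply: cvgD; first exact: cvg_cst.
have xx : x - 1 < x + 1 by lra.
have := @parameterized_integral_continuous R _ _ f (ltW xx) (fi _ _).
have xi : x \in (`]x - 1, x + 1[ : interval R) by rewrite in_itv/=; apply/andP; split; lra.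
move=> /(within_continuous_continuous xx)/(_ xi) H.
have -> : roint f (x - 1) x = Rintegral mu `[x - 1, x]%classic f.
  by rewrite /roint; case: ifP => //; rewrite lerBlDr lerDl ler01.
apply: cvg_trans H; apply: near_eq_cvg; near=> t.
rewrite /roint; case: ifP => //; suff -> : x - 1 <= t by [].
by apply/ltW; near: t; apply: lt_nbhsr; lra.
Unshelve. all: by end_near. Qed.

Lemma between_dist a b t : Num.min a b <= t <= Num.max a b ->
  `|t - a| <= `|b - a| /\ `|b - t| <= `|b - a|.
Proof.
rewrite /Order.min /Order.max; case: ltP => ab /andP[t1 t2].
  by rewrite !ger0_norm; lra.
by rewrite !ler0_norm; lra.
Qed.

Lemma roint_derive f a x : continuous f -> is_derive x 1 (roint f a) (f x).
Proof.
move=> cf; apply: rder_eps => e e0.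
have /cvgrPdist_le/(_ _ e0) [del /= del0 Hd] := cf x.
exists del => // h h0 hd.
have fi := continuous_locint cf.
rewrite roint_diff//.
rewrite (_ : h * f x = roint (fun=> f x) x (x + h)); last first.
  by rewrite roint_cst mulrC addrAC subrr add0r.
have ci : locint (fun=> f x) by apply: continuous_locint => t; exact: cvg_cst.
rewrite -rointB//.
have -> : `|h| = `|x + h - x| by rewrite addrAC subrr add0r.
apply: roint_bound; [|exact: ltW|].
  apply: measurable_funB => //; exact: continuous_measurable_fun.
apply: aeW => /= t /between_dist[+ _] ; rewrite addrAC subrr add0r => th.
by rewrite distrC; apply: Hd => /=; rewrite distrC; exact: le_lt_trans hd.
Qed.

End RealIntegral.

(** * Integration by parts against a Lipschitz primitive; continuous complex-valued functions *)

Section Caratheodory.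
Context {R : realType}.
Local Notation mu := (@lebesgue_measure R).
Local Notation C := (Cplx R).
Implicit Types (f g q : R -> R) (a b c x : R).

Lemma rder0_cst f a b : (forall x, is_derive x 1 f 0) -> f a = f b.
Proof. by move=> H; exact: is_derive_0_is_cst. Qed.

Lemma rder_all_continuous f df : (forall x, is_derive x 1 f (df x)) -> continuous f.
Proof. by move=> H x; exact: rder_continuous (H x). Qed.

Lemma roint_rder f df a b : (forall x, is_derive x 1 f (df x)) -> continuous df ->
  roint df a b = f b - f a.
Proof.
move=> fdf cdf; pose D t := roint df a t - f t.
have : D a = D b.
  apply: rder0_cst => x; apply: rder_eq (rderB (roint_derive a x cdf) (fdf x)) _.
  by rewrite subrr.
by rewrite /D roint_same; lra.
Qed.

(** The primitive of [q] is only Lipschitz, so the product rule need not hold at every point.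
    Instead, the difference [D] of the two sides has increments of order [h^2]: between [x] and [t]
    only the integrals of [q(s) (y(s) - y(t))] and of [(Q(s) - Q(x)) dy(s)] survive. Hence [D' = 0]
    everywhere, although single terms of [D] may fail to be differentiable. *)
Lemma roint_by_parts q (y dy : R -> R) (M : R) a x : measurable_fun setT q -> 0 <= M ->
  (\forall t \ae mu, `|q t| <= M) ->
  (forall t : R, is_derive t 1 y (dy t)) -> continuous dy ->
  roint (fun t => q t * y t) a x =
  roint q a x * y x - roint (fun t => roint q a t * dy t) a x.
Proof.
move=> mq M0 qM ydy cdy.
have cy := rder_all_continuous ydy.
have qi : locint q.
  have c1 : continuous (fun _ : R => 1 : R) by move=> t; exact: cvg_cst.
  rewrite (_ : q = fun u => q u * (fun _ : R => 1 : R) u); first exact: bounded_mul_locint qM c1.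
  by apply/funext => u; rewrite mulr1.
have qyi : locint (fun t => q t * y t) by exact: bounded_mul_locint qM cy.
pose Q := roint q a.
have cQ : continuous Q by exact: roint_continuous.
have cQdy : continuous (fun t => Q t * dy t).
  by move=> t; apply: cvgM; [exact: cQ|exact: cdy].
have Qdyi := continuous_locint cQdy.
pose D t := roint (fun t => q t * y t) a t - Q t * y t + roint (fun t => Q t * dy t) a t.
suff D0 : forall t : R, is_derive t 1 D 0.
  have := rder0_cst a x D0; rewrite /D /Q !roint_same; lra.
move=> {}x; apply: rder_eps => e e0.
have [L L0 dyL] := continuous_bounded (x - 1) (x + 1) cdy.
(* Both surviving integrals are at most [M L h^2]; the [+ 1] keeps the denominator positive, and
   [del <= 1] keeps [t] where [L] bounds [dy]. *)
pose del := Num.min 1 (e / (2 * M * L + 1)).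
have ML0 : 0 <= M * L by rewrite mulr_ge0.
have K0 : 0 < 2 * M * L + 1 by lra.
exists del; first by rewrite lt_min ltr01 divr_gt0.
move=> h h0; rewrite lt_min => /andP[h1 he].
set t := x + h; have th : t - x = h by rewrite /t addrAC subrr add0r.
rewrite mulr0 subr0.
have inI s : Num.min x t <= s <= Num.max x t -> x - 1 <= s <= x + 1.
  move=> /between_dist[+ _]; rewrite th => sx.
  by have := le_lt_trans sx h1; rewrite ltr_norml => /andP[? ?]; apply/andP; split; lra.
have between_trans s u : Num.min x t <= s <= Num.max x t ->
    Num.min s t <= u <= Num.max s t -> Num.min x t <= u <= Num.max x t.
  by rewrite /Order.min /Order.max; do 2 case: ltP => ?; move=> /andP[? ?] /andP[? ?]; apply/andP; split; lra.
have ybd s : Num.min x t <= s <= Num.max x t -> `|y s - y t| <= L * `|h|.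
  move=> sI; rewrite distrC -(roint_rder s t ydy cdy).
  apply: le_trans (_ : L * `|t - s| <= _).
    apply: roint_bound => //; first exact: continuous_measurable_fun.
    by apply: aeW => u uI /=; apply/dyL/inI/(between_trans s).
  by rewrite ler_wpM2l// -th; have [] := between_dist sI.
have Qbd s : Num.min x t <= s <= Num.max x t -> `|Q s - Q x| <= M * `|h|.
  move=> sI; rewrite roint_diff//.
  apply: le_trans (_ : M * `|s - x| <= _).
    by apply: roint_bound => //; apply: aeS qM => u H _.
  by rewrite ler_wpM2l// -th; have [] := between_dist sI.
have E1 : roint (fun s => q s * y s) x t =
    roint (fun s => q s * (y s - y t)) x t + y t * (Q t - Q x).
  rewrite (_ : Q t - Q x = roint q x t); last first.
    by rewrite roint_diff.
  have cyt : continuous (fun s => y s - y t).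
    by move=> s; apply: cvgB; [exact: cy|exact: cvg_cst].
  rewrite -rointZ// -rointD; [|exact: bounded_mul_locint qM cyt|exact: locintZ].
  by apply: eq_roint => s; ring.
have cQQ : continuous (fun s => (Q s - Q x) * dy s).
  move=> s; apply: cvgM; last exact: cdy.
  by apply: cvgB; [exact: cQ|exact: cvg_cst].
have E2 : roint (fun s => Q s * dy s) x t =
    roint (fun s => (Q s - Q x) * dy s) x t + Q x * (y t - y x).
  rewrite -(roint_rder x t ydy cdy) -rointZ; last exact: continuous_locint.
  rewrite -rointD; [|exact: continuous_locint|exact/locintZ/continuous_locint].
  by apply: eq_roint => s; ring.
have -> : D t - D x = roint (fun s => q s * (y s - y t)) x t +
    roint (fun s => (Q s - Q x) * dy s) x t.
  rewrite /D -(roint_chasles x a t qyi) -(roint_chasles x a t Qdyi) E1 E2; ring.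
have B1 : `|roint (fun s => q s * (y s - y t)) x t| <= (M * (L * `|h|)) * `|h|.
  rewrite -th; apply: roint_bound; rewrite ?th ?mulr_ge0//.
    apply: measurable_funM => //; apply: measurable_funB => //.
    exact: continuous_measurable_fun.
  by apply: aeS qM => s qs sI; rewrite normrM ler_pM// ybd.
have B2 : `|roint (fun s => (Q s - Q x) * dy s) x t| <= (M * `|h| * L) * `|h|.
  rewrite -th; apply: roint_bound; rewrite ?th ?mulr_ge0//.
    exact: continuous_measurable_fun.
  by apply: aeW => s sI; rewrite normrM ler_pM// ?Qbd// dyL// inI.
apply: le_trans (ler_normD _ _) _.
apply: le_trans (lerD B1 B2) _.
rewrite -mulrDl ler_wpM2r//.
have : `|h| * (2 * M * L + 1) <= e by rewrite -ler_pdivlMr// ltW.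
have := normr_ge0 h; nra.
Qed.

Definition ccont (f : R -> C) := continuous (cRe \o f) /\ continuous (cIm \o f).

Lemma ccontD (f g : R -> C) : ccont f -> ccont g -> ccont (fun t => f t + g t).
Proof.
move=> [f1 f2] [g1 g2]; split.
  rewrite (_ : _ \o _ = (fun t => cRe (f t) + cRe (g t))).
    by move=> x; apply: cvgD; [exact: f1|exact: g1].
  by apply/funext => t /=; rewrite !cReIm.
rewrite (_ : _ \o _ = (fun t => cIm (f t) + cIm (g t))).
  by move=> x; apply: cvgD; [exact: f2|exact: g2].
by apply/funext => t /=; rewrite !cReIm.
Qed.

Lemma ccontM (f g : R -> C) : ccont f -> ccont g -> ccont (fun t => f t * g t).
Proof.
move=> [f1 f2] [g1 g2]; split.
  rewrite (_ : _ \o _ = (fun t => cRe (f t) * cRe (g t) - cIm (f t) * cIm (g t))).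
    by move=> x; apply: cvgB; apply: cvgM; [exact: f1|exact: g1|exact: f2|exact: g2].
  by apply/funext => t /=; rewrite !cReIm.
rewrite (_ : _ \o _ = (fun t => cRe (f t) * cIm (g t) + cIm (f t) * cRe (g t))).
  by move=> x; apply: cvgD; apply: cvgM; [exact: f1|exact: g2|exact: f2|exact: g1].
by apply/funext => t /=; rewrite !cReIm.
Qed.

Lemma ccont_cst (c : C) : ccont (fun=> c).
Proof. by split=> x; exact: cvg_cst. Qed.

Lemma ccontN (f : R -> C) : ccont f -> ccont (fun t => - f t).
Proof.
move=> cf; rewrite (_ : (fun _ => _) = (fun t => -1 * f t)).
  exact: ccontM (ccont_cst _) cf.
by apply/funext => t; rewrite mulN1r.
Qed.

Lemma ccontB (f g : R -> C) : ccont f -> ccont g -> ccont (fun t => f t - g t).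
Proof. by move=> cf cg; apply: ccontD => //; exact: ccontN. Qed.

Lemma ccont_real (f : R -> R) : continuous f -> ccont (fun t => (f t)%:C).
Proof. by move=> cf; split=> [|x]; [exact: cf|exact: cvg_cst]. Qed.

Lemma ccont_sqr : ccont (fun t => (t ^+ 2)%:C).
Proof. by apply: ccont_real => x; exact: exprn_continuous. Qed.

Lemma cder_ccont (f df : R -> C) : (forall x, cder f x (df x)) -> ccont f.
Proof. by move=> H; split=> x; have [] := cder_continuous (H x). Qed.

Lemma cRe_oint (f : R -> C) a b : cRe (oint f a b) = roint (cRe \o f) a b.
Proof. by rewrite /oint /roint; case: ifP. Qed.
Lemma cIm_oint (f : R -> C) a b : cIm (oint f a b) = roint (cIm \o f) a b.
Proof. by rewrite /oint /roint; case: ifP. Qed.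

Lemma oint_cder (f : R -> C) a x : ccont f -> cder (oint f a) x (f x).
Proof.
move=> [f1 f2]; split.
  rewrite (_ : _ \o _ = roint (cRe \o f) a); first exact: (roint_derive a x f1).
  by apply/funext => t; exact: cRe_oint.
rewrite (_ : _ \o _ = roint (cIm \o f) a); first exact: (roint_derive a x f2).
by apply/funext => t; exact: cIm_oint.
Qed.

Lemma oint_same (f : R -> C) a : oint f a a = 0.
Proof. by apply: cext; rewrite ?cRe_oint ?cIm_oint roint_same. Qed.

Lemma oint_of_cder (f df : R -> C) a b : (forall x, cder f x (df x)) -> ccont df ->
  oint df a b = f b - f a.
Proof.
move=> fdf [c1 c2]; apply: cext; rewrite ?cRe_oint ?cIm_oint !cReIm.
  by apply: (@roint_rder (cRe \o f)) => // x; case: (fdf x).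
by apply: (@roint_rder (cIm \o f)) => // x; case: (fdf x).
Qed.

End Caratheodory.

(** * Elimination of [q] through the quasi-derivative *)

Section Quasi.
Context {R : realType}.
Local Notation mu := (@lebesgue_measure R).
Local Notation C := (Cplx R).
Implicit Types (q Q y dy F f g : R -> C) (l : C) (a b x : R).

(** Formally [y'' = (x^2 + Q' - l) y - F]. The quasi-derivative [dy - Q y] is differentiable at
    every point, whereas [dy] itself need only be so almost everywhere. The source [F] is carried
    along for differences of solutions with different [l]. *)
Definition csol Q l F y dy : Prop := forall x : R,
  cder y x (dy x) /\
  cder (fun t => dy t - Q t * y t) x (((x ^+ 2)%:C - l) * y x - Q x * dy x - F x).

Lemma oint_ext f g a b : f =1 g -> oint f a b = oint g a b.
Proof. by move=> /funext ->. Qed.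

Lemma ccont_loc_integrable f : ccont f -> loc_integrable f.
Proof. by move=> [f1 f2] a b; split; apply: continuous_locint. Qed.

Lemma loc_integrableD f g : loc_integrable f -> loc_integrable g ->
  loc_integrable (fun t => f t + g t).
Proof.
move=> fi gi a b; have [f1 f2] := fi a b; have [g1 g2] := gi a b; split.
  rewrite (_ : cRe \o _ = fun t => cRe (f t) + cRe (g t)); first exact: integrableD f1 g1.
  by apply/funext => t /=; rewrite !cReIm.
rewrite (_ : cIm \o _ = fun t => cIm (f t) + cIm (g t)); first exact: integrableD f2 g2.
by apply/funext => t /=; rewrite !cReIm.
Qed.

Lemma ointD f g a b : loc_integrable f -> loc_integrable g ->
  oint (fun t => f t + g t) a b = oint f a b + oint g a b.
Proof.
move=> fi gi; apply: cext; rewrite !cReIm ?cRe_oint ?cIm_oint -rointD.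
- by apply: eq_roint => t /=; rewrite !cReIm.
- by move=> s t; case: (fi s t).
- by move=> s t; case: (gi s t).
- by apply: eq_roint => t /=; rewrite !cReIm.
- by move=> s t; case: (fi s t).
- by move=> s t; case: (gi s t).
Qed.

Lemma oint_ccont f a : loc_integrable f -> ccont (oint f a).
Proof.
move=> fi; split.
  rewrite (_ : _ \o _ = roint (cRe \o f) a).
    by apply: roint_continuous => s t; case: (fi s t).
  by apply/funext => t; exact: cRe_oint.
rewrite (_ : _ \o _ = roint (cIm \o f) a).
  by apply: roint_continuous => s t; case: (fi s t).
by apply/funext => t; exact: cIm_oint.
Qed.

Lemma Linfty_bound q : Linfty q -> exists M : R, [/\ 0 <= M,
  \forall x \ae mu, `|cRe (q x)| <= M & \forall x \ae mu, `|cIm (q x)| <= M].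
Proof.
move=> [_ _ [M HM]]; exists `|M|; split => //.
  apply: aeS HM => x H; exact: le_trans (ler_cRe _) (le_trans H (ler_norm _)).
by apply: aeS HM => x H; exact: le_trans (ler_cIm _) (le_trans H (ler_norm _)).
Qed.

Lemma Linfty_mul_integrable q y : Linfty q -> ccont y ->
  loc_integrable (fun t => q t * y t).
Proof.
move=> qL [y1 y2]; have [M [M0 qr qi]] := Linfty_bound qL; have [mr mi _] := qL.
move=> a b; split.
  rewrite (_ : cRe \o _ = fun t => cRe (q t) * cRe (y t) - cIm (q t) * cIm (y t)).
    apply: locintB; [exact: bounded_mul_locint qr y1|exact: bounded_mul_locint qi y2].
  by apply/funext => t /=; rewrite !cReIm.
rewrite (_ : cIm \o _ = fun t => cRe (q t) * cIm (y t) + cIm (q t) * cRe (y t)).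
  apply: locintD; [exact: bounded_mul_locint qr y2|exact: bounded_mul_locint qi y1].
by apply/funext => t /=; rewrite !cReIm.
Qed.

Lemma Linfty_loc_integrable q : Linfty q -> loc_integrable q.
Proof.
move=> qL; have := Linfty_mul_integrable qL (ccont_cst 1).
by rewrite (_ : (fun t => q t * 1) = q)//; apply/funext => t; rewrite mulr1.
Qed.

Lemma prim_ccont q : Linfty q -> ccont (prim q).
Proof. by move=> qL; apply: oint_ccont; exact: Linfty_loc_integrable. Qed.

Lemma prim_lipschitz q : Linfty q -> exists2 L : R, 0 <= L &
  forall a b, cabs (prim q a - prim q b) <= L * `|a - b|.
Proof.
move=> qL; have [M [M0 qr qi]] := Linfty_bound qL; have [mr mi _] := qL.
have qli := Linfty_loc_integrable qL.
exists (M + M); first exact: addr_ge0.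
move=> a b; apply: le_trans (cabs_le_sum _) _.
rewrite /prim !cReIm !cRe_oint !cIm_oint !roint_diff; last 2 first.
- by move=> s t; case: (qli s t).
- by move=> s t; case: (qli s t).
rewrite mulrDl; apply: lerD; apply: roint_bound => //.
  by apply: aeS qr.
by apply: aeS qi.
Qed.

Lemma oint_by_parts q y dy x : Linfty q -> (forall t, cder y t (dy t)) -> ccont dy ->
  oint (fun t => q t * y t) 0 x = prim q x * y x - oint (fun t => prim q t * dy t) 0 x.
Proof.
move=> qL ydy cdy; have [M [M0 qr qi]] := Linfty_bound qL; have [mr mi _] := qL.
have [y1 y2] := cder_ccont ydy; have [d1 d2] := cdy.
have [Q1 Q2] := prim_ccont qL.
have ydr (t : R) : is_derive t 1 (cRe \o y) (cRe (dy t)) by case: (ydy t).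
have ydi (t : R) : is_derive t 1 (cIm \o y) (cIm (dy t)) by case: (ydy t).
have QE : cRe \o prim q = roint (cRe \o q) 0.
  by apply/funext => t /=; rewrite cRe_oint.
have QF : cIm \o prim q = roint (cIm \o q) 0.
  by apply/funext => t /=; rewrite cIm_oint.
have ci (u v : R -> R) : continuous u -> continuous v -> locint (fun t => u t * v t).
  by move=> cu cv; apply: continuous_locint => t; apply: cvgM; [exact: cu|exact: cv].
apply: cext.
  rewrite !cReIm !cRe_oint.
  rewrite (@eq_roint _ _ (fun t => cRe (q t) * cRe (y t) - cIm (q t) * cIm (y t))); last first.
    by move=> t /=; rewrite !cReIm.
  rewrite rointB; [|exact: bounded_mul_locint qr y1|exact: bounded_mul_locint qi y2].
  rewrite (roint_by_parts 0 x mr M0 qr ydr d1) (roint_by_parts 0 x mi M0 qi ydi d2).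
  rewrite -QE -QF.
  rewrite (@eq_roint _ (cRe \o (fun t => prim q t * dy t)) (fun t => cRe (prim q t) * cRe (dy t) - cIm (prim q t) * cIm (dy t))); last first.
    by move=> t /=; rewrite !cReIm.
  by rewrite rointB; [rewrite /=; ring|exact: ci|exact: ci].
rewrite !cReIm !cIm_oint.
rewrite (@eq_roint _ _ (fun t => cRe (q t) * cIm (y t) + cIm (q t) * cRe (y t))); last first.
  by move=> t /=; rewrite !cReIm.
rewrite rointD; [|exact: bounded_mul_locint qr y2|exact: bounded_mul_locint qi y1].
rewrite (roint_by_parts 0 x mr M0 qr ydi d2) (roint_by_parts 0 x mi M0 qi ydr d1).
rewrite -QE -QF.
rewrite (@eq_roint _ (cIm \o (fun t => prim q t * dy t)) (fun t => cRe (prim q t) * cIm (dy t) + cIm (prim q t) * cRe (dy t))); last first.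
  by move=> t /=; rewrite !cReIm.
by rewrite rointD; [rewrite /=; ring|exact: ci|exact: ci].
Qed.

Lemma ccont_sqrB l y : ccont y -> ccont (fun t => ((t ^+ 2)%:C - l) * y t).
Proof.
move=> cy; apply: ccontM => //; apply: ccontB; [exact: ccont_sqr|exact: ccont_cst].
Qed.

Lemma coef_oint q l y dy : Linfty q -> (forall t, cder y t (dy t)) -> ccont dy ->
  loc_integrable (fun t => coef q l t * y t) /\
  forall x, oint (fun t => coef q l t * y t) 0 x =
    oint (fun t => ((t ^+ 2)%:C - l) * y t - prim q t * dy t) 0 x + prim q x * y x.
Proof.
move=> qL ydy cdy; have cy := cder_ccont ydy; have cQ := prim_ccont qL.
have cA := ccont_sqrB l cy; have iA := ccont_loc_integrable cA.
have iB := Linfty_mul_integrable qL cy.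
have E : (fun t => coef q l t * y t) = (fun t => ((t ^+ 2)%:C - l) * y t + q t * y t).
  by apply/funext => t; rewrite /coef; ring.
rewrite E; split; first exact: loc_integrableD.
have cQd := ccontM cQ cdy.
move=> x; rewrite ointD// (oint_by_parts x qL ydy cdy).
have -> : oint (fun t => ((t ^+ 2)%:C - l) * y t) 0 x =
   oint (fun t => ((t ^+ 2)%:C - l) * y t - prim q t * dy t) 0 x + oint (fun t => prim q t * dy t) 0 x.
  rewrite -ointD; [|by apply: ccont_loc_integrable; exact: ccontB|exact: ccont_loc_integrable].
  by apply: oint_ext => t; rewrite subrK.
by ring.
Qed.

Lemma csol_ccont Q l y dy : ccont Q -> csol Q l (fun=> 0) y dy -> ccont dy.
Proof.
move=> cQ H.
have cy : ccont y by apply: (@cder_ccont _ _ dy) => x; case: (H x).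
have cw : ccont (fun t => dy t - Q t * y t).
  by apply: (cder_ccont (df := fun x => ((x ^+ 2)%:C - l) * y x - Q x * dy x - 0)) => x; case: (H x).
rewrite (_ : dy = fun t => (dy t - Q t * y t) + Q t * y t).
  by apply: ccontD => //; exact: ccontM.
by apply/funext => t; rewrite subrK.
Qed.

(** Integration by parts replaces the integral of [q y] by [Q y] minus the integral of [Q dy]. Once
    [Q y] is moved to the left, the integrand is continuous, so the integrated equation and the
    pointwise one are equivalent by the fundamental theorem of calculus. *)
Lemma ode_solP q l y dy : Linfty q ->
  ode_sol q l y dy <-> csol (prim q) l (fun=> 0) y dy.
Proof.
move=> qL; have cQ := prim_ccont qL; split.
  move=> [iy idy yE dyE].
  have cdy : ccont dy.
    rewrite (_ : dy = fun x => dy 0 + oint (fun t => coef q l t * y t) 0 x).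
      by apply: ccontD; [exact: ccont_cst|exact: oint_ccont].
    by apply/funext => x; exact: dyE.
  have ydy x : cder y x (dy x).
    rewrite (_ : y = fun x => y 0 + oint dy 0 x); last by apply/funext => t; exact: yE.
    by apply: cder_eq (cderD (cder_cst _ _) (oint_cder 0 x cdy)) _; rewrite add0r.
  have [_ cE] := coef_oint l qL ydy cdy; have cy := cder_ccont ydy.
  move=> x; split=> //.
  rewrite (_ : (fun t => _) = (fun x => dy 0 +
     oint (fun t => ((t ^+ 2)%:C - l) * y t - prim q t * dy t) 0 x)); last first.
    by apply/funext => t; rewrite dyE cE; ring.
  have c1 : ccont (fun t => ((t ^+ 2)%:C - l) * y t - prim q t * dy t).
    by apply: ccontB; [exact: ccont_sqrB|exact: ccontM].
  by apply: cder_eq (cderD (cder_cst _ _) (oint_cder 0 x c1)) _; rewrite add0r subr0.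
move=> H; have cdy := csol_ccont cQ H.
have ydy x : cder y x (dy x) by case: (H x).
have [iy cE] := coef_oint l qL ydy cdy; have cy := cder_ccont ydy.
split=> //; first exact: ccont_loc_integrable.
  by move=> x; rewrite (oint_of_cder 0 x ydy cdy) addrC subrK.
move=> x; rewrite cE.
have c1 : ccont (fun t => ((t ^+ 2)%:C - l) * y t - prim q t * dy t).
  by apply: ccontB; [exact: ccont_sqrB|exact: ccontM].
have wE t : cder (fun t => dy t - prim q t * y t) t
    (((t ^+ 2)%:C - l) * y t - prim q t * dy t).
  by have [_ h] := H t; apply: cder_eq h _; rewrite subr0.
rewrite (oint_of_cder 0 x wE c1) /= {2}/prim oint_same; ring.
Qed.

Lemma prim_bounded q : Linfty q -> Linfty (prim q) ->
  exists M : R, forall x, cabs (prim q x) <= M.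
Proof.
move=> qL [_ _ [M HM]]; have [L L0 HL] := prim_lipschitz qL.
exists M => x; apply/ler_addgt0Pr => e e0; apply: contrapT => /negP; rewrite -ltNge => xM.
(* If [|Q x| > M + e], the Lipschitz bound keeps [|Q| > M] on all of [[x, x + d]], an interval of
   positive length inside a null set. *)
pose d := e / (L + 1).
have d0 : 0 < d by rewrite divr_gt0// ltr_wpDl.
have H t : x <= t <= x + d -> ~ cabs (prim q t) <= M.
  move=> /andP[xt td] tM.
  have h1 := HL x t; have h2 := cabs_triB (prim q x) (prim q t).
  suff h3 : L * `|x - t| <= e.
    have := le_trans h2 (le_trans h1 h3).
    by rewrite leNgt ltrBrDl (le_lt_trans _ xM)// lerD2r.
  apply: le_trans (_ : L * d <= _).
      by rewrite ler_wpM2l// distrC ger0_norm ?subr_ge0// lerBlDl.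
    by rewrite /d mulrA ler_pdivrMr ?ltr_wpDl// mulrC ler_pM2l// lerDl.
have [N [mN N0 NM]] := HM.
have : (mu `[x, (x + d)%R]%classic <= mu N)%E.
  apply: le_measure; rewrite ?inE//.
  by move=> t /=; rewrite in_itv/= => tI; apply: NM => /=; exact: H.
rewrite N0 lebesgue_measure_itv/= lte_fin ltrDl d0 -EFinD lee_fin addrAC subrr add0r.
by rewrite leNgt d0.
Qed.

End Quasi.

(** * Limits with explicit rates and global existence for linear systems *)

Section Limits.
Context {R : realType}.
Local Notation C := (Cplx R).
Implicit Types (f g : R -> C) (x : R).

Lemma eqW_le (x y : R) : x = y -> x <= y. Proof. by move=> ->. Qed.

Lemma expR_ge1 (x : R) : 0 <= x -> 1 <= expR x.
Proof. by move=> x0; rewrite -expR0 ler_expR. Qed.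

Lemma small_divSn (K e : R) : 0 < e ->
  exists N, forall n, (N <= n)%N -> K / n.+1%:R <= e.
Proof.
move=> e0; exists (Num.bound (K / e)) => n Nn.
rewrite ler_pdivrMr// mulrC -ler_pdivrMr//.
apply: le_trans (ler_norm _) _; apply/ltW.
apply: lt_le_trans (archi_boundP (normr_ge0 _)) _.
rewrite ler_nat; apply: leq_trans (leqnSn _); apply: leq_trans Nn.
by rewrite /Num.bound normr_id.
Qed.

(** The limit is produced before the rate [K]. It can thus be chosen for all points at once, while
    [K] may still depend on a bounded set of points; [0] is the default when no rate exists. *)
Lemma ccauchy_lim (a : nat -> C) : exists L : C, forall K : R,
  (forall n m, (n <= m)%N -> cabs (a m - a n) <= K / n.+1%:R) ->
  forall n, cabs (a n - L) <= K / n.+1%:R.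
Proof.
have [[K0 H0]|no] := pselect (exists K : R,
    forall n m, (n <= m)%N -> cabs (a m - a n) <= K / n.+1%:R); last first.
  by exists 0 => K H; exfalso; apply: no; exists K.
have real_lim (u : nat -> R) : (forall n m, (n <= m)%N -> `|u m - u n| <= K0 / n.+1%:R) ->
    exists l, forall e, 0 < e -> exists N, forall n, (N <= n)%N -> `|u n - l| <= e.
  move=> Hu; have : cvgn u.
    apply/cauchy_cvgP/cauchy_exP => e e0.
    have e2 : 0 < e / 2 by rewrite divr_gt0.
    have [N HN] := small_divSn K0 e2.
    exists (u N); exists N => // n /= Nn.
    have ee : e / 2 < e by rewrite ltr_pdivrMr// ltr_pMr// ltr1n.
    have H := le_lt_trans (le_trans (Hu _ _ Nn) (HN N (leqnn N))) ee.
    by rewrite /ball /= distrC.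
  move=> cu; exists (limn u) => e e0.
  have /cvgrPdist_le/(_ _ e0)[N _ HN] := cu.
  by exists N => n Nn; rewrite distrC; exact: HN.
have [|lr Hr] := real_lim (fun n => cRe (a n)).
  by move=> n m nm; apply: le_trans (H0 n m nm); apply: le_trans (ler_cRe _); rewrite !cReIm.
have [|li Hi] := real_lim (fun n => cIm (a n)).
  by move=> n m nm; apply: le_trans (H0 n m nm); apply: le_trans (ler_cIm _); rewrite !cReIm.
exists (Complex lr li) => K HK n; apply/ler_addgt0Pr => e e0.
have e2 : 0 < e / 2 by rewrite divr_gt0.
have [N1 H1] := Hr _ e2; have [N2 H2] := Hi _ e2.
pose m := maxn n (maxn N1 N2).
have nm : (n <= m)%N by rewrite leq_maxl.
have := H1 m; rewrite /m !leq_max leqnn orbT /= => /(_ isT) h1.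
have := H2 m; rewrite /m !leq_max leqnn !orbT /= => /(_ isT) h2.
apply: le_trans (cabs_distD _ _ (a m)) _; apply: lerD; first by rewrite cabsBC HK.
apply: le_trans (cabs_le_sum _) _; rewrite !cReIm [leRHS]splitr.
by apply: lerD; [exact: h1|exact: h2].
Qed.

Lemma ccontP f : ccont f <-> forall x (e : R), 0 < e -> exists2 d : R, 0 < d &
  forall t, `|t - x| < d -> cabs (f t - f x) <= e.
Proof.
split=> [[f1 f2] x e e0|H].
  have e2 : 0 < e / 2 by rewrite divr_gt0.
  have /cvgrPdist_le/(_ _ e2)[d1 /= d10 H1] := f1 x.
  have /cvgrPdist_le/(_ _ e2)[d2 /= d20 H2] := f2 x.
  exists (Num.min d1 d2); first by rewrite lt_min d10.
  move=> t; rewrite lt_min distrC => /andP[td1 td2].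
  apply: le_trans (cabs_le_sum _) _; rewrite !cReIm [leRHS]splitr distrC.
  by apply: lerD; [exact: H1|rewrite distrC; exact: H2].
split=> x; apply/cvgrPdist_le => e e0; have [d d0 Hd] := H x e e0; exists d => // t /=.
  rewrite distrC => /Hd; rewrite distrC; apply: le_trans.
  by apply: le_trans (ler_cRe _); rewrite !cReIm.
rewrite distrC => /Hd; rewrite distrC; apply: le_trans.
by apply: le_trans (ler_cIm _); rewrite !cReIm.
Qed.

Lemma ccont_bounded f (a b : R) : ccont f ->
  exists2 K : R, 0 <= K & forall x, a <= x <= b -> cabs (f x) <= K.
Proof.
move=> [f1 f2]; have [K1 K10 H1] := continuous_bounded a b f1.
have [K2 K20 H2] := continuous_bounded a b f2.
exists (K1 + K2); first exact: addr_ge0.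
move=> x xab; apply: le_trans (cabs_le_sum _) _.
by apply: lerD; [exact: H1|exact: H2].
Qed.

Lemma ccont_uniform_limit (u : nat -> R -> C) f :
  (forall n, ccont (u n)) ->
  (forall x, exists K : R, forall n t, `|t - x| <= 1 -> cabs (u n t - f t) <= K / n.+1%:R) ->
  ccont f.
Proof.
move=> cu H; apply/ccontP => x e e0; have [K HK] := H x.
have e4 : 0 < e / 4 by rewrite divr_gt0.
have [n /(_ n (leqnn _)) Kn] := small_divSn K e4.
have /ccontP/(_ x _ e4)[d d0 Hd] := cu n.
exists (Num.min d 1); first by rewrite lt_min d0 ltr01.
move=> t; rewrite lt_min => /andP[td t1].
have h1 := le_trans (HK n t (ltW t1)) Kn.
have h2 := Hd t td.
have h3 : cabs (u n x - f x) <= e / 4.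
  by apply: le_trans (HK n x _) Kn; rewrite subrr normr0.
have h4 := cabs_distD (f t) (f x) (u n t); have h5 := cabs_distD (u n t) (f x) (u n x).
rewrite (cabsBC (f t) (u n t)) in h4; lra.
Qed.

(** The weight [exp (c |t - x0|)] is reproduced by integration with a gain of [1/c]; a large [c]
    therefore makes the Picard operator contract on any bounded interval. *)
Lemma oint_bound_exp f (x0 x K c : R) : ccont f -> 0 < c ->
  (forall t, `|t - x0| <= `|x - x0| -> cabs (f t) <= K * (c * expR (c * `|t - x0|))) ->
  cabs (oint f x0 x) <= K * (expR (c * `|x - x0|) - 1).
Proof.
move=> cf c0 Hf; have [x0x|/ltW xx0] := leP x0 x.
  pose g t := K * expR (c * (t - x0)); pose dg t := K * (expR (c * (t - x0)) * (c * (1 - 0))).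
  have H : cabs (oint f x0 x - oint f x0 x0) <= g x - g x0.
    apply: (cder_mean_value (df := f) (dg := dg)) => // t /andP[t1 t2].
    - exact: oint_cder.
    - have := Hf t; rewrite !ger0_norm ?subr_ge0// lerD2r => /(_ t2).
      by rewrite /dg subr0 mulr1 [X in _ <= _ * X]mulrC.
  move: H; rewrite oint_same subr0 /g subrr mulr0 expR0 ger0_norm ?subr_ge0//.
  by rewrite (mulrBr K).
pose g t := - (K * expR (c * (x0 - t))).
pose dg t := - (K * (expR (c * (x0 - t)) * (c * (0 - 1)))).
have H : cabs (oint f x0 x0 - oint f x0 x) <= g x0 - g x.
  apply: (cder_mean_value (df := f) (dg := dg)) => // t /andP[t1 t2].
  - exact: oint_cder.
  - have := Hf t; rewrite !(distrC _ x0) !ger0_norm ?subr_ge0// lerD2l lerN2 => /(_ t1).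
    by rewrite /dg sub0r !mulrN1 !mulrN opprK [X in _ <= _ * X]mulrC.
move: H; rewrite oint_same sub0r cabsN /g subrr mulr0 expR0 distrC ger0_norm ?subr_ge0//.
by rewrite (mulrBr K) opprK addrC.
Qed.

(** Picard iteration in the norm weighted by [exp (4 L |t - x0|)], where [L] bounds the coefficients
    for [|t - x0| <= r]. It converges on intervals of every length, so a global solution arises
    without continuation. *)
Lemma linear_ivp (A : bool -> bool -> R -> C) (x0 : R) (al : bool -> C) :
  (forall i j, ccont (A i j)) ->
  exists X : bool -> R -> C, forall i, X i x0 = al i /\
    forall x, cder (X i) x (A i true x * X true x + A i false x * X false x).
Proof.
move=> cA.
pose rhs (X : bool -> R -> C) i t := A i true t * X true t + A i false t * X false t.
pose step X i x := al i + oint (rhs X i) x0 x.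
pose X n := iter n step (fun i _ => al i).
have XS n : X n.+1 = step (X n) by [].
have crhs Y i : (forall j, ccont (Y j)) -> ccont (rhs Y i).
  by move=> cY; apply: ccontD; apply: ccontM.
have cX n i : ccont (X n i).
  elim: n i => [|n IH] i; first exact: ccont_cst.
  rewrite XS /step; apply: ccontD; first exact: ccont_cst.
  by apply: oint_ccont; apply: ccont_loc_integrable; apply: crhs.
have Abd r : exists2 L : R, 1 <= L & forall i j t, `|t - x0| <= r -> cabs (A i j t) <= L.
  have H i j : exists2 K : R, 0 <= K & forall t, `|t - x0| <= r -> cabs (A i j t) <= K.
    have [K K0 HK] := ccont_bounded (x0 - r) (x0 + r) (cA i j).
    exists K => // t; rewrite ler_norml => /andP[? ?]; apply: HK; apply/andP; split; lra.
  have [K1 ? H1] := H true true; have [K2 ? H2] := H true false.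
  have [K3 ? H3] := H false true; have [K4 ? H4] := H false false.
  exists (1 + K1 + K2 + K3 + K4); first lra.
  move=> [] [] t tr; [have := H1 _ tr|have := H2 _ tr|have := H3 _ tr|have := H4 _ tr]; lra.
(* Each component of the right-hand side has two terms of size at most [L K] times the weight, and
   [2 L K = (K / 2) (4 L)]: one step halves the distance. *)
have step_bd r (L : R) (Y Z : bool -> R -> C) (K : R) : 0 < L -> 0 <= K ->
    (forall i j t, `|t - x0| <= r -> cabs (A i j t) <= L) ->
    (forall i, ccont (Y i)) -> (forall i, ccont (Z i)) ->
    (forall i t, `|t - x0| <= r -> cabs (Y i t - Z i t) <= K * expR (4 * L * `|t - x0|)) ->
    forall i t, `|t - x0| <= r ->
      cabs (step Y i t - step Z i t) <= K / 2 * expR (4 * L * `|t - x0|).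
  move=> L0 K0 AL cY cZ H i t tr.
  rewrite /step [X in cabs X](_ : _ = oint (fun s => rhs Y i s - rhs Z i s) x0 t); last first.
    have := @ointD R (fun s => rhs Y i s - rhs Z i s) (rhs Z i) x0 t.
    rewrite (_ : (fun s => rhs Y i s - rhs Z i s + rhs Z i s) = rhs Y i); last first.
      by apply/funext => s; rewrite subrK.
    move=> ->; first by ring.
      by apply: ccont_loc_integrable; apply: ccontB; exact: crhs.
    by apply: ccont_loc_integrable; exact: crhs.
  apply: le_trans (_ : K / 2 * (expR (4 * L * `|t - x0|) - 1) <= _); last first.
    by rewrite ler_wpM2l ?divr_ge0// gerBl.
  apply: oint_bound_exp; [by apply: ccontB; exact: crhs|by rewrite mulr_gt0|].
  move=> s st; have sr := le_trans st tr.
  rewrite /rhs (_ : _ - _ = A i true s * (Y true s - Z true s) +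
      A i false s * (Y false s - Z false s)); last by ring.
  apply: le_trans (cabsD _ _) _; rewrite !cabsM.
  have b1 : cabs (A i true s) * cabs (Y true s - Z true s) <= L * (K * expR (4 * L * `|s - x0|)).
    by apply: ler_pM; rewrite ?cabs_ge0 ?AL ?H.
  have b2 : cabs (A i false s) * cabs (Y false s - Z false s) <= L * (K * expR (4 * L * `|s - x0|)).
    by apply: ler_pM; rewrite ?cabs_ge0 ?AL ?H.
  by apply: le_trans (lerD b1 b2) _; lra.
have incr (r : R) : exists2 K : R, 0 <= K & forall n i t, `|t - x0| <= r ->
    cabs (X n.+1 i t - X n i t) <= K / 2 ^+ n.
  have [L L1 AL] := Abd r; have L0 : 0 < L by apply: lt_le_trans L1.
  have H0 i : exists2 K : R, 0 <= K & forall t, `|t - x0| <= r -> cabs (X 1%N i t - X 0%N i t) <= K.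
    have [K K0 HK] := ccont_bounded (x0 - r) (x0 + r) (ccontB (cX 1%N i) (cX 0%N i)).
    exists K => // t; rewrite ler_norml => /andP[? ?]; apply: HK; apply/andP; split; lra.
  have [K1 K10 H1] := H0 true; have [K2 K20 H2] := H0 false.
  have K0 : 0 <= K1 + K2 by exact: addr_ge0.
  have H n : forall i t, `|t - x0| <= r -> cabs (X n.+1 i t - X n i t) <=
      (K1 + K2) / 2 ^+ n * expR (4 * L * `|t - x0|).
    elim: n => [|n IH] i t tr.
      rewrite expr0 divr1; apply: le_trans (_ : K1 + K2 <= _).
        by case: i; [have := H1 t tr|have := H2 t tr]; lra.
      by rewrite ler_peMr// expR_ge1// !mulr_ge0// ltW.
    rewrite (XS n.+1) (XS n).
    have := step_bd r L (X n.+1) (X n) ((K1 + K2) / 2 ^+ n) L0 _ AL (cX _) (cX _) IH i t tr.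
    by rewrite exprS invfM mulrA (mulrAC _ _ (2 ^+ n)^-1); apply; rewrite divr_ge0// exprn_ge0.
  exists ((K1 + K2) * expR (4 * L * r)); first by rewrite mulr_ge0// expR_ge0.
  move=> n i t tr; apply: le_trans (H n i t tr) _.
  rewrite mulrAC ler_wpM2r ?invr_ge0 ?exprn_ge0// ler_wpM2l// ler_expR ler_wpM2l//.
  by rewrite mulr_ge0// ltW.
have cauchy (r : R) : exists2 K : R, 0 <= K & forall i t, `|t - x0| <= r ->
    forall n m, (n <= m)%N -> cabs (X m i t - X n i t) <= K / n.+1%:R.
  have [K K0 HK] := incr r; exists (2 * K); first by rewrite mulr_ge0.
  move=> i t tr n m nm.
  (* The geometric rate is weakened to the rate [1 / (n + 1)] of [ccauchy_lim]. Subtracting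
     [2 K / 2^m] below is what makes the induction on [m - n] telescope. *)
  apply: le_trans (_ : 2 * K / 2 ^+ n <= _); last first.
    rewrite ler_wpM2l ?mulr_ge0// lef_pV2 ?posrE ?exprn_gt0//.
    by rewrite -natrX ler_nat ltn_expl.
  suff : cabs (X m i t - X n i t) <= 2 * K / 2 ^+ n - 2 * K / 2 ^+ m.
    move/le_trans; apply; rewrite gerBl divr_ge0 ?mulr_ge0 ?exprn_ge0//.
  rewrite -(subnKC nm); elim: (m - n)%N => [|k IH]; first by rewrite addn0 !subrr cabs0.
  rewrite addnS; apply: le_trans (cabs_distD _ _ (X (n + k)%N i t)) _.
  apply: le_trans (lerD (HK _ i t tr) IH) _.
  rewrite exprS invfM; set z := (2 ^+ (n + k))^-1; lra.
have [Y HY] : exists Y : bool -> R -> C, forall i t (K : R),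
    (forall n m, (n <= m)%N -> cabs (X m i t - X n i t) <= K / n.+1%:R) ->
    forall n, cabs (X n i t - Y i t) <= K / n.+1%:R.
  have /choice[Y HY] := fun p : bool * R => ccauchy_lim (fun n => X n p.1 p.2).
  by exists (fun i t => Y (i, t)) => i t; exact: HY (i, t).
have cvY (r : R) : exists2 K : R, 0 <= K & forall i t n, `|t - x0| <= r ->
    cabs (X n i t - Y i t) <= K / n.+1%:R.
  by have [K K0 HK] := cauchy r; exists K => // i t n tr; apply: HY => ? ? ?; exact: HK.
have cY i : ccont (Y i).
  apply: (@ccont_uniform_limit (fun n => X n i)) => // x.
  have [K K0 HK] := cvY (`|x - x0| + 1); exists K => n t t1; apply: HK.
  have := ler_distD x t x0; lra.
have YE i x : Y i x = step Y i x.
  apply/eqP; rewrite -subr_eq0; apply/eqP/cabs_eq0/eqP; rewrite eq_le cabs_ge0 andbT.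
  apply/ler_addgt0Pr => e e0; rewrite add0r.
  have [L L1 AL] := Abd `|x - x0|; have L0 : 0 < L by apply: lt_le_trans L1.
  have [K K0 HK] := cvY `|x - x0|.
  pose K' := K + K * expR (4 * L * `|x - x0|).
  have K'0 : 0 <= K' by rewrite addr_ge0// mulr_ge0 ?expR_ge0.
  have [n /(_ n (leqnn _)) Kn] := small_divSn K' e0.
  apply: le_trans Kn; apply: le_trans (cabs_distD _ _ (X n.+1 i x)) _.
  rewrite /K' mulrDl; apply: lerD.
    rewrite cabsBC; apply: le_trans (HK i x n.+1 (lexx _)) _.
    by rewrite ler_wpM2l// lef_pV2 ?posrE// ler_nat.
  rewrite XS.
  have Kn0 : 0 <= K / n.+1%:R by rewrite divr_ge0.
  apply: le_trans (step_bd `|x - x0| L (X n) Y (K / n.+1%:R) L0 Kn0 AL (cX n) cY _ i x (lexx _)) _.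
    move=> j t tx; apply: le_trans (HK j t n tx) _.
    by rewrite ler_peMr// expR_ge1// !mulr_ge0// ltW.
  have : 0 <= K / n.+1%:R * expR (4 * L * `|x - x0|) by rewrite mulr_ge0 ?expR_ge0.
  by set z := n.+1%:R^-1; lra.
exists Y => i; split; first by rewrite YE /step oint_same addr0.
move=> x; rewrite (_ : Y i = step Y i); last by apply/funext => t; exact: YE.
apply: cder_eq (cderD (cder_cst _ _) (oint_cder x0 x _)) _; first exact: crhs.
by rewrite add0r.
Qed.

End Limits.

(** * Initial value problem, Gronwall bounds and monotonicity for the equation *)

Section LinearODE.
Context {R : realType}.
Local Notation C := (Cplx R).
Implicit Types (Q F y dy f g : R -> C) (l : C) (x : R).

Lemma csol_ivp Q l (x0 : R) (al be : C) : ccont Q ->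
  exists y dy, [/\ csol Q l (fun=> 0) y dy, y x0 = al & dy x0 = be].
Proof.
move=> cQ.
(* The unknowns are [y] (index [true]) and [w = dy - Q y] (index [false]): [y' = Q y + w] and
   [w' = (x^2 - l - Q^2) y - Q w]. *)
pose A (i j : bool) : R -> C := match i, j with
  | true, true => Q | true, false => fun=> 1
  | false, true => fun x => ((x ^+ 2)%:C - l) - Q x * Q x | false, false => fun x => - Q x end.
have cA i j : ccont (A i j).
  case: i; case: j => //=; first exact: ccont_cst.
    apply: ccontB; last exact: ccontM.
    by apply: ccontB; [exact: ccont_sqr|exact: ccont_cst].
  exact: ccontN.
have [Y HY] := linear_ivp x0 (fun i : bool => if i then al else be - Q x0 * al) cA.
have [Y1 D1] := HY true; have [Y2 D2] := HY false.
exists (Y true), (fun x => Y false x + Q x * Y true x); split.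
- move=> x; split.
    by apply: cder_eq (D1 x) _; rewrite /A mul1r addrC.
  rewrite (_ : (fun t => _) = Y false); last by apply/funext => t; rewrite addrK.
  by apply: cder_eq (D2 x) _; rewrite /A; ring.
- by [].
- by rewrite Y1 Y2 subrK.
Qed.

Lemma csolD Q l F1 F2 y1 dy1 y2 dy2 : csol Q l F1 y1 dy1 -> csol Q l F2 y2 dy2 ->
  csol Q l (fun x => F1 x + F2 x) (fun x => y1 x + y2 x) (fun x => dy1 x + dy2 x).
Proof.
move=> H1 H2 x; have [a1 b1] := H1 x; have [a2 b2] := H2 x; split; first exact: cderD.
rewrite (_ : (fun t => _) = (fun t => (dy1 t - Q t * y1 t) + (dy2 t - Q t * y2 t))).
  by apply: cder_eq (cderD b1 b2) _; ring.
by apply/funext => t; ring.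
Qed.

Lemma csolZ Q l F (c : C) y dy : csol Q l F y dy ->
  csol Q l (fun x => c * F x) (fun x => c * y x) (fun x => c * dy x).
Proof.
move=> H x; have [a b] := H x; split; first exact: cderMl.
rewrite (_ : (fun t => _) = (fun t => c * (dy t - Q t * y t))).
  by apply: cder_eq (cderMl c b) _; ring.
by apply/funext => t; ring.
Qed.

Lemma csolB Q l F1 F2 y1 dy1 y2 dy2 : csol Q l F1 y1 dy1 -> csol Q l F2 y2 dy2 ->
  csol Q l (fun x => F1 x - F2 x) (fun x => y1 x - y2 x) (fun x => dy1 x - dy2 x).
Proof.
move=> H1 /(csolZ (-1)) H2; have := csolD H1 H2.
by congr (csol _ _ _ _ _); apply/funext => x; rewrite mulN1r.
Qed.

(** A change of parameter becomes a source term, so that solutions for different parameters can be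
    subtracted within one equation. *)
Lemma csol_shift Q l m F y dy : csol Q m F y dy ->
  csol Q l (fun x => F x + (m - l) * y x) y dy.
Proof. by move=> H x; have [a b] := H x; split => //; apply: cder_eq b _; ring. Qed.

Lemma csol_ext Q l F G y dy : csol Q l F y dy -> F =1 G -> csol Q l G y dy.
Proof. by move=> H /funext <-. Qed.

(** The real inner product [Re (conj z * w)]; its diagonal is the squared modulus, which unlike the
    modulus is differentiable at zeros. *)
Definition cdot (z w : C) : R := cRe z * cRe w + cIm z * cIm w.

Lemma cdot_le z w : `|cdot z w| <= cabs z * cabs w.
Proof.
rewrite -(cabs_conj z) -cabsM; apply: le_trans (ler_cRe _).
by rewrite !cReIm mulNr opprK.
Qed.

Lemma rder_cdot f g x (d e : C) : cder f x d -> cder g x e ->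
  is_derive x 1 (fun t => cdot (f t) (g t)) (cdot d (g x) + cdot (f x) e).
Proof.
move=> [a b] [a' b']; apply: rder_eq (rderD (rderM a a') (rderM b b')) _.
by rewrite /cdot /=; ring.
Qed.

Lemma cdotxx z : cdot z z = cabs z ^+ 2.
Proof. by rewrite /cdot cabs2 !expr2. Qed.

Definition energy Q y dy x := cdot (y x) (y x) + cdot (dy x - Q x * y x) (dy x - Q x * y x).

Lemma energy_ge0 Q y dy x : 0 <= energy Q y dy x.
Proof. by rewrite /energy !cdotxx addr_ge0// sqr_ge0. Qed.

(** [E + f^2] satisfies [|(E + f^2)'| <= L (E + f^2)], which integrates in both directions. Placing
    [G] before [Q], [l], [F] and the solution gives the uniformity in [l] needed for holomorphy. *)
Lemma gronwall (B r a b : R) : 0 <= B -> 0 <= r -> a <= b ->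
  exists2 G : R, 0 < G & forall Q l F y dy (f : R),
    (forall t, cabs (Q t) <= B) -> cabs l <= r -> csol Q l F y dy -> 0 <= f ->
    (forall t, a <= t <= b -> cabs (F t) <= f) ->
    forall x x0, a <= x <= b -> a <= x0 <= b ->
      energy Q y dy x <= G * (energy Q y dy x0 + f ^+ 2).
Proof.
move=> B0 r0 ab; pose K := a ^+ 2 + b ^+ 2 + r + B ^+ 2; pose L := 2 * B + K + 2.
have K0 : 0 <= K by rewrite /K !addr_ge0// sqr_ge0.
have L0 : 0 <= L by move: K0; rewrite /L; clearbody K; lra.
exists (expR (L * (b - a))); first exact: expR_gt0.
move=> Q l F y dy f QB lr H f0 Ff.
pose E := energy Q y dy; pose w t := dy t - Q t * y t.
pose dw t := ((t ^+ 2)%:C - l) * y t - Q t * dy t - F t.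
pose dE t := cdot (dy t) (y t) + cdot (y t) (dy t) + (cdot (dw t) (w t) + cdot (w t) (dw t)).
have EdE (t : R) : is_derive t 1 E (dE t).
  by have [h1 h2] := H t; exact: rderD (rder_cdot h1 h1) (rder_cdot h2 h2).
have dEL t : a <= t <= b -> `|dE t| <= L * (E t + f ^+ 2).
  move=> tab; rewrite /E /energy !cdotxx -/(w t).
  have dyE : dy t = w t + Q t * y t by rewrite /w subrK.
  have tt : t ^+ 2 <= a ^+ 2 + b ^+ 2.
    by move: tab => /andP[? ?]; have [t0|t0] := leP 0 t; nra.
  set Y := cabs (y t); set W := cabs (w t).
  have Y0 : 0 <= Y := cabs_ge0 _; have W0 : 0 <= W := cabs_ge0 _.
  have h1 : cabs (dy t) <= W + B * Y.
    rewrite dyE; apply: le_trans (cabsD _ _) _; rewrite lerD2l cabsM.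
    by rewrite ler_wpM2r// cabs_ge0.
  have h2 : cabs (dw t) <= K * Y + B * W + f.
    apply: le_trans (cabsB _ _) _; apply: lerD; last exact: Ff.
    apply: le_trans (cabsB _ _) _; rewrite !cabsM.
    have k1 : cabs ((t ^+ 2)%:C - l) <= a ^+ 2 + b ^+ 2 + r.
      apply: le_trans (cabsB _ _) _; rewrite cabsC ger0_norm ?sqr_ge0//.
      exact: lerD.
    have k2 : cabs ((t ^+ 2)%:C - l) * Y <= (a ^+ 2 + b ^+ 2 + r) * Y by rewrite ler_wpM2r.
    have k3 : cabs (Q t) * cabs (dy t) <= B * (W + B * Y).
      by apply: ler_pM; rewrite ?cabs_ge0.
    rewrite /K; apply: le_trans (lerD k2 k3) _; apply: eqW_le; ring.
  have m1 : `|cdot (dy t) (y t)| <= (W + B * Y) * Y.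
    by apply: le_trans (cdot_le _ _) _; rewrite ler_wpM2r.
  have m2 : `|cdot (y t) (dy t)| <= Y * (W + B * Y).
    by apply: le_trans (cdot_le _ _) _; rewrite ler_wpM2l.
  have m3 : `|cdot (dw t) (w t)| <= (K * Y + B * W + f) * W.
    by apply: le_trans (cdot_le _ _) _; rewrite ler_wpM2r.
  have m4 : `|cdot (w t) (dw t)| <= W * (K * Y + B * W + f).
    by apply: le_trans (cdot_le _ _) _; rewrite ler_wpM2l.
  apply: le_trans (ler_normD _ _) _.
  apply: le_trans (lerD (ler_normD _ _) (ler_normD _ _)) _.
  apply: le_trans (lerD (lerD m1 m2) (lerD m3 m4)) _.
  (* The gap between [L (E + f^2)] and the bound on [|dE|] is an explicit sum of nonnegative terms,
     [2 Y W] and [2 W f] being absorbed by squares. *)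
  have s1 : 0 <= (Y - W) ^+ 2 := sqr_ge0 _; have s2 : 0 <= (W - f) ^+ 2 := sqr_ge0 _.
  have s3 : 0 <= K * (Y - W) ^+ 2 by rewrite mulr_ge0.
  have s4 : 0 <= B * f ^+ 2 by rewrite mulr_ge0 ?sqr_ge0.
  have s5 : 0 <= K * f ^+ 2 by rewrite mulr_ge0 ?sqr_ge0.
  have s6 : 0 <= f ^+ 2 := sqr_ge0 _; have s7 : 0 <= Y ^+ 2 := sqr_ge0 _.
  rewrite /L; rewrite -subr_ge0.
  rewrite [X in 0 <= X](_ : _ = (Y - W) ^+ 2 + (W - f) ^+ 2 + K * (Y - W) ^+ 2 +
    2 * (B * f ^+ 2) + K * f ^+ 2 + f ^+ 2 + Y ^+ 2); last by ring.
  by rewrite !addr_ge0// mulr_ge0.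
have fwd s t : a <= s -> s <= t -> t <= b -> E t + f ^+ 2 <= expR (L * (t - s)) * (E s + f ^+ 2).
  move=> as_ st tb.
  pose phi u := - ((E u + f ^+ 2) * expR (- L * u)).
  pose dphi u := - ((dE u + 0) * expR (- L * u) + (E u + f ^+ 2) * (expR (- L * u) * (- L * 1))).
  have : phi s <= phi t.
    apply: (@is_derive_nondecr _ phi dphi) => // u /andP[su ut].
      have e1 := rderD (EdE u) (rder_cst (f ^+ 2) u).
      have e2 := rder_exp (rderMl (- L) (rder_id u)).
      exact: rderN (rderM e1 e2).
    have := dEL u; rewrite (le_trans as_ su) (le_trans ut tb) => /(_ isT).
    rewrite ler_norml => /andP[_ d1].
    rewrite /dphi addr0 mulr1 oppr_ge0 mulrCA [X in _ + X]mulrC -mulrDl.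
    by rewrite pmulr_lle0 ?expR_gt0// mulrN subr_le0 mulrC.
  rewrite /phi lerN2 => h.
  rewrite -(ler_pM2r (expR_gt0 (- L * t))); apply: le_trans h _.
  rewrite mulrAC -expRD (_ : L * (t - s) + - L * t = - L * s); last by ring.
  by rewrite mulrC.
have bwd s t : a <= s -> s <= t -> t <= b -> E s + f ^+ 2 <= expR (L * (t - s)) * (E t + f ^+ 2).
  move=> as_ st tb.
  pose phi u := (E u + f ^+ 2) * expR (L * u).
  pose dphi u := (dE u + 0) * expR (L * u) + (E u + f ^+ 2) * (expR (L * u) * (L * 1)).
  have : phi s <= phi t.
    apply: (@is_derive_nondecr _ phi dphi) => // u /andP[su ut].
      have e1 := rderD (EdE u) (rder_cst (f ^+ 2) u).
      have e2 := rder_exp (rderMl L (rder_id u)).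
      exact: rderM e1 e2.
    have := dEL u; rewrite (le_trans as_ su) (le_trans ut tb) => /(_ isT).
    rewrite ler_norml => /andP[d1 _].
    rewrite /dphi addr0 mulr1 mulrCA [X in _ + X]mulrC -mulrDl.
    by rewrite pmulr_lge0 ?expR_gt0// -lerBlDr sub0r mulrC.
  rewrite /phi => h.
  rewrite -(ler_pM2r (expR_gt0 (L * s))); apply: le_trans h _.
  rewrite mulrAC -expRD (_ : L * (t - s) + L * s = L * t); last by ring.
  by rewrite mulrC.
move=> x x0 /andP[ax xb] /andP[ax0 x0b].
have f20 : 0 <= f ^+ 2 := sqr_ge0 _.
apply: le_trans (_ : E x + f ^+ 2 <= _); first by rewrite lerDl.
have E0 : 0 <= E x0 + f ^+ 2 by rewrite addr_ge0// energy_ge0.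
have [xx0|/ltW x0x] := leP x x0.
  apply: le_trans (bwd _ _ ax xx0 x0b) _.
  by rewrite ler_wpM2r// ler_expR ler_wpM2l// lerB.
apply: le_trans (fwd _ _ ax0 x0x xb) _.
by rewrite ler_wpM2r// ler_expR ler_wpM2l// lerB.
Qed.

Lemma csol_unique Q l (B : R) y dy x0 : (forall t, cabs (Q t) <= B) ->
  csol Q l (fun=> 0) y dy -> y x0 = 0 -> dy x0 = 0 -> forall x, y x = 0 /\ dy x = 0.
Proof.
move=> QB H y0 dy0 x.
have B0 : 0 <= B by exact: le_trans (cabs_ge0 _) (QB 0).
have ab : Num.min x x0 <= Num.max x x0 by rewrite le_max ge_min lexx.
have [G G0 HG] := gronwall B0 (cabs_ge0 l) ab.
have := HG Q l (fun=> 0) y dy 0 QB (lexx _) H (lexx _) _ x x0 _ _.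
rewrite {2}/energy y0 dy0 mulr0 subr0 /cdot !cReIm !mul0r !addr0 expr0n/= addr0 mulr0.
have bx : Num.min x x0 <= x <= Num.max x x0 by rewrite le_max ge_min lexx.
have bx0 : Num.min x x0 <= x0 <= Num.max x x0 by rewrite le_max ge_min lexx !orbT.
have z0 t : Num.min x x0 <= t <= Num.max x x0 -> cabs (0 : C) <= 0 by rewrite cabs0.
move=> /(_ z0 bx bx0) E0.
have yx : y x = 0.
  apply: cabs_eq0; apply/eqP; rewrite -sqrf_eq0 eq_le sqr_ge0 andbT.
  apply: le_trans E0; rewrite /energy !cdotxx lerDl sqr_ge0//.
split=> //; apply: cabs_eq0; apply/eqP; rewrite -sqrf_eq0 eq_le sqr_ge0 andbT.
by apply: le_trans E0; rewrite /energy yx mulr0 subr0 !cdotxx lerDr sqr_ge0.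
Qed.

(* [Re (conj u * w) - B |u|^2] has nonnegative derivative where [x^2 >= Re l + 4 B^2]. *)
Lemma csol_sq_nondecr Q l (B : R) u du X : (forall t, cabs (Q t) <= B) ->
  csol Q l (fun=> 0) u du -> 0 <= X -> cRe l + 4 * B ^+ 2 <= X ^+ 2 -> u X = 0 ->
  forall x t, X <= x -> x <= t -> cabs (u x) <= cabs (u t).
Proof.
move=> QB H X0 XB uX.
pose w t := du t - Q t * u t; pose dw t := ((t ^+ 2)%:C - l) * u t - Q t * du t - 0.
pose G t := cdot (u t) (w t) - B * cdot (u t) (u t).
pose dG t := (cdot (du t) (w t) + cdot (u t) (dw t)) -
  B * (cdot (du t) (u t) + cdot (u t) (du t)).
have dGP (t : R) : is_derive t 1 G (dG t).
  have [h1 h2] := H t.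
  exact: rderB (rder_cdot h1 h2) (rderMl B (rder_cdot h1 h1)).
have B0 : 0 <= B by exact: le_trans (cabs_ge0 _) (QB 0).
have QRe t : `|cRe (Q t)| <= B := le_trans (ler_cRe _) (QB t).
have dG0 t : X <= t -> 0 <= dG t.
  move=> Xt.
  have -> : dG t = cabs (du t) ^+ 2 + (t ^+ 2 - cRe l) * cabs (u t) ^+ 2 -
      2 * (B + cRe (Q t)) * cdot (u t) (du t).
    by rewrite /dG /w /dw -!cdotxx /cdot !cReIm; ring.
  have h1 := cdot_le (u t) (du t).
  set S := cdot (u t) (du t); set U := cabs (u t); set V := cabs (du t).
  have U0 : 0 <= U := cabs_ge0 _; have V0 : 0 <= V := cabs_ge0 _.
  have h2 : (B + cRe (Q t)) * S <= 2 * B * (U * V).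
    have := QRe t; rewrite ler_norml => /andP[q1 q2].
    apply: le_trans (_ : (B + cRe (Q t)) * (U * V) <= _).
      by rewrite ler_wpM2l -?lerBlDl ?sub0r// (le_trans (ler_norm _) h1).
    by rewrite ler_wpM2r ?mulr_ge0//; lra.
  have h3 : 4 * B ^+ 2 * U ^+ 2 <= (t ^+ 2 - cRe l) * U ^+ 2.
    rewrite ler_wpM2r ?sqr_ge0//.
    have : X ^+ 2 <= t ^+ 2 by rewrite ler_pXn2r ?nnegrE// (le_trans X0 Xt).
    lra.
  have h4 := sqr_ge0 (V - 2 * B * U); nra.
have Gge0 t : X <= t -> 0 <= G t.
  move=> Xt; have : G X <= G t.
    by apply: (@is_derive_nondecr _ G dG _ _ Xt) => // s /andP[Xs _]; exact: dG0.
  by rewrite {1}/G uX /cdot !cReIm !mul0r !addr0 mulr0 subr0.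
move=> x t Xx xt.
rewrite -(ler_pXn2r (n := 2))// ?nnegrE ?cabs_ge0// -!cdotxx.
apply: (@is_derive_nondecr _ (fun s => cdot (u s) (u s))
   (fun s => cdot (du s) (u s) + cdot (u s) (du s))) => // s /andP[xs _].
  by have [h1 _] := H s; exact: rder_cdot.
have := Gge0 s (le_trans Xx xs).
have := QRe s; rewrite ler_norml => /andP[q1 _].
have : 0 <= (B + cRe (Q s)) * cdot (u s) (u s).
  by apply: mulr_ge0; [lra|rewrite cdotxx sqr_ge0].
rewrite /G /w /cdot !cReIm; lra.
Qed.

End LinearODE.

(** * The correction [h] of the approximate solution *)

Section WKB.
Context {R : realType}.
Local Notation C := (Cplx R).
Implicit Types (Q : R -> C) (l : C) (x : R).

(** [G] plays the role of the tail integral of a bound for [|df|]. The condition [G t <= K / t]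
    provides the rate of [ccauchy_lim] along the sample points [X + n]. *)
Lemma ctail_lim (f df : R -> C) (G dG : R -> R) (X K : R) : 1 <= X ->
  (forall t, X <= t -> cder f t (df t)) ->
  (forall t, X <= t -> is_derive t 1 G (dG t)) ->
  (forall t, X <= t -> cabs (df t) <= - dG t) ->
  (forall t, X <= t -> 0 <= G t <= K / t) ->
  exists L : C, forall x, X <= x -> cabs (f x - L) <= G x.
Proof.
move=> X1 fdf GdG dfG G0.
have diff s t : X <= s -> s <= t -> cabs (f t - f s) <= G s.
  move=> Xs st; apply: le_trans (_ : - G t - - G s <= _); last first.
    by have /andP[? _] := G0 t (le_trans Xs st); lra.
  apply: (@cder_mean_value _ f df (fun t => - G t) (fun t => - dG t)) => // v /andP[sv vt].
  - exact/fdf/(le_trans Xs).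
  - exact/rderN/GdG/(le_trans Xs).
  - exact/dfG/(le_trans Xs).
have K0 : 0 <= K.
  have /andP[g0 g1] := G0 X (lexx X); have := le_trans g0 g1.
  by rewrite pmulr_lge0// invr_gt0 (lt_le_trans _ X1).
have Gn n : G (X + n%:R) <= K / n.+1%:R.
  have Xn : X <= X + n%:R by rewrite lerDl.
  have /andP[_ g1] := G0 _ Xn; apply: le_trans g1 _; rewrite ler_wpM2l//.
  have Xn0 : 0 < X + n%:R by rewrite (lt_le_trans _ (le_trans X1 Xn)).
  by rewrite lef_pV2 ?posrE// -nat1r lerD2r.
have [L HL] := ccauchy_lim (fun n => f (X + n%:R)).
exists L => x Xx; apply/ler_addgt0Pr => e e0.
have H n m : (n <= m)%N -> cabs (f (X + m%:R) - f (X + n%:R)) <= K / n.+1%:R.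
  by move=> nm; apply: le_trans (diff _ _ _ _) (Gn n); rewrite ?lerDl// lerD2l ler_nat.
have {H}HK := HL K H.
have [n1 Hn1] := small_divSn K e0.
pose n := maxn n1 (Num.bound x).
have xn : x <= X + n%:R.
  apply: le_trans (_ : n%:R <= _); last by rewrite lerDr (le_trans _ X1).
  have x0 : 0 <= x by rewrite (le_trans _ Xx)// (le_trans _ X1).
  by apply: le_trans (ltW (archi_boundP x0)) _; rewrite ler_nat leq_maxr.
apply: le_trans (cabs_distD _ _ (f (X + n%:R))) _; apply: lerD.
  by rewrite cabsBC; exact: diff.
by apply: le_trans (HK n) (Hn1 n _); rewrite leq_maxl.
Qed.

Lemma expRNsqr_le x : 1 <= x -> expR (- x ^+ 2) <= 1 / x.
Proof.
move=> x1; have x0 : 0 < x by apply: lt_le_trans x1.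
rewrite expRN div1r lef_pV2 ?posrE ?expR_gt0//.
apply: le_trans (_ : 1 + x ^+ 2 <= _); last exact: expR_ge1Dx.
by nra.
Qed.

Lemma rder_gauss x : is_derive x 1 (fun t : R => expR (- t ^+ 2)) (expR (- x ^+ 2) * (- (2 * x))).
Proof.
have h := rderN (rderX 1 x); rewrite expr1 in h; exact: (rder_exp h).
Qed.

(* The formal solution [exp h] of the transport equation [h'' - 2 x h' = q] uses only the primitive
   [Q] of [q]: [g = h'] satisfies [(g - Q)' = 2 x g], which makes [g = O(1/x)] by Lipschitz
   continuity of [Q] and [g = (g - Q)' / (2x)] integrable by its boundedness. *)
Lemma wkb_correction Q (B M : R) : ccont Q -> (forall t, cabs (Q t) <= B) ->
  (forall s t, cabs (Q s - Q t) <= M * `|s - t|) -> 0 <= M ->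
  exists g h : R -> C, exists2 K : R, 0 <= K & forall x, 1 <= x ->
    [/\ cder h x (g x), cder (fun t => g t - Q t) x ((2 * x)%:C * g x),
        cabs (g x) <= K / x & cabs (h x) <= K / x].
Proof.
move=> cQ QB QM M0.
have B0 : 0 <= B by exact: le_trans (cabs_ge0 _) (QB 0).
pose e2 (x : R) := expR (- x ^+ 2).
have ce2 : continuous e2 by move=> x; exact: rder_continuous (rder_gauss x).
pose dI (t : R) : C := (2 * t * e2 t)%:C * Q t.
have cdI : ccont dI.
  apply: ccontM => //; apply: ccont_real => t; apply: cvgM; last exact: ce2.
  by apply: cvgM; [exact: cvg_cst|exact: cvg_id].
pose I := oint dI 0.
have IdI t : cder I t (dI t) by exact: oint_cder.
have e2gt0 t : 0 < e2 t by exact: expR_gt0.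
have [L HL] : exists L : C, forall x, 1 <= x -> cabs (I x - L) <= B * e2 x.
  apply: (@ctail_lim I dI (fun t => B * e2 t) (fun t => B * (e2 t * (- (2 * t)))) 1 B (lexx 1)) => t t1.
  - exact: IdI.
  - exact: (rderMl B (rder_gauss t)).
  - rewrite /dI cabsM cabsC ger0_norm; last by rewrite !mulr_ge0// ?(le_trans _ t1)// ltW.
    rewrite mulrN mulrN opprK (mulrC B) [e2 t * _]mulrC.
    by rewrite ler_wpM2l// !mulr_ge0// ?(le_trans _ t1)// ltW.
  - apply/andP; split; first by rewrite mulr_ge0// ltW.
    by rewrite ler_wpM2l//; have := expRNsqr_le t1; rewrite div1r.
(* [k] is to be [g - Q], so [k' = 2 x (k + Q)], that is [(exp (- x^2) k)' = 2 x exp (- x^2) Q].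
   Subtracting the limit [L] of [I] selects the bounded solution; another constant would leave a
   term growing like [exp (x^2)]. *)
pose k x : C := (expR (x ^+ 2))%:C * (I x - L).
pose g x := k x + Q x.
have ee x : expR (x ^+ 2) * e2 x = 1 by rewrite /e2 -expRD subrr expR0.
have kder x : cder k x ((2 * x)%:C * g x).
  have h1 : cder (fun t => (expR (t ^+ 2))%:C : C) x (expR (x ^+ 2) * (2 * x))%:C.
    have h := rderX 1 x; rewrite expr1 in h.
    exact: (cder_real (rder_exp h)).
  apply: cder_eq (cderM h1 (cderB (IdI x) (cder_cst L x))) _.
  rewrite subr0 /g /dI /k.
  rewrite (_ : (expR (x ^+ 2))%:C * ((2 * x * e2 x)%:C * Q x) =
    (2 * x)%:C * (expR (x ^+ 2) * e2 x)%:C * Q x); last by rewrite !rmorphM/=; ring.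
  by rewrite ee !rmorphM/=; ring.
have kB x : 1 <= x -> cabs (k x) <= B.
  move=> x1; rewrite /k cabsM cabsC ger0_norm ?expR_ge0//.
  apply: le_trans (_ : expR (x ^+ 2) * (B * e2 x) <= _).
    by rewrite ler_wpM2l ?expR_ge0// HL.
  by rewrite mulrCA ee mulr1.
(* Morally [g x] is [exp (x^2)] times the integral over [t >= x] of [2 t exp (- t^2) (Q x - Q t)];
   with [|Q x - Q t| <= M (t - x)] this gains the factor [1/x]. *)
have gM x : 1 <= x -> cabs (g x) <= M / 2 / x.
  move=> x1; have x0 : 0 < x by apply: lt_le_trans x1.
  have gE : g x = (expR (x ^+ 2))%:C * ((I x - L) + Q x * (e2 x)%:C).
    rewrite mulrDr -/(k x) mulrCA -rmorphM/= ee mulr1 //.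
  rewrite gE cabsM cabsC ger0_norm ?expR_ge0//.
  suff h : cabs (I x - L + Q x * (e2 x)%:C) <= M / 2 / x * e2 x.
    apply: le_trans (_ : expR (x ^+ 2) * (M / 2 / x * e2 x) <= _).
      by rewrite ler_wpM2l ?expR_ge0.
    by rewrite mulrCA ee mulr1.
  apply/ler_addgt0Pr => e e0.
  have [n Hn] := small_divSn (2 * B) e0.
  pose N := x + n%:R; have xN : x <= N by rewrite lerDl.
  have N1 : 1 <= N := le_trans x1 xN.
  pose F t := I t + Q x * (e2 t)%:C.
  pose dF t := dI t + Q x * (e2 t * (- (2 * t)))%:C.
  (* Integrating [2 t (t - x) exp (- t^2)] by parts leaves the Gaussian tail, majorized through
     [1 <= t / x] by an explicit antiderivative. The value of [- G] at [x] is
     [M exp (- x^2) / (2 x)], whence the constant [M / 2]. *)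
  pose G t := - (M * ((t - x) * e2 t + e2 t / (2 * x))).
  pose dG t := - (M * ((1 - 0) * e2 t + (t - x) * (e2 t * (- (2 * t))) +
     (e2 t * (- (2 * t))) / (2 * x))).
  have FG : cabs (F N - F x) <= G N - G x.
    apply: (cder_mean_value (df := dF) (dg := dG) xN) => t /andP[xt tN].
    - by apply: cderD => //; apply: cderMl; apply: cder_real; exact: rder_gauss.
    - have h1 := rderM (rderB (rder_id t) (rder_cst x t)) (rder_gauss t).
      have h2 := rderMl (2 * x)^-1 (rder_gauss t).
      have h3 := rderN (rderMl M (rderD h1 h2)).
      rewrite /G (_ : (fun t => _) = (fun t => - (M * ((t - x) * expR (- t ^+ 2) + (2 * x)^-1 * expR (- t ^+ 2))))).
        by apply: rder_eq h3 _; rewrite /dG /e2; congr (- (M * (_ + _))); rewrite mulrC.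
      by apply/funext => s; rewrite /e2 [_ / _]mulrC.
    - have t0 : 0 < t by apply: lt_le_trans xt.
      rewrite /dF /dI (_ : _ + _ = (2 * t * e2 t)%:C * (Q t - Q x)); last first.
        by rewrite mulrN rmorphN/= [e2 t * _]mulrC; ring.
      rewrite cabsM cabsC ger0_norm; last by rewrite !mulr_ge0// ltW.
      apply: le_trans (_ : 2 * t * e2 t * (M * (t - x)) <= _).
        rewrite ler_wpM2l//; first by rewrite !mulr_ge0// ltW.
        by apply: le_trans (QM _ _) _; rewrite ger0_norm// subr_ge0.
      have tx : 1 <= t / x by rewrite ler_pdivlMr// mul1r.
      rewrite -subr_ge0 /dG.
      rewrite [X in 0 <= X](_ : _ = M * e2 t * (t / x - 1)); last by field; rewrite gt_eqF.
      by rewrite !mulr_ge0// ?subr_ge0// ltW.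
  have GNx : G N - G x <= M / 2 / x * e2 x.
    have -> : G N - G x = M / 2 / x * e2 x - M * ((N - x) * e2 N + e2 N / (2 * x)).
      by rewrite /G subrr; field; rewrite gt_eqF.
    rewrite gerBl mulr_ge0// addr_ge0// ?mulr_ge0// ?subr_ge0// ?invr_ge0 ?mulr_ge0//; exact: ltW.
  have -> : I x - L + Q x * (e2 x)%:C = (F x - F N) + ((I N - L) + Q x * (e2 N)%:C).
    by rewrite /F; ring.
  apply: le_trans (cabsD _ _) _; apply: lerD.
    by rewrite cabsBC; exact: le_trans FG GNx.
  apply: le_trans (cabsD _ _) _.
  have b1 := HL N N1.
  have b2 : cabs (Q x * (e2 N)%:C) <= B * e2 N.
    by rewrite cabsM cabsC (ger0_norm (ltW (e2gt0 N))) ler_wpM2r// ltW.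
  apply: le_trans (lerD b1 b2) _.
  apply: le_trans (_ : 2 * B / n.+1%:R <= _); last exact: Hn.
  have -> : B * e2 N + B * e2 N = 2 * B * e2 N by ring.
  apply: ler_wpM2l; first by rewrite mulr_ge0.
  apply: le_trans (expRNsqr_le N1) _; rewrite div1r.
  by rewrite lef_pV2 ?posrE// ?(lt_le_trans _ N1)// -nat1r lerD2r.
have cI : ccont I by exact: (@cder_ccont _ I dI).
have cg : ccont g by apply: ccontD => //; exact: (cder_ccont kder).
pose H := oint g 1.
have Hder t : cder H t (g t) by exact: oint_cder.
(* Since [g = k' / (2 t)], integration by parts writes the integral of [g] as [k / (2 t)] plus the
   integral of [k / (2 t^2)], which converges absolutely because [|k| <= B]. The limit [L2] is then
   subtracted to make [h] tend to [0]. *)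
pose f t := H t - k t * ((2 * t)^-1)%:C.
pose df t := k t * ((2 * t ^+ 2)^-1)%:C.
have invder (t : R) : 1 <= t -> is_derive t 1 (fun s : R => (2 * s)^-1) (- (2 * t ^+ 2)^-1).
  move=> t1; have t0 : t != 0 by rewrite gt_eqF// (lt_le_trans _ t1).
  rewrite (_ : (fun s => _) = fun s => 2^-1 * s^-1).
    by apply: rder_eq (rderMl 2^-1 (rder_inv t0)) _; field.
  by apply/funext => s; rewrite invfM.
have [L2 HL2] : exists L : C, forall x, 1 <= x -> cabs (f x - L) <= B / 2 / x.
  apply: (@ctail_lim f df (fun t => B / 2 / t) (fun t => B / 2 * - (t ^- 2)) 1 (B / 2) (lexx 1)) => t t1.
  - have t0 : t != 0 by rewrite gt_eqF// (lt_le_trans _ t1).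
    apply: cder_eq (cderB (Hder t) (cderM (kder t) (cder_real (invder t t1)))) _.
    rewrite /df rmorphN/= (_ : (2 * t)%:C * g t * ((2 * t)^-1)%:C = (2 * t * (2 * t)^-1)%:C * g t).
      by rewrite divff ?mulf_neq0//; ring.
    by rewrite [in RHS]rmorphM/=; ring.
  - have t0 : t != 0 by rewrite gt_eqF// (lt_le_trans _ t1).
    exact: (rderMl (B / 2) (rder_inv t0)).
  - have t0 : 0 < t by rewrite (lt_le_trans _ t1).
    have i0 : 0 <= (2 * t ^+ 2)^-1 by rewrite invr_ge0 pmulr_rge0 ?sqr_ge0.
    rewrite /df cabsM cabsC (ger0_norm i0).
    apply: le_trans (_ : B * (2 * t ^+ 2)^-1 <= _).
      by rewrite ler_wpM2r ?kB.
    by apply: eqW_le; field; rewrite gt_eqF.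
  - apply/andP; split; last by [].
    by rewrite !mulr_ge0 ?invr_ge0// (le_trans _ t1).
exists g, (fun t => H t - L2); exists (M + B); first exact: addr_ge0.
move=> x x1; have x0 : 0 < x by rewrite (lt_le_trans _ x1).
have xi0 : 0 <= x^-1 by rewrite invr_ge0 ltW.
split.
- by apply: cder_eq (cderB (Hder x) (cder_cst L2 x)) _; rewrite subr0.
- by rewrite (_ : (fun t => _) = k)//; apply/funext => t; rewrite /g addrK.
- by apply: le_trans (gM x x1) _; apply: ler_wpM2r => //; lra.
- have -> : H x - L2 = (f x - L2) + k x * ((2 * x)^-1)%:C by rewrite /f; ring.
  apply: le_trans (cabsD _ _) _.
  have b2 : cabs (k x * ((2 * x)^-1)%:C) <= B / 2 / x.
    have i0 : 0 <= (2 * x)^-1 by rewrite invr_ge0 mulr_ge0// ltW.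
    rewrite cabsM cabsC (ger0_norm i0) invfM mulrA.
    by apply: ler_wpM2r => //; rewrite ler_wpM2r ?kB// invr_ge0.
  apply: le_trans (lerD (HL2 x x1) b2) _.
  by rewrite -mulrDl; apply: ler_wpM2r => //; lra.
Qed.

End WKB.

(** * A priori estimates for the system satisfied by [u = y / z] and [p = u'] *)

Section Volterra.
Context {R : realType}.
Local Notation C := (Cplx R).
Implicit Types (Q b z rho f u p : R -> C) (l : C) (x : R).

Lemma rderVX n x : x != 0 ->
  is_derive x 1 (fun t : R => (t ^+ n.+1)^-1) (- (n.+1%:R * (x ^+ n.+2)^-1)).
Proof.
move=> x0; have x1 := expf_neq0 n.+1 x0.
have h := @is_deriveV R (fun t => t ^+ n.+1) x _ 1 x1 (rderX n x).
by apply: rder_eq h _; rewrite /GRing.scale/= !exprS; field; rewrite x0 expf_neq0.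
Qed.

(* The system for [u = y / z], [p = u'] when [y'' = V y], [z'' = (V + rho) z], [b = z' / z]. *)
Definition wkb_sys b rho f X u p : Prop := forall x, X <= x ->
  cder u x (p x) /\ cder p x (- (2 * b x * p x) - rho x * u x + f x).

(** [2 Re b <= - x] says that [|z|^2] decreases at relative rate at least [x]. The condition
    [c <= X^2] is the smallness that lets the contribution of [rho u] be absorbed on [[X, +oo[]. *)
Definition wkb_data b z rho (X c : R) : Prop :=
  [/\ 1 <= X, 0 <= c, c <= X ^+ 2 & forall x, X <= x ->
    [/\ cder z x (b x * z x), z x != 0, 2 * cRe (b x) <= - x &
        cabs (rho x) <= c / x ^+ 2]].

Lemma wkb_sysB b rho f1 f2 X u1 p1 u2 p2 : wkb_sys b rho f1 X u1 p1 ->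
  wkb_sys b rho f2 X u2 p2 ->
  wkb_sys b rho (fun x => f1 x - f2 x) X (fun x => u1 x - u2 x) (fun x => p1 x - p2 x).
Proof.
move=> H1 H2 x Xx; have [a1 b1] := H1 x Xx; have [a2 b2] := H2 x Xx.
by split; [exact: cderB|apply: cder_eq (cderB b1 b2) _; ring].
Qed.

Lemma wkb_sysZ b rho f X (k : C) u p : wkb_sys b rho f X u p ->
  wkb_sys b rho (fun x => k * f x) X (fun x => k * u x) (fun x => k * p x).
Proof.
move=> H x Xx; have [a1 b1] := H x Xx.
by split; [exact: cderMl|apply: cder_eq (cderMl k b1) _; ring].
Qed.

Lemma wkb_sys_ext b rho f1 f2 X u p : (forall x, f1 x = f2 x) ->
  wkb_sys b rho f1 X u p -> wkb_sys b rho f2 X u p.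
Proof. by move=> /funext <-. Qed.

(* [(z^2 p)' = z^2 (f - rho u)] is compared with the derivative of [- K |z|^2 x^-3], which
   dominates it because [|z|^2' <= - x |z|^2]. *)
Lemma wkb_apriori_finite b z rho X c f u p (N ep e : R) : wkb_data b z rho X c ->
  X <= N -> wkb_sys b rho f X u p -> 0 <= ep -> 0 <= e ->
  (forall x, X <= x <= N -> cabs (f x) <= ep / x ^+ 2) ->
  cabs (u N) <= e -> N * cabs (p N) <= e ->
  forall x, X <= x <= N ->
    [/\ cabs (u x) <= 4 * e + ep,
        cabs (p x) <= (c * (4 * e + ep) + ep) / x ^+ 3 + e &
        cabs (u x) <= 2 * e + (c * (4 * e + ep) + ep) / x ^+ 2].
Proof.
move=> [X1 c0 cX HD] XN Hs ep0 e0 fep uN pN.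
pose m t := cdot (z t) (z t); pose dm t := 2 * cRe (b t) * m t.
have mder t : X <= t -> is_derive t 1 m (dm t).
  move=> Xt; have [zt _ _ _] := HD t Xt.
  by apply: rder_eq (rder_cdot zt zt) _; rewrite /dm /m /cdot !cReIm; ring.
have m0 t : X <= t -> 0 < m t.
  by move=> Xt; have [_ z0 _ _] := HD t Xt; rewrite /m cdotxx exprn_gt0// cabs_gt0.
have pos t : X <= t -> 0 < t by move=> Xt; rewrite (lt_le_trans _ Xt)// (lt_le_trans _ X1).
have mN t : X <= t -> t <= N -> m N <= m t.
  move=> Xt tN; rewrite -lerN2.
  apply: (@is_derive_nondecr _ (fun s => - m s) (fun s => - dm s) _ _ tN) => s /andP[ts sN].
    exact/rderN/mder/(le_trans Xt).
  have Xs := le_trans Xt ts; have [_ _ bs _] := HD s Xs.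
  rewrite /dm -mulNr mulr_ge0 ?(ltW (m0 _ Xs))//; have := pos s Xs; lra.
(* The maximum [S] of [|u|] on the compact interval is an unknown finite quantity; everything is
   bounded in terms of it first, and [S] is solved for at the end. *)
have [xm /[!in_itv]/= xmI Sm] : exists2 xm, xm \in `[X, N] &
    forall x, X <= x <= N -> cabs (u x) <= cabs (u xm).
  have cu : ({within `[X, N], continuous (fun x => cdot (u x) (u x))})%classic.
    apply: continuous_in_subspaceT => x; rewrite inE/= in_itv/= => /andP[Xx _].
    by have [ux _] := Hs x Xx; exact: rder_continuous (rder_cdot ux ux).
  have [xm xmI H] := EVT_max XN cu; exists xm => // x xI.
  by rewrite -(ler_pXn2r (n := 2))// ?nnegrE ?cabs_ge0// -!cdotxx H// in_itv.
set S := cabs (u xm) in Sm; have S0 : 0 <= S := cabs_ge0 _.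
pose K := c * S + ep; have K0 : 0 <= K by rewrite addr_ge0// mulr_ge0.
have pbd x : X <= x <= N -> cabs (p x) <= K / x ^+ 3 + cabs (p N).
  move=> /andP[Xx xN].
  pose F t := z t * z t * p t; pose dF t := z t * z t * (f t - rho t * u t).
  pose G t := - (K * (m t * (t ^+ 3)^-1)).
  pose dG t := - (K * (dm t * (t ^+ 3)^-1 + m t * - (3%:R * (t ^+ 4)^-1))).
  have FG : cabs (F N - F x) <= G N - G x.
    apply: (@cder_mean_value _ F dF G dG _ _ xN) => t /andP[xt tN].
    - have [zt _ _ _] := HD t (le_trans Xx xt); have [_ pt] := Hs t (le_trans Xx xt).
      by apply: cder_eq (cderM (cderM zt zt) pt) _; rewrite /dF; ring.
    - have t0 : t != 0 by rewrite gt_eqF// pos// (le_trans Xx).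
      exact: rderN (rderMl K (rderM (mder t (le_trans Xx xt)) (rderVX 2 t0))).
    - have Xt := le_trans Xx xt; have [_ _ bt rt] := HD t Xt; have t0 := pos t Xt.
      have tI : X <= t <= N by rewrite Xt tN.
      rewrite /dF cabsM cabsM -expr2 -cdotxx -/(m t).
      have h1 : cabs (f t - rho t * u t) <= K / t ^+ 2.
        apply: le_trans (cabsB _ _) _; rewrite cabsM /K mulrDl addrC; apply: lerD; last exact: fep.
        rewrite -mulrA (mulrC S) mulrA.
        by apply: ler_pM => //; [exact: cabs_ge0|exact: cabs_ge0|exact: Sm].
      apply: le_trans (_ : m t * (K / t ^+ 2) <= _).
        by rewrite ler_wpM2l// ltW// m0.
      have -> : dG t = K * m t * (t ^+ 3)^-1 * (- (2 * cRe (b t)) + 3 / t).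
        by rewrite /dG /dm; field; rewrite gt_eqF.
      have -> : m t * (K / t ^+ 2) = K * m t * (t ^+ 3)^-1 * t by field; rewrite gt_eqF.
      apply: ler_wpM2l; first by rewrite !mulr_ge0 ?invr_ge0 ?exprn_ge0 ?(ltW t0)// ltW// m0.
      have : 0 <= 3 / t by rewrite divr_ge0// ltW.
      lra.
  have mx := m0 x Xx; rewrite -(ler_pM2l mx).
  have FE t : cabs (F t) = m t * cabs (p t) by rewrite /F cabsM cabsM -expr2 -cdotxx.
  rewrite -FE; have h2 : cabs (F x) <= cabs (F N) + (G N - G x).
    by have := cabs_triB (F x) (F N); rewrite cabsBC; lra.
  apply: le_trans h2 _; rewrite FE /G mulrDr.
  have h3 : m N * cabs (p N) <= m x * cabs (p N) by rewrite ler_wpM2r ?cabs_ge0// mN.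
  have h4 : 0 <= K * (m N * (N ^+ 3)^-1).
    have mN0 := ltW (m0 N XN); have N0 := ltW (pos N XN).
    by rewrite !mulr_ge0 ?invr_ge0 ?exprn_ge0.
  rewrite [X in _ <= X + _](_ : _ = K * (m x * (x ^+ 3)^-1)); last by ring.
  lra.
(* Integrating the bound on [p]: [K / t^3] contributes [K / (2 x^2)], and the constant [|p N|] at
   most [N |p N| <= e]; with [|u N| <= e] this makes [2 e]. *)
have ubd x : X <= x <= N -> cabs (u x) <= 2 * e + K / 2 / x ^+ 2.
  move=> /andP[Xx xN].
  pose G t := - (K / 2 * (t ^+ 2)^-1) + cabs (p N) * t.
  pose dG t := - (K / 2 * - (2%:R * (t ^+ 3)^-1)) + cabs (p N) * 1.
  have uG : cabs (u N - u x) <= G N - G x.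
    apply: (@cder_mean_value _ u p G dG _ _ xN) => t /andP[xt tN].
    - by have [] := Hs t (le_trans Xx xt).
    - have t0 : t != 0 by rewrite gt_eqF// pos// (le_trans Xx).
      exact: rderD (rderN (rderMl (K / 2) (rderVX 1 t0))) (rderMl (cabs (p N)) (rder_id t)).
    - have Xt := le_trans Xx xt; apply: le_trans (pbd t _) _; first by rewrite Xt.
      by rewrite /dG mulr1 lerD2r; apply: eqW_le; field; rewrite gt_eqF// pos.
  have h2 : cabs (u x) <= cabs (u N) + (G N - G x).
    by have := cabs_triB (u x) (u N); rewrite cabsBC; lra.
  have h3 : 0 <= K / 2 * (N ^+ 2)^-1 by rewrite mulr_ge0 ?divr_ge0 ?invr_ge0 ?sqr_ge0.
  have h4 : 0 <= cabs (p N) * x by rewrite mulr_ge0 ?cabs_ge0// ltW// pos.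
  move: h2; rewrite /G; have := pN; rewrite (mulrC N); lra.
(* At the maximum point [c <= xm^2] and [1 <= xm^2], so the previous bound reads
   [S <= 2 e + S / 2 + ep / 2]. *)
have Sbd : S <= 4 * e + ep.
  have /andP[Xm _] := xmI; have xm0 := pos _ Xm.
  have h := ubd xm xmI; rewrite -/S in h.
  suff : K / 2 / xm ^+ 2 <= S / 2 + ep / 2 by lra.
  have x2 : 0 < xm ^+ 2 by rewrite exprn_gt0.
  have cx : c <= xm ^+ 2 by apply: le_trans cX _; rewrite ler_pXn2r ?nnegrE// ltW// pos.
  have x1 : 1 <= xm ^+ 2 by rewrite exprn_ege1// (le_trans X1).
  rewrite ler_pdivrMr// /K.
  have k1 : c * S <= xm ^+ 2 * S by rewrite ler_wpM2r.
  have k2 : 1 * ep <= xm ^+ 2 * ep by rewrite ler_wpM2r.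
  lra.
have Kbd : K <= c * (4 * e + ep) + ep by rewrite lerD2r ler_wpM2l.
have pNe : cabs (p N) <= e.
  apply: le_trans pN; rewrite ler_peMl ?cabs_ge0//; exact: le_trans X1 XN.
move=> x xI; have /andP[Xx _] := xI; have x0 := pos x Xx; split.
- exact: le_trans (Sm x xI) Sbd.
- apply: le_trans (pbd x xI) _; apply: lerD => //.
  by rewrite ler_wpM2r ?invr_ge0 ?exprn_ge0// ltW.
- apply: le_trans (ubd x xI) _; rewrite lerD2l ler_wpM2r ?invr_ge0 ?sqr_ge0//.
  by apply: le_trans Kbd; rewrite ler_pdivrMr// ler_peMr// ler1n.
Qed.

(** The weight [N] on [p N] pays for integrating this constant over an interval of length up to
    [N]. *)
Definition vanishing u p := forall e : R, 0 < e -> exists N0 : R, forall N, N0 <= N ->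
  cabs (u N) <= e /\ N * cabs (p N) <= e.

Lemma wkb_apriori b z rho X c f u p (ep : R) : wkb_data b z rho X c ->
  wkb_sys b rho f X u p -> 0 <= ep ->
  (forall x, X <= x -> cabs (f x) <= ep / x ^+ 2) -> vanishing u p ->
  forall x, X <= x -> [/\ cabs (u x) <= ep, cabs (p x) <= (c + 1) * ep / x ^+ 3 &
     cabs (u x) <= (c + 1) * ep / x ^+ 2].
Proof.
move=> D Hs ep0 fep van x Xx; have [X1 c0 _ _] := D.
have x1 : 1 <= x := le_trans X1 Xx.
have key e : 0 < e -> [/\ cabs (u x) <= ep + e, cabs (p x) <= (c + 1) * ep / x ^+ 3 + e &
     cabs (u x) <= (c + 1) * ep / x ^+ 2 + e].
  (* With boundary error [d], the three finite estimates exceed their limits by at most [4 d],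
     [4 c d + d] and [2 d + 4 c d], all below [(4 c + 5) d = e]. *)
  move=> e0; pose d := e / (4 * c + 5).
  have c5 : 0 < 4 * c + 5 by lra.
  have d0 : 0 < d by rewrite divr_gt0.
  have de : d * (4 * c + 5) = e by rewrite divfK// gt_eqF.
  have [N0 HN0] := van d d0; pose N := Num.max N0 x.
  have N0N : N0 <= N by rewrite le_max lexx.
  have [uN pN] := HN0 N N0N.
  have xN : x <= N by rewrite le_max lexx orbT.
  have [||h1 h2 h3] := wkb_apriori_finite D (le_trans Xx xN) Hs ep0 (ltW d0) _ uN pN (x := x).
  - by move=> t /andP[Xt _]; exact: fep.
  - by rewrite Xx.
  have cd : 0 <= c * d by rewrite mulr_ge0// ltW.
  have inv_le n : (c * (4 * d + ep) + ep) / x ^+ n.+1 <= (c + 1) * ep / x ^+ n.+1 + 4 * (c * d).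
    rewrite (_ : c * (4 * d + ep) + ep = (c + 1) * ep + 4 * (c * d)); last by ring.
    have xn1 : 1 <= x ^+ n.+1 by exact: exprn_ege1.
    rewrite mulrDl lerD2l ler_pdivrMr ?(lt_le_trans _ xn1)//.
    by apply: ler_peMr => //; lra.
  have i2 := inv_le 1%N; have i3 := inv_le 2%N.
  split; [lra|apply: le_trans h2 _|apply: le_trans h3 _]; lra.
by split; apply/ler_addgt0Pr => e e0; have [] := key e e0.
Qed.

End Volterra.

(** * The approximate solution [z] and decaying solutions *)

Section Decaying.
Context {R : realType}.
Local Notation C := (Cplx R).
Implicit Types (Q g h y dy F : R -> C) (l : C) (x : R).

(** The energy involves [dy - Q y]; replacing it by [dy] costs a factor [1 + B] at each of the two
    points. [G + 1] stands for the square root of [G]. *)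
Lemma gronwall_norm (B r a b : R) : 0 <= B -> 0 <= r -> a <= b ->
  exists2 G : R, 0 < G & forall Q l F y dy (f : R),
    (forall t, cabs (Q t) <= B) -> cabs l <= r -> csol Q l F y dy -> 0 <= f ->
    (forall t, a <= t <= b -> cabs (F t) <= f) ->
    forall x x0, a <= x <= b -> a <= x0 <= b ->
      cabs (y x) <= G * (cabs (y x0) + cabs (dy x0) + f) /\
      cabs (dy x) <= G * (cabs (y x0) + cabs (dy x0) + f).
Proof.
move=> B0 r0 ab; have [G G0 HG] := gronwall B0 r0 ab.
pose H := (G + 1) * (1 + B).
have H0 : 0 < H by rewrite mulr_gt0//; lra.
exists (H * (1 + B)); first by rewrite mulr_gt0//; lra.
move=> Q l F y dy f QB lr Hs f0 Ff x x0 xI x0I.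
have E := HG Q l F y dy f QB lr Hs f0 Ff x x0 xI x0I.
set s := cabs (y x0) + cabs (dy x0) + f.
have Y0 := cabs_ge0 (y x0); have D0 := cabs_ge0 (dy x0).
have s0 : 0 <= s by rewrite /s; lra.
have w_le t : cabs (dy t - Q t * y t) <= cabs (dy t) + B * cabs (y t).
  apply: le_trans (cabsB _ _) _; rewrite lerD2l cabsM ler_wpM2r ?cabs_ge0//.
have E0 : energy Q y dy x0 + f ^+ 2 <= ((1 + B) * s) ^+ 2.
  rewrite /energy !cdotxx.
  have h1 : cabs (dy x0 - Q x0 * y x0) ^+ 2 <= (cabs (dy x0) + B * cabs (y x0)) ^+ 2.
    by rewrite ler_pXn2r ?nnegrE ?cabs_ge0// addr_ge0// mulr_ge0.
  apply: le_trans (_ : cabs (y x0) ^+ 2 + (cabs (dy x0) + B * cabs (y x0)) ^+ 2 + f ^+ 2 <= _).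
    by rewrite lerD2r lerD2l.
  apply: le_trans (_ : (cabs (y x0) + (cabs (dy x0) + B * cabs (y x0)) + f) ^+ 2 <= _).
    have : 0 <= cabs (dy x0) + B * cabs (y x0) by rewrite addr_ge0// mulr_ge0.
    by set w := cabs (dy x0) + _; nra.
  have BY : 0 <= B * cabs (y x0) by rewrite mulr_ge0.
  apply: lerXn2r; rewrite ?nnegrE; [by lra|by rewrite mulr_ge0//; lra|].
  have : 0 <= B * cabs (dy x0) by rewrite mulr_ge0.
  have : 0 <= B * f by rewrite mulr_ge0.
  rewrite /s; lra.
have Ex : energy Q y dy x <= (H * s) ^+ 2.
  apply: le_trans E _; apply: le_trans (_ : G * ((1 + B) * s) ^+ 2 <= _).
    by rewrite ler_wpM2l// ltW.
  rewrite /H -mulrA [leRHS]exprMn ler_wpM2r ?sqr_ge0//; nra.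
have Hs0 : 0 <= H * s by rewrite mulr_ge0// ltW.
have yx : cabs (y x) <= H * s.
  rewrite -(ler_pXn2r (n := 2))// ?nnegrE ?cabs_ge0//; apply: le_trans Ex.
  by rewrite /energy !cdotxx lerDl sqr_ge0.
have wx : cabs (dy x - Q x * y x) <= H * s.
  rewrite -(ler_pXn2r (n := 2))// ?nnegrE ?cabs_ge0//; apply: le_trans Ex.
  by rewrite /energy !cdotxx lerDr sqr_ge0.
have BHs : 0 <= B * (H * s) by rewrite mulr_ge0.
have -> : H * (1 + B) * s = H * s + B * (H * s) by ring.
split; first lra.
rewrite (_ : dy x = (dy x - Q x * y x) + Q x * y x); last by rewrite subrK.
apply: le_trans (cabsD _ _) _; apply: lerD => //; rewrite cabsM.
by apply: ler_pM; rewrite ?cabs_ge0.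
Qed.

Lemma cabs_nat n : cabs (n%:R : C) = n%:R.
Proof. by rewrite -(rmorph_nat (real_complex R)) /= cabsC normr_nat. Qed.

Definition wkb_corr Q g h (K : R) : Prop := 0 <= K /\ forall x, 1 <= x ->
  [/\ cder h x (g x), cder (fun t => g t - Q t) x ((2 * x)%:C * g x),
      cabs (g x) <= K / x & cabs (h x) <= K / x].

(** In the notation of the overview, [wz], [wb], [wr], [wu] and [wp] are [z], [z' / z], [rho],
    [y / z] and [(y / z)'], with [g = h']. [wr] is what remains of [wb' + wb^2] after removing
    [x^2 - l] and [g' - 2 x g], which stands for [q]. *)
Definition wz h l x : C := pref_p l x * cexp (h x).
Definition wb g l x : C := (l - 1) / 2 * (x^-1)%:C - x%:C + g x.
Definition wr g l x : C := (((l - 1) / 2) ^+ 2 - (l - 1) / 2) * (x^-1)%:C ^+ 2 + g x ^+ 2 +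
  2 * ((l - 1) / 2) * g x * (x^-1)%:C.
Definition wu h l y x : C := y x * (wz h l x)^-1.
Definition wp g h l y dy x : C := dy x * (wz h l x)^-1 - wb g l x * wu h l y x.

(** The exponent of [z]. Written as an exponential, [z] vanishes nowhere, not even where [ln] takes
    its default value, and [1 / z] is differentiated like [z]. *)
Definition wphase h l x : C := (l - 1) / 2 * (ln (Num.sqrt 2 * x))%:C + (- (x ^+ 2) / 2)%:C + h x.

Lemma wzE h l x : wz h l x = cexp (wphase h l x).
Proof. by rewrite /wz /pref_p /cpowR -cexpC -!cexpD. Qed.

Lemma wz_neq0 h l x : wz h l x != 0.
Proof. by rewrite wzE cexp_neq0. Qed.

Lemma wzVE h l x : (wz h l x)^-1 = cexp (- wphase h l x).
Proof. by rewrite wzE cexpN. Qed.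

Lemma wuK h l y x : y x = wz h l x * wu h l y x.
Proof. by rewrite /wu mulrCA mulfV ?mulr1 ?wz_neq0. Qed.

Lemma wpK g h l y dy x : dy x = wz h l x * (wp g h l y dy x + wb g l x * wu h l y x).
Proof. by rewrite /wp subrK mulrCA mulfV ?mulr1 ?wz_neq0. Qed.

Lemma cder_wphase Q g h K l x : wkb_corr Q g h K -> 1 <= x ->
  cder (wphase h l) x (wb g l x).
Proof.
move=> [K0 H] x1; have x0 : 0 < x by rewrite (lt_le_trans _ x1).
have [hx _ _ _] := H x x1.
have s2 : 0 < Num.sqrt 2 :> R by rewrite sqrtr_gt0.
have h1 : is_derive x 1 (fun t : R => ln (Num.sqrt 2 * t)) x^-1.
  have e := is_derive1_comp (rder_ln (mulr_gt0 s2 x0)) (rderMl (Num.sqrt 2) (rder_id x)).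
  by apply: rder_eq e _; field; rewrite !gt_eqF.
have h2 : is_derive x 1 (fun t : R => - (t ^+ 2) / 2) (- x).
  rewrite (_ : (fun t => _) = fun t : R => - 2^-1 * t ^+ 2).
    by apply: rder_eq (rderMl (- 2^-1) (rderX 1 x)) _; field.
  by apply/funext => t; field.
apply: cder_eq (cderD (cderD (cderMl ((l - 1) / 2) (cder_real h1)) (cder_real h2)) hx) _.
by rewrite /wb rmorphN.
Qed.

Lemma cder_wz Q g h K l x : wkb_corr Q g h K -> 1 <= x ->
  cder (wz h l) x (wb g l x * wz h l x).
Proof.
move=> W x1; rewrite (_ : wz h l = fun t => cexp (wphase h l t)).
  exact: cder_cexp (cder_wphase l W x1).
by apply/funext => t; exact: wzE.
Qed.

Lemma cder_wzV Q g h K l x : wkb_corr Q g h K -> 1 <= x ->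
  cder (fun t => (wz h l t)^-1) x (- wb g l x * (wz h l x)^-1).
Proof.
move=> W x1; rewrite wzVE (_ : (fun t => _) = fun t => cexp (- wphase h l t)).
  exact: cder_cexp (cderN (cder_wphase l W x1)).
by apply/funext => t; exact: wzVE.
Qed.

(** Neither [dy] nor [wb] need be differentiable, but [dy - Q y] and [wb - Q] are. In
    [p = dy / z - wb u] the two occurrences of [Q y / z = Q u] cancel, so [p] can be differentiated
    through them. *)
Lemma wkb_sys_of_csol Q g h K l y dy : wkb_corr Q g h K -> csol Q l (fun=> 0) y dy ->
  wkb_sys (wb g l) (wr g l) (fun=> 0) 1 (wu h l y) (wp g h l y dy).
Proof.
move=> W H x x1; have [yx wx] := H x; have zV := cder_wzV l W x1.
have x0 : 0 < x by rewrite (lt_le_trans _ x1).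
have ux : cder (wu h l y) x (wp g h l y dy x).
  by apply: cder_eq (cderM yx zV) _; rewrite /wp /wu; ring.
split=> //.
have [_ W2] := W; have [_ gQ _ _] := W2 x x1.
have x0' : x != 0 by rewrite gt_eqF.
have bQ : cder (fun t => wb g l t - Q t) x
    ((l - 1) / 2 * (- (x^-1)%:C ^+ 2) - 1 + (2 * x)%:C * g x).
  rewrite (_ : (fun t => _) = fun t => ((l - 1) / 2 * (t^-1)%:C - t%:C) + (g t - Q t)).
    apply: cder_eq (cderD (cderB (cderMl ((l - 1) / 2) (cder_real (rder_inv x0')))
      (cder_real (rder_id x))) gQ) _.
    by rewrite rmorphN/= -rmorphXn/= exprVn.
  by apply/funext => t; rewrite /wb; ring.
rewrite (_ : wp g h l y dy = fun t => (dy t - Q t * y t) * (wz h l t)^-1 -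
    (wb g l t - Q t) * wu h l y t); last first.
  by apply/funext => t; rewrite /wp /wu; ring.
apply: cder_eq (cderB (cderM wx zV) (cderM bQ ux)) _.
have xxi : x%:C * (x^-1)%:C = 1 :> C by rewrite -rmorphM/= mulfV.
have lE : l = 2 * ((l - 1) / 2) + 1 by field.
rewrite /wp /wu /wr rmorphXn rmorphM /= {1}lE /wb.
set a := (l - 1) / 2; set xi := (x^-1)%:C; set X := x%:C; set zi := (wz h l x)^-1.
rewrite (_ : 2%:C = 2 :> C); last by rewrite rmorph_nat.
apply/eqP; rewrite -subr_eq0; apply/eqP.
(* The two sides agree only modulo [x * x^-1 = 1], which is isolated here as a factor. *)
rewrite [LHS](_ : _ = 2 * a * (X * xi - 1) * (y x * zi)); last by ring.
by rewrite xxi subrr mulr0 mul0r.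
Qed.

Lemma wr_bound Q g h K r l x : wkb_corr Q g h K -> 1 <= x -> cabs l <= r ->
  cabs (wr g l x) <= ((r + 1 + K) ^+ 2 + (r + 1)) / x ^+ 2.
Proof.
move=> [K0 W] x1 lr; have [_ _ gx _] := W x x1.
have x0 : 0 < x by rewrite (lt_le_trans _ x1).
have r0 : 0 <= r := le_trans (cabs_ge0 l) lr.
set a := (l - 1) / 2.
have a_le : cabs a <= r + 1.
  rewrite /a cabsM cabsV (cabs_nat 2).
  rewrite ler_pdivrMr//; apply: le_trans (cabsB _ _) _; rewrite cabs1; lra.
have xi : cabs (x^-1)%:C = x^-1 by rewrite cabsC ger0_norm// invr_ge0 ltW.
have xi0 : 0 <= x^-1 by rewrite invr_ge0 ltW.
have A0 := cabs_ge0 a; have G0 := cabs_ge0 (g x).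
rewrite /wr -/a; apply: le_trans (cabsD _ _) _.
apply: le_trans (lerD (cabsD _ _) (lexx _)) _.
have e1 : cabs ((a ^+ 2 - a) * (x^-1)%:C ^+ 2) = cabs (a ^+ 2 - a) * x^-1 ^+ 2.
  by rewrite cabsM cabsX xi.
have e3 : cabs (2 * a * g x * (x^-1)%:C) = 2 * cabs a * cabs (g x) * x^-1.
  by rewrite !cabsM xi (cabs_nat 2).
rewrite e1 cabsX e3.
have b1 : cabs (a ^+ 2 - a) * x^-1 ^+ 2 <= ((r + 1) ^+ 2 + (r + 1)) * x^-1 ^+ 2.
  rewrite ler_wpM2r ?exprn_ge0//; apply: le_trans (cabsB _ _) _; rewrite cabsX.
  by apply: lerD => //; rewrite ler_pXn2r ?nnegrE//; lra.
have b2 : cabs (g x) ^+ 2 <= (K / x) ^+ 2.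
  by rewrite ler_pXn2r ?nnegrE// mulr_ge0.
have b3 : 2 * cabs a * cabs (g x) * x^-1 <= 2 * (r + 1) * (K / x) * x^-1.
  by rewrite ler_wpM2r//; apply: ler_pM => //; rewrite ?mulr_ge0// ler_wpM2l.
apply: le_trans (lerD (lerD b1 b2) b3) _.
by rewrite exprMn exprVn; apply: eqW_le; field; rewrite gt_eqF.
Qed.

Lemma wkb_data_ex Q g h K (r : R) : wkb_corr Q g h K -> 0 <= r ->
  exists X c : R, forall l, cabs l <= r -> wkb_data (wb g l) (wz h l) (wr g l) X c.
Proof.
move=> W r0; have [K0 W2] := W.
pose c := (r + 1 + K) ^+ 2 + (r + 1).
have c0 : 0 <= c by rewrite addr_ge0 ?sqr_ge0//; lra.
(* For [x >= X >= 1] one has [x^2 >= x >= X]; this gives both [c <= X^2] and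
   [2 (r + 1 + K) / x <= x], and the latter turns [2 Re wb], which is [- 2 x] up to that error, into
   at most [- x]. *)
pose X := 1 + c + 2 * (r + 1 + K).
have X1 : 1 <= X by rewrite /X; clearbody c; lra.
have XX x : X <= x -> 1 + c + 2 * (r + 1 + K) <= x ^+ 2.
  move=> Xx; apply: le_trans (_ : x <= _); first exact: Xx.
  by rewrite expr2 ler_peMr// ?(le_trans _ Xx)// (le_trans _ X1).
exists X, c => l lr; split => //.
  by apply: le_trans (XX X (lexx X)); clearbody c; lra.
move=> x Xx; have x1 : 1 <= x := le_trans X1 Xx.
have x0 : 0 < x by rewrite (lt_le_trans _ x1).
split; [exact: cder_wz W x1|exact: wz_neq0| |exact: wr_bound W x1 lr].
have [_ _ gx _] := W2 x x1.
have xi0 : 0 <= x^-1 by rewrite invr_ge0 ltW.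
have a_le : cabs ((l - 1) / 2 * (x^-1)%:C) <= (r + 1) / x.
  rewrite cabsM cabsC ger0_norm// ler_wpM2r//.
  rewrite cabsM cabsV (cabs_nat 2).
  rewrite ler_pdivrMr//; apply: le_trans (cabsB _ _) _; rewrite cabs1; lra.
have h1 := le_trans (ler_norm _) (le_trans (ler_cRe _) a_le).
have h2 := le_trans (ler_norm _) (le_trans (ler_cRe _) gx).
rewrite /wb cReD cReD cReN cReC.
suff : 2 * ((r + 1) / x + K / x) <= x by lra.
rewrite -mulrDl mulrA ler_pdivrMr// -expr2.
by have := XX x Xx; clearbody c; lra.
Qed.

(** [X] and [D] may depend on [l] here; uniform values are recovered afterwards from the a priori
    estimate. *)
Definition decaying Q g h l y dy : Prop := csol Q l (fun=> 0) y dy /\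
  exists X D : R, forall x, X <= x ->
    cabs (wu h l y x - 1) <= D / x ^+ 2 /\ cabs (wp g h l y dy x) <= D / x ^+ 3.

Lemma vanishing_power (u p : R -> C) (X D : R) : (forall x, X <= x ->
    cabs (u x) <= D / x ^+ 2 /\ cabs (p x) <= D / x ^+ 3) -> vanishing u p.
Proof.
move=> H e e0; exists (Num.max X (1 + `|D| / e)) => N; rewrite ge_max => /andP[XN DN].
have [uN pN] := H N XN.
have De0 : 0 <= `|D| / e by rewrite divr_ge0// ltW.
have N1 : 1 <= N by apply: le_trans DN; rewrite lerDl.
have N0 : 0 < N by rewrite (lt_le_trans _ N1).
have De : `|D| <= e * N ^+ 2.
  rewrite mulrC -ler_pdivrMr//; apply: le_trans (_ : N <= _); first by lra.
  by rewrite expr2 ler_peMr// ltW.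
have De2 : D / N ^+ 2 <= e.
  by rewrite ler_pdivrMr ?exprn_gt0// (le_trans (ler_norm _)).
split; first exact: le_trans De2.
apply: le_trans (_ : N * (D / N ^+ 3) <= _); first by rewrite ler_wpM2l// ltW.
by apply: le_trans De2; apply: eqW_le; field; rewrite gt_eqF.
Qed.

(** Subtracting the limit [1] of [u] turns [- rho] into a source of size [c / x^2], the case
    [ep = c] of the estimates. *)
Lemma wkb_sys_sub1 b rho X (u p : R -> C) : wkb_sys b rho (fun=> 0) X u p ->
  wkb_sys b rho (fun x => - rho x) X (fun x => u x - 1) p.
Proof.
move=> H x Xx; have [h1 h2] := H x Xx; split.
  by apply: cder_eq (cderB h1 (cder_cst 1 x)) _; rewrite subr0.
by apply: cder_eq h2 _; ring.
Qed.

Lemma wkb_sys_le b rho f X X' (u p : R -> C) : X <= X' -> wkb_sys b rho f X u p ->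
  wkb_sys b rho f X' u p.
Proof. by move=> XX H x Xx; apply: H; exact: le_trans Xx. Qed.

(** The bounds attached to an individual solution serve only to see that [u - 1] and [p] vanish at
    infinity; the a priori estimate then returns constants depending on [r] alone. *)
Lemma decaying_uniform Q g h K (r : R) : wkb_corr Q g h K -> 0 <= r ->
  exists X D : R, [/\ 1 <= X, 0 <= D & forall l y dy, cabs l <= r -> decaying Q g h l y dy ->
    forall x, X <= x ->
    cabs (wu h l y x - 1) <= D / x ^+ 2 /\ cabs (wp g h l y dy x) <= D / x ^+ 3].
Proof.
move=> W r0; have [X [c HD]] := wkb_data_ex W r0.
have [X1 c0 _ _] : wkb_data (wb g 0) (wz h 0) (wr g 0) X c by apply: HD; rewrite cabs0.
exists X, ((c + 1) * c); split => //; first by rewrite mulr_ge0//; lra.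
move=> l y dy lr [Hs [X' [D HX]]] x Xx.
have D1 := HD l lr; have [_ _ _ D2] := D1.
have S1 := wkb_sys_le X1 (wkb_sys_sub1 (wkb_sys_of_csol W Hs)).
have [||_ h2 h3] := wkb_apriori D1 S1 c0 _ _ Xx; [|exact: vanishing_power HX|by []].
by move=> t Xt; rewrite cabsN; have [] := D2 t Xt.
Qed.

End Decaying.

(** * Existence of the decaying solution *)

Section Existence.
Context {R : realType}.
Local Notation C := (Cplx R).
Implicit Types (Q g h y dy F : R -> C) (l : C) (x : R).

(* The decaying solution is the limit of the solutions [y n] with the data of [z] at [X + n],
   which form a Cauchy sequence at [X] by the a priori estimate. *)
Lemma decaying_exists Q g h (K B : R) l : wkb_corr Q g h K -> ccont Q ->
  (forall t, cabs (Q t) <= B) -> exists y dy, decaying Q g h l y dy.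
Proof.
move=> W cQ QB; have B0 : 0 <= B by exact: le_trans (cabs_ge0 _) (QB 0).
have [X [c HD]] := wkb_data_ex W (cabs_ge0 l).
have D1 := HD l (lexx _); have [X1 c0 _ D2] := D1.
pose N (n : nat) : R := X + n%:R.
have XN n : X <= N n by rewrite lerDl.
have N1 n : 1 <= N n := le_trans X1 (XN n).
have N0 n : 0 < N n := lt_le_trans ltr01 (N1 n).
have NS n : n.+1%:R <= N n ^+ 2.
  apply: le_trans (_ : N n <= _); first by rewrite -nat1r lerD2r.
  by rewrite expr2 ler_peMr// ltW.
have /choice[Y HY] : forall n, exists yd : (R -> C) * (R -> C),
    [/\ csol Q l (fun=> 0) yd.1 yd.2, yd.1 (N n) = wz h l (N n) &
        yd.2 (N n) = wb g l (N n) * wz h l (N n)].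
  move=> n; have [y [dy Hy]] := csol_ivp l (N n) (wz h l (N n)) (wb g l (N n) * wz h l (N n)) cQ.
  by exists (y, dy).
pose u n := wu h l (Y n).1; pose p n := wp g h l (Y n).1 (Y n).2.
have uN n : u n (N n) = 1.
  by have [_ y1 _] := HY n; rewrite /u /wu y1 mulfV ?wz_neq0.
have pN n : p n (N n) = 0.
  have [_ _ y2] := HY n; rewrite /p /wp -/(u n) uN y2 mulr1 -mulrA mulfV ?wz_neq0//.
  by rewrite mulr1 subrr.
have S n : wkb_sys (wb g l) (wr g l) (fun=> 0) X (u n) (p n).
  by have [Hs _ _] := HY n; exact: wkb_sys_le X1 (wkb_sys_of_csol W Hs).
(* The constant of the finite estimate for [u n - 1], with exact data at [N n] ([e = 0]) and source
   [- rho] ([ep = c]). *)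
pose D := c * (4 * 0 + c) + c.
have DE : 0 <= D by rewrite /D mulr0 add0r addr_ge0// mulr_ge0.
have est n x : X <= x <= N n ->
    cabs (u n x - 1) <= D / x ^+ 2 /\ cabs (p n x) <= D / x ^+ 3.
  move=> xI.
  have [|||_ h2 h3] := wkb_apriori_finite D1 (XN n) (wkb_sys_sub1 (S n)) c0 (lexx 0) _ _ _ xI.
  - by move=> t /andP[Xt _]; rewrite cabsN; have [] := D2 t Xt.
  - by rewrite uN subrr cabs0.
  - by rewrite pN cabs0 mulr0.
  - by move: h2 h3; rewrite -/D addr0 (mulr0 2) add0r.
(* The two solutions are compared at [N n], where the earlier one has data [(1, 0)] and the later
   one is within [D / N n ^ 2 <= D / (n + 1)] of it. Their difference has no source, so this error
   alone propagates back to [X]. *)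
have diffX n m : (n <= m)%N -> cabs (u m X - u n X) <= 4 * D / n.+1%:R /\
    cabs (p m X - p n X) <= (4 * c + 1) * D / n.+1%:R.
  move=> nm; pose e := D / n.+1%:R.
  have e0 : 0 <= e by rewrite divr_ge0.
  have NI : X <= N n <= N m by rewrite XN lerD2l ler_nat.
  have [e1 e2] := est m (N n) NI.
  have De : D / N n ^+ 2 <= e.
    by rewrite ler_wpM2l// lef_pV2 ?posrE ?exprn_gt0.
  have XI : X <= X <= N n by rewrite lexx XN.
  have [|||h1 h2 _] := wkb_apriori_finite D1 (XN n) (wkb_sysB (S m) (S n)) (lexx 0) e0 _ _ _ XI.
  - by move=> t _; rewrite subrr cabs0 mul0r.
  - by rewrite uN (le_trans e1).
  - rewrite pN subr0; apply: le_trans De; apply: le_trans (_ : N n * (D / N n ^+ 3) <= _).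
      by rewrite ler_wpM2l// ltW.
    by apply: eqW_le; field; rewrite gt_eqF.
  split; first by move: h1; rewrite /e addr0 mulrA.
  apply: le_trans h2 _; rewrite !addr0.
  have X3 : 1 <= X ^+ 3 by exact: exprn_ege1.
  have : c * (4 * e) / X ^+ 3 <= c * (4 * e).
    by rewrite ler_pdivrMr ?(lt_le_trans _ X3)// ler_peMr// mulr_ge0// mulr_ge0.
  rewrite -(mulrA _ D) -/e; lra.
have [U HU] := ccauchy_lim (fun n => u n X).
have {}HU := HU (4 * D) (fun n m nm => (diffX n m nm).1).
have [P HP] := ccauchy_lim (fun n => p n X).
have {}HP := HP ((4 * c + 1) * D) (fun n m nm => (diffX n m nm).2).
have aD0 : 0 <= 4 * D by rewrite mulr_ge0.
have bD0 : 0 <= (4 * c + 1) * D by rewrite mulr_ge0// addr_ge0// mulr_ge0.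
move: (4 * D) ((4 * c + 1) * D) aD0 bD0 HU HP => aD bD aD0 bD0 HU HP.
have [y [dy [Hs yX dyX]]] :=
  csol_ivp l X (wz h l X * U) (wz h l X * (P + wb g l X * U)) cQ.
(* The limit is taken only at [X]. At a fixed [x >= X], Gronwall on [[X, x]] shows that [Y n] tends
   to [y], so the bounds [est], valid for [n] large, pass to the limit with the same [D]. *)
exists y, dy; split=> //; exists X, D => x Xx.
have [G G0 HG] := gronwall_norm B0 (cabs_ge0 l) Xx.
have xI : X <= x <= x by rewrite Xx lexx.
have XI : X <= X <= x by rewrite Xx lexx.
pose A := cabs (wz h l X) * aD +
  cabs (wz h l X) * (bD + cabs (wb g l X) * aD).
have close n : cabs ((Y n).1 x - y x) <= G * (A / n.+1%:R) /\
    cabs ((Y n).2 x - dy x) <= G * (A / n.+1%:R).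
  have [Hn _ _] := HY n.
  have z0 t : X <= t <= x -> cabs (0 - 0 : C) <= 0 by rewrite subrr cabs0.
  have := HG Q l _ _ _ 0 QB (lexx _) (csolB Hn Hs) (lexx _) z0 x X xI XI.
  have dX : cabs ((Y n).1 X - y X) + cabs ((Y n).2 X - dy X) + 0 <= A / n.+1%:R.
    rewrite addr0 (wuK h l (Y n).1) -/(u n) yX -mulrBr.
    rewrite (wpK g h l (Y n).1 (Y n).2) -/(u n) -/(p n) dyX -mulrBr !(cabsM (wz h l X)).
    have -> : A / n.+1%:R = cabs (wz h l X) * (aD / n.+1%:R) + cabs (wz h l X) *
        (bD / n.+1%:R + cabs (wb g l X) * (aD / n.+1%:R)) by rewrite /A; ring.
    apply: lerD.
      by rewrite ler_wpM2l ?cabs_ge0//; exact: HU.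
    rewrite ler_wpM2l ?cabs_ge0//.
    rewrite (_ : _ - _ = (p n X - P) + wb g l X * (u n X - U)); last by ring.
    apply: le_trans (cabsD _ _) _; apply: lerD; first exact: HP.
    by rewrite cabsM ler_wpM2l ?cabs_ge0//; exact: HU.
  move=> [h1 h2]; split; first by apply: le_trans h1 _; rewrite ler_wpM2l// ltW.
  by apply: le_trans h2 _; rewrite ler_wpM2l// ltW.
pose zi := cabs (wz h l x)^-1; have zi0 : 0 <= zi := cabs_ge0 _.
pose A' := G * A * zi + cabs (wb g l x) * (G * A * zi).
have A0 : 0 <= A.
  have wb0 : 0 <= cabs (wb g l X) * aD by rewrite mulr_ge0 ?cabs_ge0.
  by apply: addr_ge0; apply: mulr_ge0; rewrite ?cabs_ge0// addr_ge0.
have GA0 : 0 <= G * A * zi by rewrite !mulr_ge0// ltW.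
have ulim n : cabs (wu h l y x - u n x) <= (G * A * zi) / n.+1%:R.
  rewrite cabsBC /u /wu -mulrBl cabsM -/zi.
  rewrite (_ : G * A * zi / n.+1%:R = G * (A / n.+1%:R) * zi); last by ring.
  by rewrite ler_wpM2r//; have [] := close n.
have plim n : cabs (wp g h l y dy x - p n x) <= A' / n.+1%:R.
  rewrite cabsBC /p /wp -/(u n) (_ : _ - _ = ((Y n).2 x - dy x) * (wz h l x)^-1 -
    wb g l x * (u n x - wu h l y x)); last by ring.
  have -> : A' / n.+1%:R = G * A * zi / n.+1%:R + cabs (wb g l x) * (G * A * zi / n.+1%:R).
    by rewrite /A'; ring.
  apply: le_trans (cabsB _ _) _; apply: lerD.
    rewrite cabsM -/zi (_ : G * A * zi / n.+1%:R = G * (A / n.+1%:R) * zi); last by ring.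
    by rewrite ler_wpM2r//; have [] := close n.
  by rewrite cabsM ler_wpM2l ?cabs_ge0// cabsBC.
have big e : 0 < e -> exists n, [/\ x <= N n, (G * A * zi) / n.+1%:R <= e & A' / n.+1%:R <= e].
  move=> e0; have [n1 H1] := small_divSn (G * A * zi) e0; have [n2 H2] := small_divSn A' e0.
  exists (maxn (Num.bound x) (maxn n1 n2)); split.
  - apply: le_trans (_ : (maxn (Num.bound x) (maxn n1 n2))%:R <= _); last first.
      by rewrite lerDr (le_trans _ X1).
    have x0 : 0 <= x by rewrite (le_trans _ Xx)// (le_trans _ X1).
    by apply: le_trans (ltW (archi_boundP x0)) _; rewrite ler_nat leq_maxl.
  - by apply: H1; rewrite !leq_max leqnn orbT.
  - by apply: H2; rewrite !leq_max leqnn !orbT.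
split; apply/ler_addgt0Pr => e e0; have [n [xN b1 b2]] := big e e0;
  have [|e1 e2] := est n x; rewrite ?Xx//.
  apply: le_trans (cabs_distD _ _ (u n x)) _; rewrite addrC; apply: lerD => //.
  exact: le_trans (ulim n) b1.
rewrite (_ : wp g h l y dy x = p n x + (wp g h l y dy x - p n x)); last by rewrite addrC subrK.
apply: le_trans (cabsD _ _) _; apply: lerD => //; exact: le_trans (plim n) b2.
Qed.

End Existence.

(** * Complex differentiability through divided differences *)

Section Holomorphy.
Context {R : realType}.
Local Notation C := (Cplx R).
Implicit Types (f : C -> C) (l s t w : C).

Definition dquot f l s : C := (f (l + s) - f l) / s.

(* The divided differences of [f] at [l] satisfy a Lipschitz Cauchy condition; this only involves
   values of [f] and implies complex differentiability by completeness. *)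
Definition ddc f l : Prop := exists E r : R, [/\ 0 <= E, 0 < r &
  forall s t, s != 0 -> t != 0 -> cabs s <= r -> cabs t <= r ->
    cabs (dquot f l s - dquot f l t) <= E * (cabs s + cabs t)].

Lemma dquotK f l s : s != 0 -> f (l + s) = f l + s * dquot f l s.
Proof. by move=> s0; rewrite /dquot mulrCA mulfV// mulr1 addrCA subrr addr0. Qed.

Lemma ddc_bounded f l : ddc f l -> exists M r : R, [/\ 0 <= M, 0 < r &
  forall s, s != 0 -> cabs s <= r -> cabs (dquot f l s) <= M /\ cabs (f (l + s)) <= M].
Proof.
(* All quotients are compared with the one at the fixed increment [r]. *)
move=> [E [r [E0 r0 H]]]; pose t : C := r%:C.
have tr : cabs t = r by rewrite cabsC ger0_norm// ltW.
have t0 : t != 0 by rewrite -cabs_gt0 tr.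
pose b := cabs (dquot f l t) + E * (r + r).
have b0 : 0 <= b by rewrite addr_ge0 ?cabs_ge0// mulr_ge0// addr_ge0// ltW.
have rb0 : 0 <= r * b by rewrite mulr_ge0// ltW.
have fl0 := cabs_ge0 (f l).
exists (b + cabs (f l) + r * b), r; split => //; first exact: addr_ge0 (addr_ge0 b0 fl0) rb0.
move=> s s0 sr.
have Ds : cabs (dquot f l s) <= b.
  have h1 := H s t s0 t0 sr; rewrite tr lexx in h1; have {}h1 := h1 isT.
  have h2 := cabs_triB (dquot f l s) (dquot f l t).
  have h3 : E * (cabs s + r) <= E * (r + r) by rewrite ler_wpM2l// lerD2r.
  rewrite /b; lra.
split; first lra.
rewrite dquotK//; apply: le_trans (cabsD _ _) _; rewrite cabsM.
have : cabs s * cabs (dquot f l s) <= r * b by apply: ler_pM; rewrite ?cabs_ge0.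
lra.
Qed.

Lemma ddc_cst (c : C) l : ddc (fun=> c) l.
Proof.
exists 0, 1; split => // s t _ _ _ _.
have e k : dquot (fun=> c) l k = 0 by rewrite /dquot /= subrr mul0r.
by rewrite !e subrr cabs0 mul0r.
Qed.

Lemma ddc_id l : ddc id l.
Proof.
exists 0, 1; split => // s t s0 t0 _ _.
have e (k : C) : k != 0 -> dquot id l k = 1.
  by move=> k0; rewrite /dquot /= addrAC subrr add0r mulfV.
by rewrite !e// subrr cabs0 mul0r.
Qed.

Lemma ddcD f1 f2 l : ddc f1 l -> ddc f2 l -> ddc (fun m => f1 m + f2 m) l.
Proof.
move=> [E1 [r1 [E10 r10 H1]]] [E2 [r2 [E20 r20 H2]]].
exists (E1 + E2), (Num.min r1 r2); split; [exact: addr_ge0|by rewrite lt_min r10|].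
move=> s t s0 t0; rewrite !le_min => /andP[s1 s2] /andP[t1 t2].
rewrite (_ : _ - _ = (dquot f1 l s - dquot f1 l t) + (dquot f2 l s - dquot f2 l t)); last first.
  by rewrite /dquot; ring.
by apply: le_trans (cabsD _ _) _; rewrite [leRHS]mulrDl; apply: lerD; [exact: H1|exact: H2].
Qed.

Lemma ddcM f1 f2 l : ddc f1 l -> ddc f2 l -> ddc (fun m => f1 m * f2 m) l.
Proof.
move=> D1 D2; have [M1 [q1 [M10 q10 B1]]] := ddc_bounded D1.
have [M2 [q2 [M20 q20 B2]]] := ddc_bounded D2.
have [E1 [r1 [E10 r10 H1]]] := D1; have [E2 [r2 [E20 r20 H2]]] := D2.
exists (E1 * M2 + M1 * M2 + cabs (f1 l) * E2), (Num.min (Num.min r1 r2) (Num.min q1 q2)).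
have fl0 := cabs_ge0 (f1 l).
split; [by rewrite !addr_ge0// mulr_ge0|by rewrite !lt_min r10 r20 q10|].
move=> s t s0 t0; rewrite !le_min.
move=> /andP[/andP[s1 s2] /andP[s3 s4]] /andP[/andP[t1 t2] /andP[t3 t4]].
have [b1 b2] := B2 s s0 s4; have [b3 b4] := B1 t t0 t3; have [b5 _] := B2 t t0 t4.
(* The middle term is [f2 (l + s) - f2 (l + t)] written through quotients, which makes it visibly
   [O(|s| + |t|)]. *)
rewrite (_ : _ - _ = (dquot f1 l s - dquot f1 l t) * f2 (l + s) +
   dquot f1 l t * (s * dquot f2 l s - t * dquot f2 l t) +
   f1 l * (dquot f2 l s - dquot f2 l t)); last first.
  rewrite /dquot /=; field; rewrite s0 t0 //.
have a0 : 0 <= cabs s + cabs t by rewrite addr_ge0 ?cabs_ge0.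
apply: le_trans (cabsD _ _) _; rewrite [leRHS]mulrDl; apply: lerD; last first.
  by rewrite cabsM -mulrA ler_wpM2l//; exact: H2.
apply: le_trans (cabsD _ _) _; rewrite [leRHS]mulrDl; apply: lerD.
  rewrite cabsM mulrAC; apply: ler_pM; rewrite ?cabs_ge0//; exact: H1.
rewrite cabsM -mulrA; apply: ler_pM; rewrite ?cabs_ge0//.
apply: le_trans (cabsB _ _) _; rewrite (cabsM s) (cabsM t) [leRHS]mulrDr.
by apply: lerD; rewrite mulrC ler_wpM2r ?cabs_ge0//.
Qed.

(** Two successive mean value inequalities along the segment from [0] to [w], on which the
    exponential is at most [exp 1] in modulus. *)
Lemma cexp_taylor w : cabs w <= 1 -> cabs (cexp w - 1 - w) <= expR 1 * cabs w ^+ 2.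
Proof.
move=> w1; have W0 := cabs_ge0 w.
have cd (x : R) : cder (fun y : R => y%:C * w) x w.
  apply: cder_eq (cderM (cder_real (rder_id x)) (cder_cst w x)) _.
  by rewrite mul1r mulr0 addr0.
have ex (x : R) : 0 <= x <= 1 -> cabs (cexp (x%:C * w)) <= expR 1.
  move=> /andP[x0 x1]; rewrite cabs_cexp ler_expR; apply: le_trans (ler_norm _) _.
  apply: le_trans (ler_cRe _) _; rewrite cabsM cabsC ger0_norm//.
  by apply: mulr_ile1.
have h1 (x : R) : 0 <= x <= 1 -> cabs (cexp (x%:C * w) - 1) <= expR 1 * cabs w.
  move=> /andP[x0 x1].
  have := @cder_mean_value _ (fun y => cexp (y%:C * w)) (fun y => w * cexp (y%:C * w))
    (fun y => expR 1 * cabs w * y) (fun y => expR 1 * cabs w * 1) 0 x x0.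
  rewrite mul0r cexp0 mulr0 subr0 => h; apply: le_trans (h _ _ _) _.
  - by move=> y _; exact: cder_cexp (cd y).
  - move=> y /andP[y0 yx]; rewrite cabsM mulr1 mulrC ler_wpM2r// ex// y0.
    exact: le_trans yx x1.
  - by rewrite ler_piMr// mulr_ge0// expR_ge0.
have := @cder_mean_value _ (fun y => cexp (y%:C * w) - y%:C * w)
    (fun y => w * cexp (y%:C * w) - w)
    (fun y => expR 1 * cabs w ^+ 2 * y) (fun y => expR 1 * cabs w ^+ 2 * 1) 0 1 ler01.
rewrite !mul1r mul0r cexp0 mulr0 !subr0 mulr1 => h.
rewrite addrAC; apply: h.
- by move=> y _; apply: cderB => //; exact: cder_cexp (cd y).
- by move=> y _; apply: rder_eq (rderMl (expR 1 * cabs w ^+ 2) (rder_id y)) _; rewrite mulr1.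
- move=> y yI; rewrite (_ : _ - w = w * (cexp (y%:C * w) - 1)); last by ring.
  by rewrite cabsM expr2 mulrA mulrC ler_wpM2r// h1.
Qed.

Lemma ddc_cexp (c : C) l : ddc (fun m => cexp (m * c)) l.
Proof.
pose M := cabs (cexp (l * c)) * (expR 1 * cabs c ^+ 2).
have c0 := cabs_ge0 c.
have M0 : 0 <= M by rewrite !mulr_ge0 ?cabs_ge0 ?expR_ge0 ?sqr_ge0.
(* This radius guarantees [|s c| <= 1], the range of the Taylor bound. *)
exists M, (1 + cabs c)^-1; have c1 : 0 < 1 + cabs c by lra.
split=> //; first by rewrite invr_gt0.
have key s : s != 0 -> cabs s <= (1 + cabs c)^-1 ->
    cabs (dquot (fun m => cexp (m * c)) l s - cexp (l * c) * c) <= M * cabs s.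
  move=> s0 sr; rewrite /dquot (mulrDl l s c) cexpD.
  rewrite (_ : _ - _ = cexp (l * c) * (cexp (s * c) - 1 - s * c) / s); last by field.
  have s0' : 0 < cabs s by rewrite cabs_gt0.
  have B : cabs (cexp (s * c) - 1 - s * c) <= expR 1 * (cabs s * cabs c) ^+ 2.
    rewrite -cabsM; apply: cexp_taylor.
    rewrite cabsM; apply: le_trans (_ : (1 + cabs c)^-1 * (1 + cabs c) <= _).
      by apply: ler_pM; rewrite ?cabs_ge0//; lra.
    by rewrite mulVf// gt_eqF.
  rewrite (cabsM _ s^-1) cabsV ler_pdivrMr// (cabsM (cexp (l * c))).
  apply: le_trans (ler_wpM2l (cabs_ge0 (cexp (l * c))) B) _.
  by apply: eqW_le; rewrite /M; ring.
move=> s t s0 t0 sr tr.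
apply: le_trans (cabs_distD _ _ (cexp (l * c) * c)) _; rewrite [leRHS]mulrDr.
by apply: lerD; [exact: key|rewrite cabsBC; exact: key].
Qed.

(** The quotients along [r / (n + 1)] have a limit [d]; the Cauchy condition compares an arbitrary
    increment [k] with this sequence and gives an error of at most [E |k|]. *)
Lemma ddc_derivable f l : ddc f l -> derivable f l 1.
Proof.
move=> [E [r [E0 r0 H]]].
pose s n : C := (r / n.+1%:R)%:C.
have s_abs n : cabs (s n) = r / n.+1%:R by rewrite cabsC ger0_norm// divr_ge0// ltW.
have s_neq0 n : s n != 0 by rewrite -cabs_gt0 s_abs divr_gt0.
have s_le n : cabs (s n) <= r by rewrite s_abs ler_pdivrMr// ler_peMr ?ler1n// ltW.
have [d Hd] := ccauchy_lim (fun n => dquot f l (s n)).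
have {}Hd n : cabs (dquot f l (s n) - d) <= 2 * E * r / n.+1%:R.
  apply: Hd => {}n m nm; apply: le_trans (H _ _ (s_neq0 m) (s_neq0 n) (s_le m) (s_le n)) _.
  have h : r / m.+1%:R <= r / n.+1%:R.
    by rewrite ler_wpM2l ?(ltW r0)// lef_pV2 ?posrE// ler_nat.
  apply: le_trans (_ : E * (r / n.+1%:R + r / n.+1%:R) <= _).
    by rewrite ler_wpM2l// !s_abs lerD2r.
  by apply: eqW_le; ring.
have key k : k != 0 -> cabs k <= r -> cabs (dquot f l k - d) <= E * cabs k.
  move=> k0 kr; apply/ler_addgt0Pr => e e0.
  have [n Hn] := small_divSn (3 * E * r) e0; have {}Hn := Hn n (leqnn n).
  apply: le_trans (cabs_distD _ _ (dquot f l (s n))) _.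
  apply: le_trans (lerD (H _ _ k0 (s_neq0 n) kr (s_le n)) (Hd n)) _.
  rewrite s_abs mulrDr -addrA lerD2l; apply: le_trans Hn; apply: eqW_le; ring.
apply/cvg_ex; exists d; apply/cvgrPdist_le => e e0.
(* In the order of [C], [0 < e] means that [e] is real and positive. *)
have [eI eR] : cIm e = 0 /\ 0 < cRe e.
  by move: e0; rewrite ltcE => /andP[/eqP ? ?].
have eE : e = (cRe e)%:C by exact: cext.
pose del := Num.min r (cRe e / (E + 1)).
have del0 : 0 < del%:C :> C by rewrite ltcR lt_min r0 divr_gt0//; lra.
near=> k.
have k0 : k != 0 by near: k; exact: nbhs_dnbhs_neq.
have : `|k| <= del%:C :> C by near: k; exact: dnbhs0_le.
rewrite cabs_norm lecR le_min => /andP[kr ke].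
rewrite distrC (_ : _ - d = dquot f l k - d); last first.
  by rewrite /dquot /GRing.scale/= mulr1 (addrC k) mulrC.
rewrite cabs_norm eE lecR; apply: le_trans (key k k0 kr) _.
have : cabs k * (E + 1) <= cRe e by rewrite -ler_pdivlMr//; lra.
have := cabs_ge0 k; lra.
Unshelve. all: by end_near. Qed.

End Holomorphy.

(** * Entire dependence of the decaying solution on [l] *)

Section EntireSolutions.
Context {R : realType}.
Local Notation C := (Cplx R).
Implicit Types (Q g h : R -> C) (l m s t : C) (x : R) (psi dpsi : C -> R -> C).

(** The divided difference [del psi s] solves the equation at [l] with source [psi (l + s)].
    Gronwall bounds first [psi (l + s)] by [A], then the divided differences by [BB]; hence two of
    them have sources differing by at most [BB (|s| + |t|)], and a third use of Gronwall
    concludes. *)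
Lemma ddc_propagate Q (B X x : R) psi dpsi l : (forall y : R, cabs (Q y) <= B) ->
  (forall m, csol Q m (fun=> 0) (psi m) (dpsi m)) ->
  ddc (fun m => psi m X) l -> ddc (fun m => dpsi m X) l ->
  ddc (fun m => psi m x) l /\ ddc (fun m => dpsi m x) l.
Proof.
move=> QB H D1 D2; have B0 : 0 <= B by exact: le_trans (cabs_ge0 _) (QB 0).
have ab : Num.min x X <= Num.max x X by rewrite le_max ge_min lexx.
have xI : Num.min x X <= x <= Num.max x X by rewrite le_max ge_min lexx.
have XI : Num.min x X <= X <= Num.max x X by rewrite le_max ge_min lexx !orbT.
have l1 : 0 <= cabs l + 1 by rewrite addr_ge0 ?cabs_ge0.
have ll : cabs l <= cabs l + 1 by rewrite lerDl.
have [G G0 HG] := gronwall_norm B0 l1 ab.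
have [M1 [r1 [M10 r10 b1]]] := ddc_bounded D1.
have [M2 [r2 [M20 r20 b2]]] := ddc_bounded D2.
have [E1 [r3 [E10 r30 c1]]] := D1; have [E2 [r4 [E20 r40 c2]]] := D2.
pose r := Num.min (Num.min r1 r2) (Num.min (Num.min r3 r4) 1).
have r0 : 0 < r by rewrite !lt_min r10 r20 r30 r40 ltr01.
pose A := G * (M1 + M2); have A0 : 0 <= A by rewrite mulr_ge0 ?addr_ge0// ltW.
pose BB := G * (M1 + M2 + A); have BB0 : 0 <= BB by rewrite mulr_ge0 ?addr_ge0// ltW.
pose del (f : C -> R -> C) s (y : R) := s^-1 * (f (l + s) y - f l y).
have rs s : cabs s <= r -> [/\ cabs s <= r1, cabs s <= r2, cabs s <= r3, cabs s <= r4 & cabs s <= 1].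
  by rewrite !le_min => /andP[/andP[-> ->] /andP[/andP[-> ->] ->]].
have delE f s y : del f s y = dquot (fun m => f m y) l s by rewrite /del /dquot mulrC.
have ybd s : s != 0 -> cabs s <= r -> forall y, Num.min x X <= y <= Num.max x X ->
    cabs (psi (l + s) y) <= A.
  move=> s0 /rs[s1 s2 _ _ s5] y yI.
  have ls : cabs (l + s) <= cabs l + 1 by apply: le_trans (cabsD _ _) _; rewrite lerD2l.
  have z0 v : Num.min x X <= v <= Num.max x X -> cabs (0 : C) <= 0 by rewrite cabs0.
  have [h1 _] := HG Q (l + s) _ _ _ 0 QB ls (H (l + s)) (lexx 0) z0 y X yI XI.
  apply: le_trans h1 _; rewrite addr0 /A ler_wpM2l ?(ltW G0)//.
  by apply: lerD; [case: (b1 s s0 s1)|case: (b2 s s0 s2)].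
have dsol s : s != 0 -> csol Q l (psi (l + s)) (del psi s) (del dpsi s).
  move=> s0; apply: csol_ext (csolZ s^-1 (csolB (csol_shift l (H (l + s))) (H l))) _.
  by move=> y /=; rewrite add0r subr0 [l + s]addrC addrK mulKf.
have dbd s : s != 0 -> cabs s <= r -> forall y, Num.min x X <= y <= Num.max x X ->
    cabs (del psi s y) <= BB.
  move=> s0 sr y yI; have [s1 s2 _ _ _] := rs s sr.
  have [h1 _] := HG Q l _ _ _ A QB ll (dsol s s0) A0 (ybd s s0 sr) y X yI XI.
  apply: le_trans h1 _; rewrite /BB ler_wpM2l ?(ltW G0)// lerD2r !delE.
  by apply: lerD; [case: (b1 s s0 s1)|case: (b2 s s0 s2)].
have key s t : s != 0 -> t != 0 -> cabs s <= r -> cabs t <= r ->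
    cabs (del psi s x - del psi t x) <= G * (E1 + E2 + BB) * (cabs s + cabs t) /\
    cabs (del dpsi s x - del dpsi t x) <= G * (E1 + E2 + BB) * (cabs s + cabs t).
  move=> s0 t0 sr tr; have st0 : 0 <= cabs s + cabs t by rewrite addr_ge0 ?cabs_ge0.
  have Fbd y : Num.min x X <= y <= Num.max x X ->
      cabs (psi (l + s) y - psi (l + t) y) <= BB * (cabs s + cabs t).
    move=> yI; rewrite (_ : _ - _ = s * del psi s y - t * del psi t y); last first.
      by rewrite /del !mulrA !mulfV// !mul1r; ring.
    apply: le_trans (cabsB _ _) _; rewrite (cabsM s) (cabsM t) [leRHS]mulrDr.
    by apply: lerD; rewrite mulrC ler_wpM2r ?cabs_ge0// dbd.
  have [h1 h2] := HG Q l _ _ _ _ QB ll (csolB (dsol s s0) (dsol t t0)) (mulr_ge0 BB0 st0) Fbd x X xI XI.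
  have [_ _ s3 s4 _] := rs s sr; have [_ _ t3 t4 _] := rs t tr.
  have hX : cabs (del psi s X - del psi t X) + cabs (del dpsi s X - del dpsi t X) +
      BB * (cabs s + cabs t) <= (E1 + E2 + BB) * (cabs s + cabs t).
    rewrite [leRHS]mulrDl lerD2r [leRHS]mulrDl !delE.
    by apply: lerD; [exact: c1|exact: c2].
  by rewrite -mulrA; split; [apply: le_trans h1 _|apply: le_trans h2 _];
    rewrite ler_wpM2l ?(ltW G0).
have GE0 : 0 <= G * (E1 + E2 + BB) by rewrite mulr_ge0 ?(ltW G0)// !addr_ge0.
split; exists (G * (E1 + E2 + BB)), r; split => // s t s0 t0 sr tr; rewrite -!delE.
  by case: (key s t s0 t0 sr tr).
by case: (key s t s0 t0 sr tr).
Qed.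

(** The counterpart of [csol_shift]: the change of coefficients is put into the source. *)
Lemma wkb_sys_param (b b' rho rho' f u p : R -> C) X : wkb_sys b' rho' f X u p ->
  wkb_sys b rho (fun x => f x - 2 * (b' x - b x) * p x - (rho' x - rho x) * u x) X u p.
Proof.
move=> H x Xx; have [h1 h2] := H x Xx; split=> //.
by apply: cder_eq h2 _; ring.
Qed.

Lemma wb_shift g l s x : wb g (l + s) x - wb g l x = s / 2 * (x^-1)%:C.
Proof. by rewrite /wb; move: (x^-1)%:C => xi; field. Qed.

(** The derivative of [wr] in [l]. As [wr] is quadratic in [l], its expansion stops after the next
    term [s^2 x^-2 / 4]. *)
Definition wrho g l x : C := ((l - 1) / 2 - 1 / 2) * (x^-1)%:C ^+ 2 + g x * (x^-1)%:C.

Lemma wr_shift g l s x :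
  wr g (l + s) x - wr g l x = s * (wrho g l x + s / 4 * (x^-1)%:C ^+ 2).
Proof. by rewrite /wr /wrho; move: (x^-1)%:C => xi; field. Qed.

Lemma wkb_data_le (b z rho : R -> C) (X X' c : R) : X <= X' -> wkb_data b z rho X c ->
  wkb_data b z rho X' c.
Proof.
move=> XX [X1 c0 cX H]; split => //; first exact: le_trans XX.
  by apply: le_trans cX _; apply: lerXn2r; rewrite ?nnegrE//; rewrite ?(le_trans _ X1)// (le_trans _ XX)// (le_trans _ X1).
by move=> x Xx; apply: H; exact: le_trans Xx.
Qed.

Lemma vanishingB (u1 p1 u2 p2 : R -> C) : vanishing u1 p1 -> vanishing u2 p2 ->
  vanishing (fun x => u1 x - u2 x) (fun x => p1 x - p2 x).
Proof.
move=> V1 V2 e e0; have e2 : 0 < e / 2 by rewrite divr_gt0.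
have [N1 H1] := V1 _ e2; have [N2 H2] := V2 _ e2.
exists (Num.max 0 (Num.max N1 N2)) => N; rewrite !ge_max => /andP[N0 /andP[n1 n2]].
have [a1 b1] := H1 N n1; have [a2 b2] := H2 N n2.
have h1 := cabsB (u1 N) (u2 N).
have h2 : N * cabs (p1 N - p2 N) <= N * (cabs (p1 N) + cabs (p2 N)).
  by rewrite ler_wpM2l// cabsB.
rewrite mulrDr in h2; split; lra.
Qed.

(** The scheme of [ddc_propagate], with the a priori estimate from infinity in place of Gronwall.
    Divided differences of [U] and [P] solve the system at [l] with a source [O(x^-2)] uniform in
    [s]; being bounded, they make the sources for [s] and [t] differ by [O((|s| + |t|) x^-2)]. *)
Lemma decaying_ddc_far Q g h (K : R) psi dpsi l : wkb_corr Q g h K ->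
  (forall m, decaying Q g h m (psi m) (dpsi m)) ->
  exists2 X : R, 1 <= X & ddc (fun m => wu h m (psi m) X) l /\
    ddc (fun m => wp g h m (psi m) (dpsi m) X) l.
Proof.
move=> W H; have [K0 W2] := W.
have r0 : 0 <= cabs l + 1 by rewrite addr_ge0 ?cabs_ge0.
have ll : cabs l <= cabs l + 1 by rewrite lerDl.
have [X1 [D [X11 D0 HD]]] := decaying_uniform W r0.
have [X2 [c HX2]] := wkb_data_ex W r0.
pose X := Num.max X1 X2.
have data : wkb_data (wb g l) (wz h l) (wr g l) X c.
  by apply: wkb_data_le (HX2 l ll); rewrite le_max lexx orbT.
have [X1' c0 _ _] := data.
have XX1 : X1 <= X by rewrite le_max lexx.
pose U m x := wu h m (psi m) x; pose P m x := wp g h m (psi m) (dpsi m) x.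
have est m x : cabs m <= cabs l + 1 -> X <= x ->
    cabs (U m x - 1) <= D / x ^+ 2 /\ cabs (P m x) <= D / x ^+ 3.
  by move=> mr Xx; apply: HD => //; exact: le_trans Xx.
have ls s : cabs s <= 1 -> cabs (l + s) <= cabs l + 1.
  by move=> s1; apply: le_trans (cabsD _ _) _; rewrite lerD2l.
have S m : wkb_sys (wb g m) (wr g m) (fun=> 0) X (U m) (P m).
  by have [Hs _] := H m; exact: wkb_sys_le X1' (wkb_sys_of_csol W Hs).
pose f s x : C := - ((x^-1)%:C * P (l + s) x) - (wrho g l x + s / 4 * (x^-1)%:C ^+ 2) * U (l + s) x.
pose du s x := s^-1 * (U (l + s) x - U l x); pose dp s x := s^-1 * (P (l + s) x - P l x).
have dS s : s != 0 -> wkb_sys (wb g l) (wr g l) (f s) X (du s) (dp s).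
  move=> s0; have := wkb_sysZ s^-1 (wkb_sysB (wkb_sys_param (wb g l) (wr g l) (S (l + s))) (S l)).
  by apply: wkb_sys_ext => x; rewrite wb_shift wr_shift /f; move: (x^-1)%:C => xi; field.
pose c1 := cabs ((l - 1) / 2 - 1 / 2) + K.
have c10 : 0 <= c1 by rewrite addr_ge0 ?cabs_ge0.
have pos x : X <= x -> 1 <= x := le_trans X1'.
have inv0 x : X <= x -> 0 <= x^-1 by move=> Xx; rewrite invr_ge0 (le_trans _ (pos x Xx)).
have invE x : X <= x -> cabs (x^-1)%:C = x^-1 by move=> Xx; rewrite cabsC ger0_norm// inv0.
have inv1 x : X <= x -> x^-1 <= 1.
  by move=> Xx; rewrite invf_le1 ?pos// (lt_le_trans _ (pos x Xx)).
have rho_bd x : X <= x -> cabs (wrho g l x) <= c1 * (x^-1) ^+ 2.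
  move=> Xx; apply: le_trans (cabsD _ _) _; rewrite /c1 [leRHS]mulrDl; apply: lerD.
    by rewrite (cabsM (_ - _)) cabsX invE.
  have [_ _ gx _] := W2 x (pos x Xx).
  by rewrite cabsM invE// expr2 mulrA ler_wpM2r// inv0.
have U_bd s x : cabs s <= 1 -> X <= x -> cabs (U (l + s) x) <= 1 + D.
  move=> s1 Xx; have [h1 _] := est _ x (ls s s1) Xx.
  have h2 := cabs_triB (U (l + s) x) 1; rewrite cabs1 in h2.
  have : D / x ^+ 2 <= D.
    have x2 : 1 <= x ^+ 2 by rewrite exprn_ege1// pos.
    by rewrite ler_pdivrMr ?(lt_le_trans _ x2)// ler_peMr.
  lra.
have s4_bd s x : cabs s <= 1 -> X <= x -> cabs (s / 4 * (x^-1)%:C ^+ 2) <= cabs s * x^-1 ^+ 2.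
  move=> s1 Xx; rewrite (cabsM (_ / _)) cabsX invE// ler_wpM2r ?exprn_ge0 ?inv0//.
  rewrite cabsM cabsV (cabs_nat 4) ler_pdivrMr// ler_peMr ?cabs_ge0// ler1n//.
pose E1 := D + (c1 + 1) * (1 + D).
have E10 : 0 <= E1 by apply: addr_ge0 => //; apply: mulr_ge0; apply: addr_ge0.
have f_bd s : cabs s <= 1 -> forall x, X <= x -> cabs (f s x) <= E1 / x ^+ 2.
  move=> s1 x Xx; have [_ h1] := est _ x (ls s s1) Xx.
  rewrite -exprVn /f /E1 [leRHS]mulrDl; apply: le_trans (cabsB _ _) _; rewrite cabsN; apply: lerD.
    rewrite cabsM invE//; apply: le_trans (_ : 1 * (D / x ^+ 3) <= _).
      by apply: ler_pM; rewrite ?inv0 ?inv1 ?cabs_ge0.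
    rewrite mul1r exprVn ler_wpM2l// lef_pV2 ?posrE ?exprn_gt0 ?(lt_le_trans _ (pos x Xx))//.
    by rewrite ler_weXn2l// pos.
  rewrite (cabsM (_ + _)) [leRHS]mulrAC; apply: ler_pM; rewrite ?cabs_ge0 ?U_bd//.
  apply: le_trans (cabsD _ _) _; rewrite [leRHS]mulrDl; apply: lerD; first exact: rho_bd.
  by apply: le_trans (s4_bd s x s1 Xx) _; rewrite ler_wpM2r ?exprn_ge0 ?inv0.
(* This bound blows up as [s] tends to [0], but it serves only for the qualitative vanishing at
   infinity for each fixed [s]. *)
have van s : cabs s <= 1 -> vanishing (du s) (dp s).
  move=> s1; apply: (@vanishing_power _ _ _ X (cabs s^-1 * (2 * D))) => x Xx.
  have [h1 h2] := est _ x (ls s s1) Xx; have [h3 h4] := est l x ll Xx.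
  rewrite /du /dp (cabsM s^-1) (cabsM s^-1) -!mulrA; split; rewrite ler_wpM2l ?cabs_ge0//.
    rewrite (_ : _ - _ = (U (l + s) x - 1) - (U l x - 1)); last by ring.
    by apply: le_trans (cabsB _ _) _; lra.
  by apply: le_trans (cabsB _ _) _; lra.
have dbd s x : s != 0 -> cabs s <= 1 -> X <= x ->
    cabs (du s x) <= E1 /\ cabs (dp s x) <= (c + 1) * E1.
  move=> s0 s1 Xx.
  have [h1 h2 _] := wkb_apriori data (dS s s0) E10 (f_bd s s1) (van s s1) Xx.
  split=> //; apply: le_trans h2 _.
  have x3 : 1 <= x ^+ 3 by rewrite exprn_ege1// pos.
  by rewrite ler_pdivrMr ?(lt_le_trans _ x3)// ler_peMr// mulr_ge0// addr_ge0.
pose E2 := (c + 1) * E1 + c1 * E1 + (1 + D).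
have E20 : 0 <= E2.
  by apply: addr_ge0; apply: addr_ge0 => //; apply: mulr_ge0 => //; exact: addr_ge0.
have ff_bd s t : s != 0 -> t != 0 -> cabs s <= 1 -> cabs t <= 1 -> forall x, X <= x ->
    cabs (f s x - f t x) <= E2 * (cabs s + cabs t) / x ^+ 2.
  move=> s0 t0 s1 t1 x Xx.
  have [u1 q1] := dbd s x s0 s1 Xx; have [u2 q2] := dbd t x t0 t1 Xx.
  set xi := (x^-1)%:C : C.
  have xiE : cabs xi = x^-1 by rewrite invE.
  have i0 := inv0 x Xx; have st0 : 0 <= cabs s + cabs t by rewrite addr_ge0 ?cabs_ge0.
  rewrite (_ : f s x - f t x = - (xi * (s * dp s x - t * dp t x)) -
    wrho g l x * (s * du s x - t * du t x) -
    (s / 4 * xi ^+ 2 * U (l + s) x - t / 4 * xi ^+ 2 * U (l + t) x)); last first.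
    rewrite /f /du /dp /xi; move: (x^-1)%:C (wrho g l x) (U (l + s) x) (U (l + t) x) (U l x)
      (P (l + s) x) (P (l + t) x) (P l x) => xi' a1 a2 a3 a4 a5 a6 a7.
    by field; rewrite s0 t0.
  rewrite -exprVn (_ : E2 * _ * _ = (c + 1) * E1 * (cabs s + cabs t) * x^-1 ^+ 2 +
     c1 * E1 * (cabs s + cabs t) * x^-1 ^+ 2 + (1 + D) * (cabs s + cabs t) * x^-1 ^+ 2); last first.
    by rewrite /E2; ring.
  have lin (a b : C) M : cabs a <= M -> cabs b <= M ->
      cabs (s * a - t * b) <= M * (cabs s + cabs t).
    move=> aM bM; apply: le_trans (cabsB _ _) _; rewrite (cabsM s) (cabsM t) [leRHS]mulrDr.
    by apply: lerD; rewrite mulrC ler_wpM2r ?cabs_ge0.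
  have lin_dp := lin _ _ _ q1 q2; have lin_du := lin _ _ _ u1 u2.
  (* In the source [dp] comes with a single factor [1/x]; the second factor needed for [x^-2] is
     taken from the decay of [dp] itself. *)
  have dp_q s' : s' != 0 -> cabs s' <= 1 -> cabs (dp s' x) <= (c + 1) * E1 * x^-1.
    move=> n0 n1.
    have [_ h2 _] := wkb_apriori data (dS s' n0) E10 (f_bd s' n1) (van s' n1) Xx.
    apply: le_trans h2 _; apply: ler_wpM2l; first by apply: mulr_ge0 => //; exact: addr_ge0.
    rewrite lef_pV2 ?posrE ?exprn_gt0 ?(lt_le_trans _ (pos x Xx))//.
    by rewrite -{1}(expr1 x) ler_weXn2l// pos.
  have lin_dp' := lin _ _ _ (dp_q s s0 s1) (dp_q t t0 t1).
  apply: le_trans (cabsB _ _) _; apply: lerD; last first.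
    apply: le_trans (cabsB _ _) _.
    rewrite (cabsM (s / 4 * xi ^+ 2)) (cabsM (t / 4 * xi ^+ 2)).
    have k1 : cabs (s / 4 * xi ^+ 2) * cabs (U (l + s) x) <= cabs s * x^-1 ^+ 2 * (1 + D).
      by apply: ler_pM; [exact: cabs_ge0|exact: cabs_ge0|exact: s4_bd|exact: U_bd].
    have k2 : cabs (t / 4 * xi ^+ 2) * cabs (U (l + t) x) <= cabs t * x^-1 ^+ 2 * (1 + D).
      by apply: ler_pM; [exact: cabs_ge0|exact: cabs_ge0|exact: s4_bd|exact: U_bd].
    by apply: le_trans (lerD k1 k2) _; apply: eqW_le; ring.
  apply: le_trans (cabsB _ _) _; apply: lerD.
    rewrite cabsN (cabsM xi) xiE; apply: le_trans (ler_wpM2l i0 lin_dp') _.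
    by apply: eqW_le; ring.
  rewrite (cabsM (wrho g l x)); apply: le_trans (_ : c1 * x^-1 ^+ 2 * (E1 * (cabs s + cabs t)) <= _).
    by apply: ler_pM; rewrite ?cabs_ge0 ?rho_bd.
  by apply: eqW_le; ring.
have E2c0 : 0 <= (c + 1) * E2 by apply: mulr_ge0 => //; exact: addr_ge0.
have key s t : s != 0 -> t != 0 -> cabs s <= 1 -> cabs t <= 1 ->
    cabs (du s X - du t X) <= (c + 1) * E2 * (cabs s + cabs t) /\
    cabs (dp s X - dp t X) <= (c + 1) * E2 * (cabs s + cabs t).
  move=> s0 t0 s1 t1; have st0 : 0 <= cabs s + cabs t by rewrite addr_ge0 ?cabs_ge0.
  have [h1 h2 _] := wkb_apriori data (wkb_sysB (dS s s0) (dS t t0)) (mulr_ge0 E20 st0)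
    (ff_bd s t s0 t0 s1 t1) (vanishingB (van s s1) (van t t1)) (lexx X).
  split.
    by apply: le_trans h1 _; rewrite -mulrA; apply: ler_peMl; [exact: mulr_ge0|lra].
  have x3 : 1 <= X ^+ 3 by rewrite exprn_ege1.
  apply: le_trans h2 _; rewrite mulrA ler_pdivrMr ?(lt_le_trans _ x3)//.
  by apply: ler_peMr => //; exact: mulr_ge0.
exists X => //; split; exists ((c + 1) * E2), 1; split => // s t s0 t0 s1 t1.
  by have [+ _] := key s t s0 t0 s1 t1; rewrite /du /dquot (mulrC s^-1) (mulrC t^-1).
by have [_ +] := key s t s0 t0 s1 t1; rewrite /dp /dquot (mulrC s^-1) (mulrC t^-1).
Qed.

(** At the large point [X], [psi = z u] and [dpsi = z (p + wb u)], where [z] is an exponential of an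
    affine function of [l] and [wb] is affine in [l]; the values at [x] follow by propagation. *)
Lemma decaying_ddc Q g h (K B : R) psi dpsi l x : wkb_corr Q g h K ->
  (forall y : R, cabs (Q y) <= B) -> (forall m, decaying Q g h m (psi m) (dpsi m)) ->
  ddc (fun m => psi m x) l /\ ddc (fun m => dpsi m x) l.
Proof.
move=> W QB H; have [X X1 [D1 D2]] := decaying_ddc_far l W H.
have Dz : ddc (fun m => wz h m X) l.
  pose L : C := (ln (Num.sqrt 2 * X))%:C.
  rewrite (_ : (fun m => _) = fun m => cexp (m * (L / 2)) *
     cexp (- (L / 2) + (- (X ^+ 2) / 2)%:C + h X)).
    exact: ddcM (ddc_cexp _ _) (ddc_cst _ _).
  apply/funext => m; rewrite wzE -cexpD /wphase -/L; congr cexp.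
  by rewrite !addrA; congr (_ + _ + _); field.
have Db : ddc (fun m => wb g m X) l.
  rewrite (_ : (fun m => _) = fun m => m * ((X^-1)%:C / 2) + (- ((X^-1)%:C / 2) - X%:C + g X)).
    exact: ddcD (ddcM (ddc_id _) (ddc_cst _ _)) (ddc_cst _ _).
  by apply/funext => m; rewrite /wb; move: (X^-1)%:C => xi; field.
apply: (@ddc_propagate Q B X x psi dpsi l QB).
- by move=> m; case: (H m).
- rewrite (_ : (fun m => _) = fun m => wz h m X * wu h m (psi m) X); first exact: ddcM.
  by apply/funext => m; exact: wuK.
- rewrite (_ : (fun m => _) = fun m => wz h m X * (wp g h m (psi m) (dpsi m) X +
     wb g m X * wu h m (psi m) X)); first by apply: ddcM => //; apply: ddcD => //; exact: ddcM.
  by apply/funext => m; exact: wpK.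
Qed.

End EntireSolutions.

(** * Simplicity of eigenvalues *)

Section Uniqueness.
Context {R : realType}.
Local Notation C := (Cplx R).
Local Notation mu := (@lebesgue_measure R).
Implicit Types (Q g h y dy u du : R -> C) (l m : C) (x : R).

Lemma rder_locally0 (f : R -> R) x d : is_derive x 1 f d ->
  (forall t, x - 1 < t < x + 1 -> f t = 0) -> d = 0.
Proof.
move=> [df <-] H; rewrite /derive; apply/cvg_lim => //.
apply: cvg_near_cst; near=> k.
have k1 : `|k| < 1 by near: k; apply: dnbhs0_lt.
move: k1; rewrite ltr_norml => /andP[k1 k2].
rewrite /= /GRing.scale/= mulr1 !H ?subrr ?mulr0//; apply/andP; split; lra.
Unshelve. all: by end_near. Qed.

Lemma csol_vanish Q l (B : R) u du X : (forall t, cabs (Q t) <= B) ->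
  csol Q l (fun=> 0) u du -> (forall x, X <= x -> u x = 0) ->
  forall x, u x = 0 /\ du x = 0.
Proof.
move=> QB H uX; apply: (csol_unique QB H (x0 := X + 1)); first by apply: uX; lra.
have [[d1 d2] _] := H (X + 1).
apply: cext.
  apply: (rder_locally0 d1) => t /andP[t1 t2] /=; rewrite uX//; lra.
apply: (rder_locally0 d2) => t /andP[t1 t2] /=; rewrite uX//; lra.
Qed.

Lemma csol_comb Q l y1 dy1 y2 dy2 (a b : C) : csol Q l (fun=> 0) y1 dy1 ->
  csol Q l (fun=> 0) y2 dy2 ->
  csol Q l (fun=> 0) (fun x => a * y1 x - b * y2 x) (fun x => a * dy1 x - b * dy2 x).
Proof.
move=> H1 H2; apply: csol_ext (csolB (csolZ a H1) (csolZ b H2)) _.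
by move=> x /=; rewrite !mulr0 subrr.
Qed.

Lemma cabs_comb_sq (a b z w : C) : cabs (a * z - b * w) ^+ 2 <=
  2 * cabs a ^+ 2 * cabs z ^+ 2 + 2 * cabs b ^+ 2 * cabs w ^+ 2.
Proof.
apply: le_trans (_ : (cabs a * cabs z + cabs b * cabs w) ^+ 2 <= _).
  apply: lerXn2r; rewrite ?nnegrE ?cabs_ge0 ?addr_ge0 ?mulr_ge0 ?cabs_ge0//.
  by rewrite -(cabsM a) -(cabsM b); exact: cabsB.
have := sqr_ge0 (cabs a * cabs z - cabs b * cabs w); nra.
Qed.

(** If the modulus were [s > 0] at [x], its square would integrate to at least [n s^2] over
    [[x, x + n]] for every [n]. The majorant [f] is used because it is a linear combination of
    [|y1|^2] and [|y2|^2], hence integrable. *)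
Lemma L2_comb_nondecr y1 y2 (a b : C) X : L2 y1 -> L2 y2 ->
  (forall x t, X <= x -> x <= t -> cabs (a * y1 x - b * y2 x) <= cabs (a * y1 t - b * y2 t)) ->
  forall x, X <= x -> a * y1 x - b * y2 x = 0.
Proof.
move=> [_ _ i1] [_ _ i2] H x Xx; apply: cabs_eq0; apply/eqP.
rewrite eq_le cabs_ge0 andbT leNgt; apply/negP => s0.
set s := cabs (a * y1 x - b * y2 x) in s0; have ss0 : 0 < s ^+ 2 by rewrite exprn_gt0.
pose f (t : R) : R := 2 * cabs a ^+ 2 * cabs (y1 t) ^+ 2 + 2 * cabs b ^+ 2 * cabs (y2 t) ^+ 2.
have fi : mu.-integrable setT (EFin \o f).
  rewrite (_ : EFin \o f = ((fun t => (2 * cabs a ^+ 2)%:E * (cabs (y1 t) ^+ 2)%:E) \+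
      (fun t => (2 * cabs b ^+ 2)%:E * (cabs (y2 t) ^+ 2)%:E))%E); last exact/funext.
  by apply: integrableD => //; apply: integrableZl.
have f0 t : 0 <= f t by apply: addr_ge0; apply: mulr_ge0; rewrite ?sqr_ge0// mulr_ge0 ?sqr_ge0.
have mf := measurable_int mu fi.
have bd n : s ^+ 2 * n%:R <= fine (\int[mu]_t (f t)%:E)%E.
  have xn : x <= x + n%:R by rewrite lerDl.
  rewrite -lee_fin fineK; last by apply: integrable_fin_num fi.
  apply: le_trans (_ : (\int[mu]_(t in `[x, (x + n%:R)%R]) (f t)%:E <= _)%E); last first.
    by apply: ge0_subset_integral => // t _; rewrite lee_fin.
  have -> : ((s ^+ 2 * n%:R)%:E = \int[mu]_(t in `[x, (x + n%:R)%R]) (s ^+ 2)%:E)%E.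
    rewrite integral_cst//= lebesgue_measure_itv/= lte_fin EFinM.
    case: ifPn => [_|]; first by rewrite -EFinD addrAC subrr add0r.
    by rewrite -leNgt gerDl lern0 => /eqP ->.
  apply: ge0_le_integral => //.
  - by move=> t _; rewrite lee_fin ltW.
  - exact: measurable_funTS.
  - move=> t /=; rewrite in_itv/= lee_fin => /andP[xt _].
    apply: le_trans (cabs_comb_sq a b (y1 t) (y2 t)).
    by apply: lerXn2r; rewrite ?nnegrE ?cabs_ge0// H.
set I := fine _ in bd.
have I0 : 0 <= I by have := bd 0%N; rewrite mulr0.
have J0 : 0 <= I / s ^+ 2 by rewrite divr_ge0// ltW.
have := archi_boundP J0; rewrite ltr_pdivrMr// mulrC.
by rewrite ltNge bd.
Qed.

(** The combination [y2(X) y1 - y1(X) y2] vanishes at [X], so for [X] large it has nondecreasing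
    modulus while being square integrable, and is zero. The same argument applied to [y1] alone
    excludes [y1(X) = 0]. *)
Lemma eigenfunction_unique Q l (B : R) y1 dy1 y2 dy2 : (forall t, cabs (Q t) <= B) ->
  csol Q l (fun=> 0) y1 dy1 -> csol Q l (fun=> 0) y2 dy2 -> L2 y1 -> L2 y2 ->
  ~ (forall x, y1 x = 0) -> exists c : C, forall x, y2 x = c * y1 x.
Proof.
move=> QB H1 H2 i1 i2 ny1.
have B0 : 0 <= B by exact: le_trans (cabs_ge0 _) (QB 0).
pose X := 1 + `|cRe l| + 4 * B ^+ 2.
have b2 : 0 <= 4 * B ^+ 2 by rewrite mulr_ge0 ?sqr_ge0.
have X1 : 1 <= X by rewrite /X; have := normr_ge0 (cRe l); lra.
have X0 : 0 <= X := le_trans ler01 X1.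
have XX : cRe l + 4 * B ^+ 2 <= X ^+ 2.
  apply: le_trans (_ : X <= _); last by rewrite expr2 ler_peMr.
  by rewrite /X; have := ler_norm (cRe l); lra.
have van (a b : C) : a * y1 X - b * y2 X = 0 -> forall x, a * y1 x - b * y2 x = 0.
  move=> uX x; have Hu := csol_comb a b H1 H2.
  have [] := csol_vanish QB Hu (L2_comb_nondecr i1 i2 (csol_sq_nondecr QB Hu X0 XX uX)) x.
  by [].
have [y1X|y1X] := eqVneq (y1 X) 0.
  exfalso; apply: ny1 => x; have := van 1 0.
  by rewrite !mul0r !mul1r !subr0 => /(_ y1X x); rewrite mul0r mul1r subr0.
exists (y2 X / y1 X) => x.
have := van (y2 X) (y1 X); rewrite [y1 X * _]mulrC subrr => /(_ erefl x)/eqP.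
by rewrite subr_eq0 => /eqP e; apply: (mulfI y1X); rewrite -e; field.
Qed.

End Uniqueness.

(** * Asymptotics and uniqueness at [+oo] *)

Section PlusSide.
Context {R : realType}.
Local Notation C := (Cplx R).
Implicit Types (Q g h y dy u du : R -> C) (l m : C) (x : R).

(** [|z|^2 x] is nonincreasing, because [(|z|^2)' <= - x |z|^2] and [x^2 >= 1]. This weak rate
    suffices to make [z] tend to [0]. *)
Lemma wkb_data_sq_le (b z rho : R -> C) (X c : R) x : wkb_data b z rho X c -> X <= x ->
  cabs (z x) ^+ 2 <= cabs (z X) ^+ 2 * X / x.
Proof.
move=> [X1 c0 _ H] Xx; have x0 : 0 < x by rewrite (lt_le_trans _ Xx)// (lt_le_trans _ X1).
rewrite ler_pdivlMr// -!cdotxx -lerN2.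
pose M t := cdot (z t) (z t).
apply: (@is_derive_nondecr _ (fun t => - (M t * t)) (fun t => - (2 * cRe (b t) * M t * t + M t * 1)) _ _ Xx)
  => t /andP[Xt _]; have [zt _ bt _] := H t Xt.
  have Mt : is_derive t 1 M (2 * cRe (b t) * M t).
    by apply: rder_eq (rder_cdot zt zt) _; rewrite /M /cdot !cReIm; ring.
  exact: rderN (rderM Mt (rder_id t)).
have M0 : 0 <= M t by rewrite /M cdotxx sqr_ge0.
have t1 : 1 <= t := le_trans X1 Xt.
rewrite -mulrA mulr1.
have h1 : 2 * cRe (b t) * (M t * t) <= - t * (M t * t).
  by apply: ler_wpM2r => //; rewrite mulr_ge0//; lra.
have h2 : M t <= t * (M t * t).
  by rewrite mulrCA ler_peMr// -expr2 exprn_ege1.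
lra.
Qed.

Lemma compact_cabs_bounded (A : set C) : compact A ->
  exists2 r : R, 0 <= r & forall l, A l -> cabs l <= r.
Proof.
move=> cA; have [[l0 Al0]|A0] := pselect (exists l, A l); last first.
  by exists 0 => // l Al; exfalso; apply: A0; exists l.
have cc : continuous (@cabs R).
  move=> z; apply/(@cvgrPdist_le _ _ _ _ (@nbhs_filter C z)) => e e0; have e0' : 0 < e%:C :> C by rewrite ltcR.
  exists e%:C => // w /=; rewrite cabs_norm ltcR => zw.
  have h1 := cabs_triB z w; have h2 := cabs_triB w z; rewrite (cabsBC w) in h2.
  rewrite ler_norml; apply/andP; split; lra.
have A0 : (A !=set0)%classic by exists l0.
have [c _ Hc] := compact_EVT_max A0 cA (continuous_subspaceT cc).
by exists (cabs c); [exact: cabs_ge0|move=> l Al; apply: Hc; rewrite inE].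
Qed.

Lemma cexp_sub1 (w : C) : cabs w <= 1 -> cabs (cexp w - 1) <= (1 + expR 1) * cabs w.
Proof.
move=> w1; have h1 := cexp_taylor w1; have W0 := cabs_ge0 w.
have h2 := cabsD (cexp w - 1 - w) w; rewrite subrK in h2.
have : expR 1 * cabs w ^+ 2 <= expR 1 * cabs w.
  by rewrite ler_wpM2l ?expR_ge0// expr2 ler_piMr.
lra.
Qed.

Lemma decaying_asymptotics Q g h (K r : R) : wkb_corr Q g h K -> 0 <= r ->
  exists A X0 : R, 1 <= X0 /\ forall l y dy, cabs l <= r -> decaying Q g h l y dy ->
    forall x, X0 <= x -> cabs (y x - pref_p l x) <= A / x * cabs (pref_p l x) /\
      cabs (dy x - dpref_p l x) <= A / x * cabs (dpref_p l x).
Proof.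
move=> W r0; have [K0 W2] := W; have [X [D [X1 D0 HD]]] := decaying_uniform W r0.
pose e := expR 1 : R; have e0 : 0 <= e by exact: expR_ge0.
pose A1 := (2 + e) * D + (1 + e) * K.
pose A2 := (2 + e) * D + (2 + e) * ((r + 1 + K) * (1 + D)) + A1.
(* Beyond [X + K] one has [|h x| <= K / x <= 1], the range in which [cexp_sub1] applies. *)
exists (A1 + A2), (X + K); split; first by rewrite -[leLHS]addr0 lerD.
move=> l y dy lr Hd x XKx; have Xx : X <= x by apply: le_trans XKx; rewrite lerDl.
have x1 : 1 <= x := le_trans X1 Xx; have x0 : 0 < x := lt_le_trans ltr01 x1.
have [uD pD] := HD l y dy lr Hd x Xx; have [_ _ gx hx] := W2 x x1.
have xi0 : 0 <= x^-1 by rewrite invr_ge0 ltW.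
have xi1 : x^-1 <= 1 by rewrite invf_le1.
have A10 : 0 <= A1 by apply: addr_ge0; apply: mulr_ge0 => //; exact: addr_ge0.
have A20 : 0 <= A2.
  apply: addr_ge0 => //; apply: addr_ge0; apply: mulr_ge0; try exact: addr_ge0; first by [].
  by apply: mulr_ge0; [apply: addr_ge0 => //; exact: addr_ge0|exact: addr_ge0].
set u := wu h l y x in uD; set p := wp g h l y dy x in pD.
pose E := cexp (h x).
have Kx : K / x <= 1 by rewrite ler_pdivrMr// mul1r; apply: le_trans XKx; rewrite lerDr (le_trans _ X1).
have h1 : cabs (h x) <= 1 := le_trans hx Kx.
have E1 : cabs (E - 1) <= (1 + e) * (K / x).
  by apply: le_trans (cexp_sub1 h1) _; apply: ler_wpM2l => //; exact: addr_ge0.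
have Ebd : cabs E <= 2 + e.
  have h2 := cabs_triB E 1; rewrite cabs1 in h2.
  have h3 : (1 + e) * (K / x) <= (1 + e) * 1 by apply: ler_wpM2l => //; exact: addr_ge0.
  lra.
have ubd : cabs (u - 1) <= D / x.
  apply: le_trans uD _; rewrite ler_wpM2l// lef_pV2 ?posrE ?exprn_gt0//.
  by rewrite expr2 ler_peMr// ltW.
have u1 : cabs u <= 1 + D.
  have h2 := cabs_triB u 1; rewrite cabs1 in h2.
  have : D / x <= D by rewrite ler_piMr.
  lra.
have pbd : cabs p <= D.
  apply: le_trans pD _; have x3 : 1 <= x ^+ 3 by exact: exprn_ege1.
  by rewrite ler_pdivrMr ?(lt_le_trans _ x3)// ler_peMr.
have Eu : cabs (E * u - 1) <= A1 / x.
  rewrite (_ : E * u - 1 = E * (u - 1) + (E - 1)); last by ring.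
  rewrite (_ : A1 / x = (2 + e) * (D / x) + (1 + e) * (K / x)); last by rewrite /A1; ring.
  apply: le_trans (cabsD _ _) _; apply: lerD => //.
  by rewrite (cabsM E); apply: ler_pM; rewrite ?cabs_ge0.
have yE : y x = pref_p l x * (E * u) by rewrite (wuK h l y) -/u /wz -/E; ring.
have dyE : dy x = pref_p l x * (E * (p + wb g l x * u)).
  by rewrite (wpK g h l y dy) -/u -/p /wz -/E; ring.
have pr0 := cabs_ge0 (pref_p l x).
have A12 : A1 / x <= (A1 + A2) / x by apply: ler_wpM2r => //; lra.
split.
  rewrite yE -[X in _ - X]mulr1 -mulrBr (cabsM (pref_p l x)) mulrC ler_wpM2r//.
  exact: le_trans A12.
rewrite dyE /dpref_p (_ : _ - _ = pref_p l x * (E * (p + wb g l x * u) + x%:C)); last by ring.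
rewrite (cabsM (pref_p l x)) (cabsM (- _)) cabsN cabsC (ger0_norm (ltW x0)).
rewrite mulrA divfK ?gt_eqF// mulrC ler_wpM2r//.
(* [G] is the bounded part of [wb = G - x]. Relative to [pref_p], the error in [dy] is
   [E p + E G u - x (E u - 1)], each term bounded; dividing by [|dpref_p| = x |pref_p|] yields the
   factor [1/x]. *)
set G := (l - 1) / 2 * (x^-1)%:C + g x.
have Gbd : cabs G <= r + 1 + K.
  apply: le_trans (cabsD _ _) _; apply: lerD; last first.
    by apply: le_trans gx _; rewrite ler_piMr.
  rewrite (cabsM (_ / _)) (cabsM (_ - _)) cabsV (cabs_nat 2) cabsC ger0_norm//.
  have h2 : cabs (l - 1) <= r + 1 by apply: le_trans (cabsB _ _) _; rewrite cabs1 lerD2r.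
  have h3 : cabs (l - 1) / 2 <= r + 1 by have := cabs_ge0 (l - 1); lra.
  by rewrite -[leRHS]mulr1; apply: ler_pM => //; rewrite divr_ge0 ?cabs_ge0.
rewrite (_ : _ + x%:C = E * p + E * (G * u) - x%:C * (E * u - 1)); last by rewrite /wb /G; ring.
apply: le_trans (cabsB _ _) _.
have b1 : cabs (E * p) <= (2 + e) * D by rewrite (cabsM E); apply: ler_pM; rewrite ?cabs_ge0.
have b2 : cabs (E * (G * u)) <= (2 + e) * ((r + 1 + K) * (1 + D)).
  rewrite (cabsM E) (cabsM G); apply: ler_pM; rewrite ?cabs_ge0 ?mulr_ge0 ?cabs_ge0//.
  by apply: ler_pM; rewrite ?cabs_ge0.
have b3 : cabs (x%:C * (E * u - 1)) <= A1.
  rewrite (cabsM x%:C) cabsC (ger0_norm (ltW x0)).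
  apply: le_trans (_ : x * (A1 / x) <= _); first by apply: ler_wpM2l => //; exact: ltW.
  by rewrite mulrC divfK// gt_eqF.
have b12 := cabsD (E * p) (E * (G * u)).
have : A2 = (2 + e) * D + (2 + e) * ((r + 1 + K) * (1 + D)) + A1 by [].
move: A2 A20 {A12} => A2' _ ->; lra.
Qed.

Lemma plus_side Q (B M : R) : ccont Q -> (forall t, cabs (Q t) <= B) -> 0 <= M ->
  (forall s t, cabs (Q s - Q t) <= M * `|s - t|) ->
  exists psi dpsi : C -> R -> C,
    [/\ forall l, csol Q l (fun=> 0) (psi l) (dpsi l),
        uasym_p psi pref_p, uasym_p dpsi dpref_p,
        (forall l y dy, csol Q l (fun=> 0) y dy -> asym_p y (pref_p l) ->
           y = psi l /\ dy = dpsi l) &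
        forall l x, ddc (fun m => psi m x) l /\ ddc (fun m => dpsi m x) l].
Proof.
move=> cQ QB M0 QM; have B0 : 0 <= B by exact: le_trans (cabs_ge0 _) (QB 0).
have [g [h [K K0 W0]]] := wkb_correction cQ QB QM M0.
have W : wkb_corr Q g h K by [].
have /choice[PP HPP] : forall l, exists yd : (R -> C) * (R -> C), decaying Q g h l yd.1 yd.2.
  by move=> l; have [y [dy Hy]] := decaying_exists l W cQ QB; exists (y, dy).
pose psi l := (PP l).1; pose dpsi l := (PP l).2.
have Hpsi l : decaying Q g h l (psi l) (dpsi l) by exact: HPP.
have as_of A X0 (eps : R) : 1 <= X0 -> 0 < eps ->
    exists2 X : R, X0 <= X & forall x, X <= x -> A / x <= eps.
  move=> X01 e0; exists (X0 + `|A| / eps).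
    by rewrite lerDl divr_ge0// ltW.
  move=> x Xx; have x0 : 0 < x.
    by apply: lt_le_trans Xx; rewrite ltr_pwDl ?(lt_le_trans _ X01)// divr_ge0// ltW.
  rewrite ler_pdivrMr//; apply: le_trans (ler_norm _) _.
  rewrite mulrC -ler_pdivrMr//; apply: le_trans Xx.
  by rewrite lerDr (le_trans _ X01).
have uas eps (A : set C) : compact A -> 0 < eps -> exists X : R, forall x, X <= x ->
    forall l, A l -> cabs (psi l x - pref_p l x) <= eps * cabs (pref_p l x) /\
      cabs (dpsi l x - dpref_p l x) <= eps * cabs (dpref_p l x).
  move=> cA e0; have [r r0 Ar] := compact_cabs_bounded cA.
  have [A' [X0 [X01 HA]]] := decaying_asymptotics W r0.
  have [X XX0 HX] := as_of A' X0 eps X01 e0.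
  exists X => x Xx l Al; have [h1 h2] := HA l _ _ (Ar l Al) (Hpsi l) x (le_trans XX0 Xx).
  by split; [apply: le_trans h1 _|apply: le_trans h2 _]; rewrite ler_wpM2r ?cabs_ge0 ?HX.
exists psi, dpsi; split.
- by move=> l; case: (Hpsi l).
- move=> A cA eps e0; have [X HX] := uas eps A cA e0.
  by exists X => x Xx l Al; case: (HX x Xx l Al).
- move=> A cA eps e0; have [X HX] := uas eps A cA e0.
  by exists X => x Xx l Al; case: (HX x Xx l Al).
- move=> l y dy Hy ay; have [Hs _] := Hpsi l.
  have c1 : compact [set l] by exact: compact_set1.
  have aps eps : 0 < eps -> exists X : R, forall x, X <= x ->
      cabs (psi l x - pref_p l x) <= eps * cabs (pref_p l x).
    by move=> e0; have [X HX] := uas eps _ c1 e0; exists X => x Xx; case: (HX x Xx l erefl).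
  have h2 : 0 < 2^-1 :> R by rewrite invr_gt0.
  have [X1 HX1] := aps _ h2; have [X2 HX2] := ay _ h2.
  have [X3 [c HX3]] := wkb_data_ex W (cabs_ge0 l).
  have data := HX3 l (lexx _); have [X31 _ _ _] := data.
  pose X4 := 1 + `|cRe l| + 4 * B ^+ 2.
  pose X := Num.max (Num.max X1 X2) (Num.max X3 X4).
  have XX1 : X1 <= X by rewrite !le_max lexx.
  have XX2 : X2 <= X by rewrite !le_max lexx orbT.
  have XX3 : X3 <= X by rewrite !le_max lexx !orbT.
  have XX4 : X4 <= X by rewrite !le_max lexx !orbT.
  have X_1 : 1 <= X := le_trans X31 XX3; have X_0 : 0 <= X := le_trans ler01 X_1.
  have XX : cRe l + 4 * B ^+ 2 <= X ^+ 2.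
    apply: le_trans (_ : X <= _); last by rewrite expr2 ler_peMr.
    by apply: le_trans XX4; rewrite /X4; have := ler_norm (cRe l); lra.
  have pref0 x : pref_p l x != 0.
    have := wz_neq0 h l x; rewrite /wz mulf_eq0 negb_or => /andP[] //.
  have prefpos x : 0 < cabs (pref_p l x) by rewrite cabs_gt0.
  (* The choice [eps = 1/2] keeps [psi] at distance at most half of [|pref_p|] from [pref_p]. *)
  have psi0 : psi l X != 0.
    rewrite -cabs_gt0; have := HX1 X XX1; have := prefpos X.
    have := cabs_triB (pref_p l X) (psi l X); rewrite cabsBC; lra.
  (* The combination [a y - b psi] vanishes at [X], hence has nondecreasing modulus; it is also at
     most a multiple of [|z|], which tends to [0], so it is zero. *)
  pose a := psi l X; pose b := y X.
  have Hu := csol_comb a b Hy Hs.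
  have uX : a * y X - b * psi l X = 0 by rewrite /a /b mulrC subrr.
  have mono := csol_sq_nondecr QB Hu X_0 XX uX.
  have pref_z x : X <= x -> cabs (pref_p l x) <= expR K * cabs (wz h l x).
    move=> Xx; have x1 := le_trans X_1 Xx; have [_ _ _ hx] := W0 x x1.
    rewrite /wz (cabsM (pref_p l x)) mulrCA ler_peMr ?cabs_ge0// cabs_cexp -expRD.
    apply: expR_ge1; have := le_trans (ler_cRe (h x)) hx; rewrite ler_norml => /andP[h1 _].
    have : K / x <= K by rewrite ler_pdivrMr ?(lt_le_trans _ x1)// ler_peMr.
    lra.
  have uz x : X <= x -> a * y x - b * psi l x = 0.
    move=> Xx; apply: cabs_eq0; apply/eqP; rewrite -sqrf_eq0 eq_le sqr_ge0 andbT.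
    pose k := (cabs a + cabs b) * 2 * expR K.
    have k0 : 0 <= k by rewrite !mulr_ge0 ?expR_ge0 ?addr_ge0 ?cabs_ge0.
    have ubd t : x <= t -> cabs (a * y t - b * psi l t) <= k * cabs (wz h l t).
      move=> xt; have Xt := le_trans Xx xt.
      have d1 := HX1 t (le_trans XX1 Xt); have d2 := HX2 t (le_trans XX2 Xt).
      have p0 := prefpos t; have pz := pref_z t Xt.
      have e1 := cabs_triB (psi l t) (pref_p l t); have e2 := cabs_triB (y t) (pref_p l t).
      have f1 : cabs (psi l t) <= 2 * cabs (pref_p l t) by lra.
      have f2 : cabs (y t) <= 2 * cabs (pref_p l t) by lra.
      apply: le_trans (cabsB _ _) _; rewrite (cabsM a) (cabsM b).
      have g1 : cabs a * cabs (y t) <= cabs a * (2 * (expR K * cabs (wz h l t))).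
        by apply: ler_wpM2l; [exact: cabs_ge0|lra].
      have g2 : cabs b * cabs (psi l t) <= cabs b * (2 * (expR K * cabs (wz h l t))).
        by apply: ler_wpM2l; [exact: cabs_ge0|lra].
      by apply: le_trans (lerD g1 g2) _; apply: eqW_le; rewrite /k; ring.
    apply/ler_addgt0Pr => eps e0; rewrite add0r.
    have [X5 xX5 HX5] := as_of (k ^+ 2 * (cabs (wz h l X3) ^+ 2 * X3)) X eps X_1 e0.
    pose t := Num.max x X5.
    have xt : x <= t by rewrite le_max lexx.
    have X5t : X5 <= t by rewrite le_max lexx orbT.
    apply: le_trans (_ : cabs (a * y t - b * psi l t) ^+ 2 <= _).
      by apply: lerXn2r; rewrite ?nnegrE ?cabs_ge0// mono.
    apply: le_trans (_ : (k * cabs (wz h l t)) ^+ 2 <= _).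
      apply: lerXn2r; [by rewrite nnegrE cabs_ge0| |exact: ubd].
      by rewrite nnegrE; apply: mulr_ge0 => //; exact: cabs_ge0.
    apply: le_trans (HX5 t X5t); rewrite exprMn -[leRHS]mulrA; apply: ler_wpM2l; first exact: sqr_ge0.
    exact: wkb_data_sq_le data (le_trans XX3 (le_trans Xx xt)).
  have all0 := csol_vanish QB Hu uz.
  pose k := b / a.
  have yk x : y x = k * psi l x.
    have [/eqP + _] := all0 x; rewrite subr_eq0 => /eqP e.
    by apply: (mulfI psi0); rewrite -/a e /k mulrA mulrCA mulfV// mulr1.
  have dyk x : dy x = k * dpsi l x.
    have [_ /eqP] := all0 x; rewrite subr_eq0 => /eqP e.
    by apply: (mulfI psi0); rewrite -/a e /k mulrA mulrCA mulfV// mulr1.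
  (* Both [y = k psi] and [psi] are asymptotic to [pref_p], and [(k - 1) pref_p = (y - pref_p) - k
     (psi - pref_p)]; the tolerance [eps / (1 + |k|)] accounts for both errors. *)
  have k1 : k = 1.
    apply/eqP; rewrite -subr_eq0; apply/eqP/cabs_eq0/eqP; rewrite eq_le cabs_ge0 andbT.
    apply/ler_addgt0Pr => eps e0; rewrite add0r.
    pose d := eps / (1 + cabs k).
    have k0 : 0 < 1 + cabs k by rewrite ltr_pwDl// cabs_ge0.
    have d0 : 0 < d by rewrite divr_gt0.
    have [Y1 HY1] := aps d d0; have [Y2 HY2] := ay d d0.
    pose x := Num.max Y1 Y2.
    have e1 := HY1 x _; have e2 := HY2 x _.
    have {}e1 : cabs (psi l x - pref_p l x) <= d * cabs (pref_p l x) by apply: e1; rewrite le_max lexx.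
    have {}e2 : cabs (y x - pref_p l x) <= d * cabs (pref_p l x) by apply: e2; rewrite le_max lexx orbT.
    rewrite -(ler_pM2r (prefpos x)) -(cabsM (k - 1)).
    rewrite (_ : (k - 1) * pref_p l x = (y x - pref_p l x) - k * (psi l x - pref_p l x)); last first.
      by rewrite yk; ring.
    apply: le_trans (cabsB _ _) _; rewrite (cabsM k).
    have e3 : cabs k * cabs (psi l x - pref_p l x) <= cabs k * (d * cabs (pref_p l x)).
      by apply: ler_wpM2l => //; exact: cabs_ge0.
    apply: le_trans (lerD e2 e3) _.
    rewrite (_ : _ + _ = d * (1 + cabs k) * cabs (pref_p l x)); last by ring.
    by rewrite /d divfK// gt_eqF.
  by split; apply/funext => x; rewrite ?yk ?dyk k1 mul1r.
- by move=> l x; exact: (decaying_ddc l x W QB Hpsi).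
Qed.

End PlusSide.

(** * The reflection [x -> - x] *)

Section Reflection.
Context {R : realType}.
Local Notation C := (Cplx R).
Implicit Types (Q y dy : R -> C) (l : C) (x : R).

Lemma cder_reflect (f : R -> C) x (d : C) : cder f (- x) d -> cder (fun t => f (- t)) x (- d).
Proof.
move=> [a b]; split; rewrite !cReIm -mulrN1.
  exact: (is_derive1_comp (f := cRe \o f) (g := fun t => - t) a (rderN (rder_id x))).
exact: (is_derive1_comp (f := cIm \o f) (g := fun t => - t) b (rderN (rder_id x))).
Qed.

(** [- Q (- x)] is the primitive of the reflected potential [q (- x)] when [Q] is the one of [q];
    the outer sign compensates the reversed orientation. *)
Lemma csol_reflect Q l y dy : csol Q l (fun=> 0) y dy ->
  csol (fun x => - Q (- x)) l (fun=> 0) (fun x => y (- x)) (fun x => - dy (- x)).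
Proof.
move=> H x; have [h1 h2] := H (- x); split; first exact: cder_reflect.
rewrite (_ : (fun t => _) = (fun t => - (dy (- t) - Q (- t) * y (- t)))).
  by apply: cder_eq (cderN (cder_reflect h2)) _; rewrite sqrrN; ring.
by apply/funext => t; ring.
Qed.

Lemma csol_reflectK Q l y dy : csol (fun x => - Q (- x)) l (fun=> 0) y dy ->
  csol Q l (fun=> 0) (fun x => y (- x)) (fun x => - dy (- x)).
Proof.
move=> /csol_reflect; congr (csol _ _ _ _ _).
by apply/funext => x; rewrite !opprK.
Qed.

Lemma pref_mE l x : pref_m l x = pref_p l (- x).
Proof. by rewrite /pref_m /pref_p mulrN sqrrN. Qed.

Lemma dpref_mE l x : dpref_m l x = - dpref_p l (- x).
Proof. by rewrite /dpref_m /dpref_p pref_mE rmorphN/= opprK mulNr. Qed.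

Lemma ccont_reflect (f : R -> C) : ccont f -> ccont (fun x => - f (- x)).
Proof.
move=> [f1 f2]; apply: (@ccontN _ (fun x => f (- x))); split=> x.
  by apply: (@continuous_comp _ _ _ -%R (cRe \o f)); [exact: opp_continuous|exact: f1].
by apply: (@continuous_comp _ _ _ -%R (cIm \o f)); [exact: opp_continuous|exact: f2].
Qed.

End Reflection.

(** * Assembly of both half-lines *)

Theorem theorem2p1 (R : realType) (q : R -> Cplx R) :
  Linfty q -> Linfty (prim q) ->
  (exists psi_p psi_m dpsi_p dpsi_m : Cplx R -> R -> Cplx R,
    [/\ forall l, ode_sol q l (psi_p l) (dpsi_p l) /\ ode_sol q l (psi_m l) (dpsi_m l),
        uasym_p psi_p pref_p /\ uasym_p dpsi_p dpref_p,
        uasym_m psi_m pref_m /\ uasym_m dpsi_m dpref_m,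
        (forall l y dy, ode_sol q l y dy ->
           asym_p y (pref_p l) -> asym_p dy (dpref_p l) ->
           y = psi_p l /\ dy = dpsi_p l) /\
        (forall l y dy, ode_sol q l y dy ->
           asym_m y (pref_m l) -> asym_m dy (dpref_m l) ->
           y = psi_m l /\ dy = dpsi_m l) &
        forall x : R,
          [/\ entire (fun l => psi_p l x), entire (fun l => dpsi_p l x),
              entire (fun l => psi_m l x), entire (fun l => dpsi_m l x) &
              entire (fun l => psi_m l x * dpsi_p l x - dpsi_m l x * psi_p l x)]])
  /\
  ((forall x, cIm (q x) = 0) ->
   forall (l : Cplx R) (y1 y2 : R -> Cplx R),
     eigenfunction q l y1 -> eigenfunction q l y2 ->
     exists c : Cplx R, forall x, y2 x = c * y1 x).
Proof.
move=> qL QL; have cQ := prim_ccont qL.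
have [B QB] := prim_bounded qL QL; have [M M0 QM] := prim_lipschitz qL.
split; last first.
  move=> _ l y1 y2 [[dy1 H1] [i1 n1]] [[dy2 H2] [i2 _]].
  have S1 := (ode_solP l y1 dy1 qL).1 H1; have S2 := (ode_solP l y2 dy2 qL).1 H2.
  apply: (eigenfunction_unique QB S1 S2 i1 i2) => y10; apply: n1.
  exact: aeW.
have [psi [dpsi [P1 P2 P3 P4 P5]]] := plus_side cQ QB M0 QM.
(* The reflected primitive keeps the bound [B] and the Lipschitz constant [M], so the result at
   [+oo] applies to it unchanged. *)
pose Q' x := - prim q (- x).
have QB' t : cabs (Q' t) <= B by rewrite cabsN.
have QM' s t : cabs (Q' s - Q' t) <= M * `|s - t|.
  rewrite /Q' -opprD cabsN; apply: le_trans (QM _ _) _.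
  by rewrite -opprD normrN.
have [phi [dphi [N1 N2 N3 N4 N5]]] := plus_side (ccont_reflect cQ) QB' M0 QM'.
pose psi_m l x := phi l (- x); pose dpsi_m l x := - dphi l (- x).
have Dm l x : ddc (fun m => psi_m m x) l /\ ddc (fun m => dpsi_m m x) l.
  have [d1 d2] := N5 l (- x); split => //.
  rewrite (_ : (fun m => _) = fun m => -1 * dphi m (- x)).
    exact: ddcM (ddc_cst _ _) d2.
  by apply/funext => m; rewrite mulN1r.
exists psi, psi_m, dpsi, dpsi_m; split.
- move=> l; split; apply/(ode_solP _ _ _ qL); first exact: P1.
  exact/csol_reflectK/N1.
- by [].
- split=> A cA eps e0.
    have [X HX] := N2 A cA eps e0; exists (- X) => x xX l Al.
    by rewrite pref_mE; apply: HX => //; rewrite lerNr.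
  have [X HX] := N3 A cA eps e0; exists (- X) => x xX l Al.
  by rewrite dpref_mE -opprD !cabsN; apply: HX => //; rewrite lerNr.
- split=> l y dy /(ode_solP _ _ _ qL) Hy ay _; first exact: P4.
  have ay' : asym_p (fun x => y (- x)) (pref_p l).
    move=> eps e0; have [X HX] := ay eps e0; exists (- X) => x xX.
    by have := HX (- x); rewrite pref_mE opprK; apply; rewrite lerNl.
  have [e1 e2] := N4 l _ _ (csol_reflect Hy) ay'.
  split; apply/funext => x.
    by rewrite /psi_m -e1 opprK.
  by rewrite /dpsi_m -e2 !opprK.
- move=> x; split=> l; apply: ddc_derivable.
  + by case: (P5 l x).
  + by case: (P5 l x).
  + by case: (Dm l x).
  + by case: (Dm l x).
  have [p1 p2] := P5 l x; have [m1 m2] := Dm l x.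
  rewrite (_ : (fun m => _) = fun m => psi_m m x * dpsi m x + -1 * (dpsi_m m x * psi m x)).
    exact: ddcD (ddcM m1 p2) (ddcM (ddc_cst _ _) (ddcM m2 p1)).
  by apply/funext => m; rewrite mulN1r.
Qed.
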